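(* Let $\Lambda$ be a representation-directed finite-dimensional (basic) algebra over a field $K$. Then there exists a partial order on the set of (isomorphism classes of) bricks in $\mathrm{mod}\,\Lambda$ such that the brick labeling of the lattice $\mathrm{wide}(\mathrm{mod}\,\Lambda)$ coming from $\tau$-exceptional sequences, i.e. the labeling $[\mathcal U,\mathcal W]\mapsto \beta(M)$ described in the context, is an EL-labeling.
   Context: $\mathrm{mod}\,\Lambda$ is the category of finitely generated left $\Lambda$-modules; subcategories are full and closed under isomorphism. $\Lambda$ is representation-directed if its Auslander-Reiten quiver has no oriented cycles (such algebras are representation-finite, hence $\tau$-tilting finite). A subcategory is wide if it is closed under kernels, cokernels and extensions; $\mathrm{wide}(\mathrm{mod}\,\Lambda)$ is the lattice of wide subcategories ordered by inclusion. A brick is a module whose endomorphism ring is a division algebra. For a $\tau$-tilting finite algebra every wide subcategory $\mathcal W$ is equivalent to a category $\mathrm{mod}\,\Lambda_{\mathcal W}$ of finitely generated modules over a finite-dimensional algebra; let $\tau_{\mathcal W}$ be the Auslander-Reiten translate of $\mathcal W$ (transported from $\mathrm{mod}\,\Lambda_{\mathcal W}$). A basic module $M\in\mathcal W$ is $\tau$-rigid in $\mathcal W$ if $\mathrm{Hom}_\Lambda(M,\tau_{\mathcal W}M)=0$, and then $\mathcal J_{\mathcal W}(M)=\{X\in\mathcal W\mid \mathrm{Hom}_\Lambda(M,X)=0=\mathrm{Hom}_\Lambda(X,\tau_{\mathcal W}M)\}$, which is a wide subcategory. For an indecomposable module $M$ that is $\tau$-rigid in $\mathcal W$, let $\beta(M)=M/\sum_g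 \mathrm{im}\,g$, the sum over all $g\in\mathrm{Hom}_\Lambda(M,M)$ with $0\ne g(M)\neq M$; this is a brick. Labeling: for each cover relation $\mathcal U\lessdot\mathcal W$ in $\mathrm{wide}(\mathrm{mod}\,\Lambda)$ there is a unique (up to isomorphism) indecomposable $M\in\mathcal W$ that is $\tau$-rigid in $\mathcal W$ with $\mathcal U=\mathcal J_{\mathcal W}(M)$; the label of the cover is $\beta(M)$. EL-labeling: let $P$ be a poset with least and greatest elements, and let $\lambda$ assign to every cover relation $[x,y]$, $x\lessdot y$, of $P$ an element of a poset $Q$. To a maximal chain $x=x_{k+1}\lessdot x_k\lessdot\cdots\lessdot x_1\lessdot x_0=y$ of an interval $[x,y]$ associate the tuple $(\lambda[x_{k+1},x_k],\lambda[x_k,x_{k-1}],\dots,\lambda[x_1,x_0])$; tuples are compared in reflected lexicographic order (lexicographic order reading from right to left). The chain is increasing if $\lambda[x_{i+1},x_i]>\lambda[x_i,x_{i-1}]$ for all $1\le i\le k$. Then $\lambda$ is an EL-labeling if every interval $[x,y]$ of $P$ has a unique increasing maximal chain, and this chain is smallest among the maximal chains of $[x,y]$ in the reflected lexicographic order. *)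

(* Defs.v *)
From Stdlib Require Export Relation_Definitions Relation_Operators Sorted.
From HB Require Import structures.
From mathcomp Require Export all_boot all_order all_algebra all_field.

Set Implicit Arguments.
Unset Strict Implicit.
Unset Printing Implicit Defensive.

Import GRing.Theory.
Local Open Scope ring_scope.

(* A finite-dimensional K-algebra is a [falgType K], in particular nonzero.
   A left module is an [lmodType], a homomorphism a [{linear M -> N}]; equality
   of homomorphisms is pointwise.  Isomorphism classes are handled by working
   with predicates on modules that are invariant under [iso]. *)

Section Modules.
Variable R : nzRingType.
Implicit Types M N L C B P X Y E Z : lmodType R.

Definition surj (S T : Type) (f : S -> T) : Prop :=
  forall y, exists x, f x = y.

Definition zero_module M : Prop := forall x : M, x = 0.

Definition iso M N : Prop := exists f : {linear M -> N}, bijective f.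

Definition hom_zero M N : Prop := forall (f : {linear M -> N}) (x : M), f x = 0.

Definition fingen M : Prop :=
  exists (n : nat) (e : 'I_n -> M),
    forall x : M, exists a : 'I_n -> R, x = \sum_i a i *: e i.

Definition is_kernel M N L (f : {linear M -> N}) (i : {linear L -> M}) : Prop :=
  injective i /\ forall y, f y = 0 <-> exists x, i x = y.

Definition is_cokernel M N C (f : {linear M -> N}) (c : {linear N -> C}) : Prop :=
  surj c /\ forall y, c y = 0 <-> exists x, f x = y.

Definition indecomposable M : Prop :=
  ~ zero_module M /\
  forall X Y, iso M (X * Y)%type -> zero_module X \/ zero_module Y.

Definition basic_module M : Prop :=
  forall X Y, indecomposable X -> ~ iso M (X * X * Y)%type.

Definition brick M : Prop :=
  [/\ fingen M, ~ zero_module M &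
      forall f : {linear M -> M}, ~ (forall x, f x = 0) ->
        exists g : {linear M -> M}, cancel f g /\ cancel g f].

Definition projective P : Prop :=
  forall (M N : lmodType R) (p : {linear M -> N}) (f : {linear P -> N}),
    surj p -> exists g : {linear P -> M}, forall x, p (g x) = f x.

(* [p] is a projective cover of its image: P is projective and a map into P
   is surjective as soon as it hits the whole image of [p]. *)
Definition proj_cover_of_image P M (p : {linear P -> M}) : Prop :=
  projective P /\
  forall X (g : {linear X -> P}),
    (forall y, exists x, p (g x) = p y) -> surj g.

Definition min_proj_presentation (P1 P0 : lmodType R) M
    (p1 : {linear P1 -> P0}) (p0 : {linear P0 -> M}) : Prop :=
  [/\ proj_cover_of_image p1, proj_cover_of_image p0 & is_cokernel p1 p0].

Definition split_mono M N (f : {linear M -> N}) : Prop :=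
  exists r : {linear N -> M}, cancel f r.

Definition split_epi M N (f : {linear M -> N}) : Prop :=
  exists s : {linear N -> M}, cancel s f.

Definition irreducible_map M N (f : {linear M -> N}) : Prop :=
  [/\ ~ split_mono f, ~ split_epi f &
      forall (Z : lmodType R) (h : {linear M -> Z}) (g : {linear Z -> N}),
        fingen Z -> (forall x, f x = g (h x)) -> split_mono h \/ split_epi g].

(* The relation is invariant under isomorphism on both sides, so oriented
   cycles of isomorphism classes are the same as cycles of modules. *)
Definition AR_arrow M N : Prop :=
  [/\ fingen M /\ indecomposable M, fingen N /\ indecomposable N &
      exists f : {linear M -> N}, irreducible_map f].

Definition AR_acyclic : Prop :=
  forall M, ~ clos_trans (lmodType R) AR_arrow M M.

Definition rep_finite : Prop :=
  exists (n : nat) (L : 'I_n -> lmodType R),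
    forall M, fingen M -> indecomposable M -> exists i, iso M (L i).

(* Finiteness of the quiver is part of the notion: wild hereditary algebras
   also have Auslander-Reiten quivers without oriented cycles. *)
Definition representation_directed : Prop := rep_finite /\ AR_acyclic.

Definition proper_image_endo M (g : {linear M -> M}) : Prop :=
  ~ (forall x, g x = 0) /\ ~ surj g.

Definition is_beta M B : Prop :=
  exists p : {linear M -> B}, surj p /\
    forall x : M, p x = 0 <->
      exists (n : nat) (g : 'I_n -> {linear M -> M}) (y : 'I_n -> M),
        (forall i, proper_image_endo (g i)) /\ x = \sum_i g i (y i).

Definition subcategory := lmodType R -> Prop.

Record wide (W : subcategory) : Prop := Wide {
  wide_fingen : forall M, W M -> fingen M;
  wide_iso : forall M N, W M -> iso M N -> W N;
  wide_nonempty : exists M, W M;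
  wide_ker : forall M N L (f : {linear M -> N}) (i : {linear L -> M}),
    W M -> W N -> is_kernel f i -> W L;
  wide_coker : forall M N C (f : {linear M -> N}) (c : {linear N -> C}),
    W M -> W N -> is_cokernel f c -> W C;
  wide_ext : forall X E Y (i : {linear X -> E}) (p : {linear E -> Y}),
    W X -> W Y -> is_kernel p i -> surj p -> W E }.

Definition wide_subcat := {W : subcategory | wide W}.

Definition wide_le (U W : wide_subcat) : Prop :=
  forall M, sval U M -> sval W M.

Definition brick_class :=
  {c : subcategory | exists B, brick B /\ forall X, c X <-> iso B X}.

End Modules.

Definition basic_algebra (R : nzRingType) : Prop := basic_module (R^o : lmodType R).

Section ARTranslate.
Variables (K : fieldType) (A : falgType K).

(* Right A-modules are left modules over the converse ring [A^c].  T is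
   Tr M = coker (Hom(p1, A) : Hom(P0, A) -> Hom(P1, A)) for a minimal projective
   presentation of M, given by a surjection [q] from Hom(P1, A); the right
   action on Hom(P1, A) is (h a)(x) = h(x) a. *)
Definition is_transpose (M : lmodType A) (T : lmodType A^c) : Prop :=
  exists (P1 P0 : lmodType A) (p1 : {linear P1 -> P0}) (p0 : {linear P0 -> M})
         (q : {linear P1 -> A^o} -> T),
    [/\ min_proj_presentation p1 p0,
        surj q,
        forall h h1 h2 : {linear P1 -> A^o},
          (forall x, h x = h1 x + h2 x) -> q h = q h1 + q h2,
        forall (a : A) (h h1 : {linear P1 -> A^o}),
          (forall x, h x = (h1 x : A) * a) -> q h = (a : A^c) *: q h1 &
        forall h : {linear P1 -> A^o},
          q h = 0 <-> exists g : {linear P0 -> A^o}, forall x, h x = g (p1 x)].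

Definition K_functional (T : lmodType A^c) (phi : T -> K) : Prop :=
  forall (k : K) (s t : T), phi (((k%:A : A) : A^c) *: s + t) = k * phi s + phi t.

(* N is the left module Hom_K(T, K), with action (a phi)(t) = phi(t a). *)
Definition is_K_dual (T : lmodType A^c) (N : lmodType A) : Prop :=
  exists theta : N -> T -> K,
    [/\ forall x, K_functional (theta x),
        forall x y t, theta (x + y) t = theta x t + theta y t,
        forall (a : A) x t, theta (a *: x) t = theta x ((a : A^c) *: t),
        forall x y, theta x =1 theta y -> x = y &
        forall phi : T -> K, K_functional phi -> exists x, theta x =1 phi].

Definition is_tau (M N : lmodType A) : Prop :=
  exists T : lmodType A^c, is_transpose M T /\ is_K_dual T N.

End ARTranslate.

Section TauTilting.
Variables (K : fieldType) (L : falgType K).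
Implicit Types (W U : subcategory L) (M N X : lmodType L).

Definition obj W := {M : lmodType L | W M}.

(* K-linear equivalence from the full subcategory W to the category of finitely
   generated A-modules: a fully faithful, essentially surjective K-linear
   functor. *)
Record equivalence W (A : falgType K) := Equivalence {
  eq_ob : obj W -> lmodType A;
  eq_hom : forall M N : obj W,
    {linear sval M -> sval N} -> {linear eq_ob M -> eq_ob N};
  eq_fingen : forall M : obj W, fingen (eq_ob M);
  eq_id : forall (M : obj W) (f : {linear sval M -> sval M}),
    (forall x, f x = x) -> forall z, eq_hom f z = z;
  eq_comp : forall (M N P : obj W) (f : {linear sval M -> sval N})
      (g : {linear sval N -> sval P}) (h : {linear sval M -> sval P}),
    (forall x, h x = g (f x)) -> forall z, eq_hom h z = eq_hom g (eq_hom f z);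
  eq_linear : forall (M N : obj W) (k : K) (f g h : {linear sval M -> sval N}),
    (forall x, h x = (k%:A : L) *: f x + g x) ->
    forall z, eq_hom h z = (k%:A : A) *: eq_hom f z + eq_hom g z;
  eq_faithful : forall (M N : obj W) (f g : {linear sval M -> sval N}),
    (forall z, eq_hom f z = eq_hom g z) -> forall x, f x = g x;
  eq_full : forall (M N : obj W) (e : {linear eq_ob M -> eq_ob N}),
    exists f : {linear sval M -> sval N}, forall z, eq_hom f z = e z;
  eq_dense : forall X : lmodType A, fingen X -> exists M : obj W, iso (eq_ob M) X }.

(* N is the Auslander-Reiten translate of M in W, transported from mod A.  As
   [falgType] excludes the zero ring, the relation is empty for W = 0, which
   contains no indecomposable module. *)
Definition is_tau_in W M N : Prop :=
  exists (A : falgType K) (F : equivalence W A) (WM : W M) (WN : W N),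
    is_tau (eq_ob F (exist _ M WM)) (eq_ob F (exist _ N WN)).

Definition tau_rigid_in W M : Prop :=
  [/\ W M, basic_module M & exists2 N, is_tau_in W M N & hom_zero M N].

Definition tau_perp W M : subcategory L := fun X =>
  [/\ W X, hom_zero M X & exists2 N, is_tau_in W M N & hom_zero X N].

Definition label_module U W M : Prop :=
  [/\ indecomposable M, tau_rigid_in W M & forall X, U X <-> tau_perp W M X].

End TauTilting.

Section ELLabeling.
Variables (P Q : Type) (leP : relation P) (leQ : relation Q).

Definition strict (T : Type) (le : relation T) : relation T :=
  fun x y => le x y /\ x <> y.

Definition covers (x y : P) : Prop :=
  strict leP x y /\ ~ exists z, strict leP x z /\ strict leP z y.

Definition labeling := forall x y : P, covers x y -> Q.

(* [labeled_chain lam x y s l]: s lists, from bottom to top, the elements of a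
   maximal chain of [x, y], and l lists its labels, also from bottom to top. *)
Inductive labeled_chain (lam : labeling) : P -> P -> seq P -> seq Q -> Prop :=
| chain_nil x : labeled_chain lam x x [:: x] [::]
| chain_cons x y z s l (h : covers x y) :
    labeled_chain lam y z s l ->
    labeled_chain lam x z (x :: s) (lam x y h :: l).

(* Each label is larger than the one above it, that is, to its right. *)
Definition increasing_labels (l : seq Q) : Prop :=
  Sorted (fun a b => strict leQ b a) l.

Fixpoint lex_le (s t : seq Q) : Prop :=
  match s, t with
  | [::], _ => True
  | _ :: _, [::] => False
  | a :: s', b :: t' => strict leQ a b \/ (a = b /\ lex_le s' t')
  end.

Definition reflected_lex_le (s t : seq Q) : Prop := lex_le (rev s) (rev t).

Definition bounded_poset : Prop :=
  [/\ Relation_Definitions.order P leP, (exists b, forall x, leP b x) &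
      (exists t, forall x, leP x t)].

Definition EL_labeling (lam : labeling) : Prop :=
  [/\ bounded_poset, Relation_Definitions.order Q leQ &
      forall x y, leP x y ->
        exists s l,
          [/\ labeled_chain lam x y s l,
              increasing_labels l,
              forall s' l', labeled_chain lam x y s' l' ->
                increasing_labels l' -> s' = s &
              forall s' l', labeled_chain lam x y s' l' ->
                reflected_lex_le l l']].

End ELLabeling.

(* The label of U <. W is the class of beta(M), where M is the unique module,
   up to isomorphism, with U = J_W(M). *)
Definition is_brick_labeling (K : fieldType) (L : falgType K)
    (lam : labeling (brick_class L) (@wide_le L)) : Prop :=
  forall (U W : wide_subcat L) (h : covers (@wide_le L) U W),
    exists M : lmodType L,
      [/\ label_module (sval U) (sval W) M,
          forall M', label_module (sval U) (sval W) M' -> iso M M' &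
          exists2 B, is_beta M B & sval (lam U W h) B].

(* Main.v *)
(* Choose rho on indecomposable modules, injective on isomorphism classes, with
   rho M < rho N whenever there is a nonzero non-isomorphism M -> N; this is
   possible because, by the Harada-Sai lemma, such a map yields a path in the
   Auslander-Reiten quiver.  Then Ext^1(M, N) <> 0 forces rho N < rho M, every
   indecomposable M is a brick, tau-rigid in every wide W containing it, and
   beta(M) = M.  Bricks are ordered by rho.

   J_W(M) consists of the X in W with Hom(M, X) = 0 and Ext^1(M, Y) = 0 for all
   quotients Y of X in W, which makes no reference to tau.  Fix wide
   subcategories U and W, and let C(U, W) be the set of indecomposable M in W
   with U inside J_W(M).
   - If U is properly contained in W, then C(U, W) is not empty.
   - If M is in C(U, W), M1 is in C(U, J_W(M)) and rho M1 < rho M, then M1 is in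
     C(U, W).
   - If M is in C(U, W) and rho M is not minimal in C(U, W), then C(U, J_W(M))
     contains some T with rho T < rho M.
   - J_W(M) included in J_W(M') implies that M and M' are isomorphic.
   The last point shows that covers are exactly the J_W(M) < W and that labels
   are unique.  Going down from W and choosing each time the smallest element of
   C(U, -) gives a chain which is increasing by the second point, the only
   increasing one by the third, and lexicographically smallest by choice. *)

Require Import Defs.
From HB Require Import structures.
From mathcomp Require Import boolp.

Set Implicit Arguments.
Unset Strict Implicit.
Unset Printing Implicit Defensive.
Import GRing.Theory.
Local Open Scope ring_scope.

(** * Modules, kernels, quotients and extensions *)

(** The order-theoretic part avoids Ext groups, [tau] and Krull-Schmidt multiplicities. Vanishing of
    Ext^1 is an extension property, a decomposition enters as the identity being a sum of
    projections onto indecomposable summands, and minimal objects are found by comparing dimensions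
    over [K]. Ext^1(M, N) <> 0 lowers [rho] because an indecomposable summand of the middle term of
    a nonsplit sequence lies strictly between [N] and [M]. Quotients occur in the description of
    J_W(M) because the X with Hom(X, tau_W M) = 0 form a torsion class. As there are finitely many
    indecomposables, torsion classes have minimal left approximations, and the required modules are
    found as summands of these or of their cokernels.

    The translate causes two obstacles. Its definition in [W] involves an arbitrary equivalence of
    [W] with some mod A, so the description by quotients must be carried through that equivalence.
    And since the conditions ask for a translate to exist, one has to be built, from a projective
    generator P of [W] and the equivalence Hom(P, -) with mod End(P)^op. *)

Definition mklin (R : nzRingType) (M N : lmodType R) (f : M -> N)
    (Hf : linear f) : {linear M -> N} :=
  HB.pack f (GRing.isLinear.Build R M N *:%R f Hf).

Record submod (R : nzRingType) (M : lmodType R) := Submod {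
  in_submod :> M -> Prop;
  submod0 : in_submod 0;
  submodL : forall a x y, in_submod x -> in_submod y -> in_submod (a *: x + y) }.

Section SubQuotient.
Variables (R : nzRingType) (M : lmodType R) (S : submod M).

Definition submod_pred : {pred M} := fun x => `[< S x >].

Lemma submod_predP x : reflect (S x) (x \in submod_pred).
Proof. exact: asboolP. Qed.

Lemma submod_pred_closed : submod_closed submod_pred.
Proof.
split=> [|a x y /submod_predP Sx /submod_predP Sy]; apply/submod_predP.
  exact: submod0.
exact: submodL.
Qed.
HB.instance Definition _ :=
  GRing.isSubmodClosed.Build R M submod_pred submod_pred_closed.

Record submodule := Submodule { sub_val :> M; _ : sub_val \in submod_pred }.
HB.instance Definition _ := [isSub for sub_val].
HB.instance Definition _ := [Choice of submodule by <:].
HB.instance Definition _ := [SubChoice_isSubLmodule of submodule by <:].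

Lemma submodule_ex : exists (N : lmodType R) (i : {linear N -> M}),
  injective i /\ forall y, S y <-> exists x, i x = y.
Proof.
exists submodule, (mklin (linearP (val : submodule -> M))); split.
  exact: val_inj.
move=> y; split=> [Sy|[[x xS] <-]]; last exact/submod_predP.
have yS : y \in submod_pred by apply/submod_predP.
by exists (Submodule yS).
Qed.

Lemma submodN x : S x -> S (- x).
Proof. by move=> Sx; have := submodL (-1) Sx (submod0 S); rewrite scaleN1r addr0. Qed.

Lemma submodD x y : S x -> S y -> S (x + y).
Proof. by move=> Sx Sy; have := submodL 1 Sx Sy; rewrite scale1r. Qed.

Lemma submodB x y : S x -> S y -> S (x - y).
Proof. by move=> Sx Sy; apply: submodD => //; apply: submodN. Qed.

Lemma submodZ a x : S x -> S (a *: x).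
Proof. by move=> Sx; have := submodL a Sx (submod0 S); rewrite addr0. Qed.

(** Elements of one coset satisfy the same predicate, so [xchoose] returns the same representative.
    The quotient is then a subtype, the fixed points of [coset_repr], and inherits its choice
    structure. *)
Lemma coset_repr_ex : exists r : M -> M,
  (forall x, S (x - r x)) /\ forall x y, S (x - y) -> r x = r y.
Proof.
have ex x : exists y, (fun y => `[< S (x - y) >]) y.
  by exists x; apply/asboolP; rewrite subrr; apply: submod0.
pose r x : M := xchoose (ex x).
exists r; split=> [x|x y Sxy]; first exact/asboolP/(xchooseP (ex x)).
apply: eq_xchoose => z; apply/asboolP/asboolP => Sz.
  by have := submodB Sz Sxy; rewrite opprB addrC addrA subrK.
by have := submodD Sxy Sz; rewrite addrA subrK.
Qed.

Definition coset_repr : M -> M := sval (cid coset_repr_ex).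
Lemma coset_reprB x : S (x - coset_repr x).
Proof. by rewrite /coset_repr; case: cid => r [] /=. Qed.
Lemma coset_repr_eq x y : S (x - y) -> coset_repr x = coset_repr y.
Proof. by rewrite /coset_repr; case: cid => r [] /= _; apply. Qed.
Lemma coset_reprK x : coset_repr (coset_repr x) = coset_repr x.
Proof. by apply/esym/coset_repr_eq/coset_reprB. Qed.

Record quotient := Quotient { quo_val : M; _ : coset_repr quo_val == quo_val }.
HB.instance Definition _ := [isSub for quo_val].
HB.instance Definition _ := [Choice of quotient by <:].

Definition to_quo (x : M) : quotient :=
  Quotient (introT eqP (coset_reprK x)).

Lemma to_quoP x y : to_quo x = to_quo y <-> S (x - y).
Proof.
split=> [/(congr1 val) /= e|Sxy]; last exact/val_inj/coset_repr_eq.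
have := submodB (coset_reprB x) (coset_reprB y).
by rewrite e opprB addrA subrK.
Qed.

Lemma to_quoK (q : quotient) : to_quo (val q) = q.
Proof. by apply: val_inj; case: q => x /= /eqP. Qed.

Definition quo_add (p q : quotient) := to_quo (val p + val q).
Definition quo_opp (p : quotient) := to_quo (- val p).
Definition quo_scale a (p : quotient) := to_quo (a *: val p).

Lemma quo_addE x y : quo_add (to_quo x) (to_quo y) = to_quo (x + y).
Proof.
apply/to_quoP; rewrite -[_ - _]opprK opprB; apply: submodN.
have := submodD (coset_reprB x) (coset_reprB y).
by rewrite addrACA -opprD.
Qed.
Lemma quo_oppE x : quo_opp (to_quo x) = to_quo (- x).
Proof. by apply/to_quoP; have := coset_reprB x; rewrite opprK addrC. Qed.
Lemma quo_scaleE a x : quo_scale a (to_quo x) = to_quo (a *: x).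
Proof.
apply/to_quoP; rewrite -scalerBr; apply: submodZ.
by rewrite -opprB; apply/submodN/coset_reprB.
Qed.

Lemma quo_addA : associative quo_add.
Proof.
move=> p q r; rewrite -[p]to_quoK -[q]to_quoK -[r]to_quoK.
by rewrite !quo_addE addrA.
Qed.
Lemma quo_addC : commutative quo_add.
Proof. by move=> p q; rewrite /quo_add addrC. Qed.
Lemma quo_add0 : left_id (to_quo 0) quo_add.
Proof. by move=> p; rewrite -[p]to_quoK quo_addE add0r. Qed.
Lemma quo_addN : left_inverse (to_quo 0) quo_opp quo_add.
Proof. by move=> p; rewrite -[p]to_quoK quo_oppE quo_addE addNr. Qed.
HB.instance Definition _ :=
  GRing.isZmodule.Build quotient quo_addA quo_addC quo_add0 quo_addN.

Lemma quo_scaleA a b p : quo_scale a (quo_scale b p) = quo_scale (a * b) p.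
Proof. by rewrite -[p]to_quoK !quo_scaleE scalerA. Qed.
Lemma quo_scale1 : left_id 1 quo_scale.
Proof. by move=> p; rewrite -[p]to_quoK quo_scaleE scale1r. Qed.
Lemma quo_scaleDr : right_distributive quo_scale +%R.
Proof.
move=> a p q; rewrite -[p]to_quoK -[q]to_quoK.
by rewrite [RHS]/GRing.add /= [X in quo_scale _ X]/GRing.add /= !(quo_scaleE, quo_addE) scalerDr.
Qed.
Lemma quo_scaleDl p : {morph quo_scale^~ p : a b / a + b}.
Proof.
move=> a b; rewrite -[p]to_quoK [RHS]/GRing.add /=.
by rewrite !(quo_scaleE, quo_addE) scalerDl.
Qed.
HB.instance Definition _ := GRing.Zmodule_isLmodule.Build R quotient
  quo_scaleA quo_scale1 quo_scaleDr quo_scaleDl.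

Lemma to_quo_linear : linear to_quo.
Proof. by move=> a x y; rewrite -quo_addE -quo_scaleE. Qed.

Lemma quotient_ex : exists (N : lmodType R) (p : {linear M -> N}),
  surj p /\ forall x, p x = 0 <-> S x.
Proof.
exists quotient, (mklin to_quo_linear); split=> [q|x].
  by exists (val q); apply: to_quoK.
by have := to_quoP x 0; rewrite subr0.
Qed.

End SubQuotient.

(** * Linear maps, short exact sequences and vanishing of Ext^1 *)

Section LinearMaps.
Variable R : nzRingType.
Implicit Types A B C E I K L M N P V X Y Z : lmodType R.

(** Many maps below are given by a relation instead of a formula. Closure under linear combinations
    reduces single-valuedness to the values at 0. *)
Lemma lin_graph M N (Q : M -> N -> Prop) :
    (forall x, exists y, Q x y) ->
    (forall a x x' y y', Q x y -> Q x' y' -> Q (a *: x + x') (a *: y + y')) ->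
    (forall y, Q 0 y -> y = 0) ->
  exists f : {linear M -> N}, forall x, Q x (f x).
Proof.
move=> /choice[f Qf] QD Q0.
have Qu x y y' : Q x y -> Q x y' -> y' = y.
  move=> Qy Qy'; apply/subr0_eq/Q0.
  by have := QD (-1) _ _ _ _ Qy Qy'; rewrite !scaleN1r addNr addrC.
have fL : linear f by move=> a x y; apply: Qu (Qf _); apply: QD.
by exists (mklin fL).
Qed.

Lemma lift_inj A B X (i : {linear A -> B}) (f : {linear X -> B}) :
    injective i -> (forall x, exists a, i a = f x) ->
  exists g : {linear X -> A}, forall x, i (g x) = f x.
Proof.
move=> i_inj fi; apply: (@lin_graph _ _ (fun x a => i a = f x)) => //.
  by move=> a x x' y y' e e'; rewrite !linearP e e'.
by move=> y; rewrite linear0 -[X in _ = X](linear0 i) => /i_inj.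
Qed.

Lemma lift_surj B C X (p : {linear B -> C}) (f : {linear B -> X}) :
    surj p -> (forall b, p b = 0 -> f b = 0) ->
  exists g : {linear C -> X}, forall b, g (p b) = f b.
Proof.
move=> ps pf.
have [|a c c' y y' [b [<- <-]] [b' [<- <-]]|y [b [b0 <-]]|g gP] :=
    @lin_graph _ _ (fun c x => exists b, p b = c /\ f b = x).
- by move=> c; have [b <-] := ps c; exists (f b), b.
- by exists (a *: b + b'); rewrite !linearP.
- exact: pf.
exists g => b; have [b' [pb <-]] := gP (p b).
by apply/subr0_eq; rewrite -linearB; apply: pf; rewrite linearB pb subrr.
Qed.

Lemma surjK (S T U : Type) (p : S -> T) (f g : T -> U) :
  surj p -> (forall x, f (p x) = g (p x)) -> forall y, f y = g y.
Proof. by move=> ps e y; have [x <-] := ps y. Qed.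

Lemma lin_inj M N (f : {linear M -> N}) :
  (forall x, f x = 0 -> x = 0) -> injective f.
Proof. by move=> f0 x y e; apply/subr0_eq/f0; rewrite linearB e subrr. Qed.

Lemma lin_inv M N (f : {linear M -> N}) : injective f -> surj f ->
  exists g : {linear N -> M}, cancel f g /\ cancel g f.
Proof.
move=> fi fs; have [x|g gP] := @lift_inj _ _ _ f idfun fi.
  by have [y <-] := fs x; exists y.
by exists g; split=> x; [apply: fi; rewrite gP | rewrite gP].
Qed.

Lemma bij_inv M N (f : {linear M -> N}) : bijective f ->
  exists g : {linear N -> M}, cancel f g /\ cancel g f.
Proof.
move=> [g fK gK]; apply: lin_inv; first exact: can_inj fK.
by move=> y; exists (g y); rewrite gK.
Qed.

Lemma inj_surj_bij M N (f : {linear M -> N}) : injective f -> surj f -> bijective f.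
Proof. by move=> fi fs; have [g []] := lin_inv fi fs; exists g. Qed.

Lemma bij_surj (S T : Type) (f : S -> T) : bijective f -> surj f.
Proof. by move=> [g fK gK] y; exists (g y). Qed.

Lemma surj_comp (S T U : Type) (f : S -> T) (g : T -> U) :
  surj f -> surj g -> surj (g \o f).
Proof. by move=> fs gs z; have [y <-] := gs z; have [x <-] := fs y; exists x. Qed.

Lemma iso_refl M : iso M M.
Proof. by exists idfun; exists id. Qed.

Lemma iso_sym M N : iso M N -> iso N M.
Proof. by move=> [f /bij_inv[g [fK gK]]]; exists g; exists f. Qed.

Lemma iso_trans M N X : iso M N -> iso N X -> iso M X.
Proof. by move=> [f fb] [g gb]; exists (g \o f); apply: bij_comp. Qed.

Lemma isoP M N : iso M N ->
  exists (f : {linear M -> N}) (g : {linear N -> M}), cancel f g /\ cancel g f.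
Proof. by move=> [f /bij_inv[g fg]]; exists f, g. Qed.

Lemma can_iso M N (f : {linear M -> N}) (g : {linear N -> M}) :
  cancel f g -> cancel g f -> iso M N.
Proof. by move=> fK gK; exists f; exists g. Qed.

Lemma pair_lin_subproof X A B (f : {linear X -> A}) (g : {linear X -> B}) :
  linear (fun x => (f x, g x)).
Proof. by move=> a x y; rewrite !linearP. Qed.
Definition pair_lin X A B (f : {linear X -> A}) (g : {linear X -> B}) :
  {linear X -> (A * B)%type} := mklin (pair_lin_subproof f g).

Definition copair_lin X A B (f : {linear A -> X}) (g : {linear B -> X}) :
  {linear (A * B)%type -> X} := (f \o fst) \+ (g \o snd).

Definition inl_lin A B : {linear A -> (A * B)%type} := pair_lin idfun \0.
Definition inr_lin A B : {linear B -> (A * B)%type} := pair_lin \0 idfun.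

Lemma copair_linE X A B (f : {linear A -> X}) (g : {linear B -> X}) u :
  copair_lin f g u = f u.1 + g u.2.
Proof. by []. Qed.

Lemma fproj_linear n M (i : 'I_n) : linear (fun a : {ffun 'I_n -> M} => a i).
Proof. by move=> k a b; rewrite !ffunE. Qed.
Definition fproj n M (i : 'I_n) : {linear {ffun 'I_n -> M} -> M} := mklin (@fproj_linear n M i).

Lemma ftuple_linear n X M (g : 'I_n -> {linear X -> M}) :
  linear (fun x => [ffun i => g i x]).
Proof. by move=> k x y; apply/ffunP => i; rewrite !ffunE linearP. Qed.
Definition ftuple n X M (g : 'I_n -> {linear X -> M}) : {linear X -> {ffun 'I_n -> M}} :=
  mklin (ftuple_linear g).

Lemma fsum_linear n X M (g : 'I_n -> {linear M -> X}) :
  linear (fun a : {ffun 'I_n -> M} => \sum_i g i (a i)).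
Proof.
move=> k a b; rewrite scaler_sumr -big_split; apply: eq_bigr => i _.
by rewrite !ffunE linearP.
Qed.
Definition fsum n X M (g : 'I_n -> {linear M -> X}) : {linear {ffun 'I_n -> M} -> X} :=
  mklin (fsum_linear g).

Definition ker_submod M N (f : {linear M -> N}) : submod M.
Proof.
exists (fun x => f x = 0); first exact: linear0.
by move=> a x y fx fy; rewrite linearP fx fy scaler0 addr0.
Defined.

Definition im_submod M N (f : {linear M -> N}) : submod N.
Proof.
exists (fun y => exists x, f x = y); first by exists 0; apply: linear0.
by move=> a _ _ [x <-] [y <-]; exists (a *: x + y); apply: linearP.
Defined.

Lemma ker_ex M N (f : {linear M -> N}) :
  exists (L : lmodType R) (i : {linear L -> M}), is_kernel f i.
Proof. by have [L [i]] := submodule_ex (ker_submod f); exists L, i. Qed.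

Lemma coker_ex M N (f : {linear M -> N}) :
  exists (C : lmodType R) (c : {linear N -> C}), is_cokernel f c.
Proof. by have [C [c]] := quotient_ex (im_submod f); exists C, c. Qed.

Lemma im_ex M N (f : {linear M -> N}) :
  exists (I : lmodType R) (p : {linear M -> I}) (i : {linear I -> N}),
    [/\ surj p, injective i & forall x, i (p x) = f x].
Proof.
have [I [i [i_inj iP]]] := submodule_ex (im_submod f).
have [x|p pP] := lift_inj (f := f) i_inj; first by apply/iP; exists x.
exists I, p, i; split=> // y.
have /iP[x fx] : exists x, i x = i y by exists y.
by exists x; apply: i_inj; rewrite pP.
Qed.

Definition ses Y E M (i : {linear Y -> E}) (p : {linear E -> M}) :=
  is_kernel p i /\ surj p.

Lemma ses0 Y E M (i : {linear Y -> E}) (p : {linear E -> M}) y :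
  ses i p -> p (i y) = 0.
Proof. by move=> [[_ ip] _]; apply/ip; exists y. Qed.

Lemma ses_inj Y E M (i : {linear Y -> E}) (p : {linear E -> M}) :
  ses i p -> injective i.
Proof. by move=> [[]]. Qed.

Lemma ses_surj Y E M (i : {linear Y -> E}) (p : {linear E -> M}) :
  ses i p -> surj p.
Proof. by move=> []. Qed.

Lemma ses_ker Y E M (i : {linear Y -> E}) (p : {linear E -> M}) e :
  ses i p -> p e = 0 -> exists y, i y = e.
Proof. by move=> [[_ ip] _] /ip. Qed.

Lemma ses_coker Y E M (i : {linear Y -> E}) (p : {linear E -> M}) :
  ses i p -> is_cokernel i p.
Proof. by move=> [[]]. Qed.

Lemma ses_of_surj E M (p : {linear E -> M}) : surj p ->
  exists Y (i : {linear Y -> E}), ses i p.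
Proof. by have [Y [i ip]] := ker_ex p; exists Y, i. Qed.

Lemma ses_of_inj Y E (i : {linear Y -> E}) : injective i ->
  exists M (p : {linear E -> M}), ses i p.
Proof. by have [M [p [ps pi]]] := coker_ex i; exists M, p. Qed.

Lemma ses_lift Y E M X (i : {linear Y -> E}) (p : {linear E -> M})
    (f : {linear X -> E}) : ses i p -> (forall x, p (f x) = 0) ->
  exists g : {linear X -> Y}, forall x, i (g x) = f x.
Proof.
move=> ip pf; apply: lift_inj => [|x]; first exact: ses_inj ip.
exact: ses_ker ip (pf x).
Qed.

Lemma ses_desc Y E M X (i : {linear Y -> E}) (p : {linear E -> M})
    (f : {linear E -> X}) : ses i p -> (forall y, f (i y) = 0) ->
  exists g : {linear M -> X}, forall x, g (p x) = f x.
Proof.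
move=> ip fi; apply: lift_surj => [|e pe]; first exact: ses_surj ip.
by have [y <-] := ses_ker ip pe.
Qed.

Lemma pullback_ex A B C (f : {linear A -> C}) (g : {linear B -> C}) :
  exists P (a : {linear P -> A}) (b : {linear P -> B}),
  [/\ forall z, f (a z) = g (b z),
      forall x y, f x = g y -> exists z, a z = x /\ b z = y &
      forall z z', a z = a z' -> b z = b z' -> z = z'].
Proof.
have [P [i [i_inj iP]]] := ker_ex (copair_lin f (\0 \- g)).
have iE z : f (i z).1 = g (i z).2.
  apply/subr0_eq; have /iP : exists x, i x = i z by exists z.
  by rewrite copair_linE /= sub0r.
exists P, (fst \o i), (snd \o i); split=> [//|x y e|z z' /= e1 e2].
  have /iP[z iz] : copair_lin f (\0 \- g) (x, y) = 0.
    by rewrite copair_linE /= sub0r e subrr.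
  by exists z; rewrite /= iz.
by apply: i_inj; move: e1 e2; case: (i z) (i z') => [? ?] [? ?] /= -> ->.
Qed.

Lemma pullback_ses Y E M M' (i : {linear Y -> E}) (p : {linear E -> M})
    (g : {linear M' -> M}) : ses i p ->
  exists E' (i' : {linear Y -> E'}) (p' : {linear E' -> M'}) (v : {linear E' -> E}),
  [/\ ses i' p', forall e, p (v e) = g (p' e), forall y, v (i' y) = i y &
      forall X (a : {linear X -> E}) (b : {linear X -> M'}),
        (forall x, p (a x) = g (b x)) ->
        exists c : {linear X -> E'}, forall x, v (c x) = a x /\ p' (c x) = b x].
Proof.
move=> ip; have [E' [v [p' [comm ex un]]]] := pullback_ex p g.
have univ X (a : {linear X -> E}) (b : {linear X -> M'}) :
    (forall x, p (a x) = g (b x)) ->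
    exists c : {linear X -> E'}, forall x, v (c x) = a x /\ p' (c x) = b x.
  move=> ab; pose Q (x : X) (z : E') := v z = a x /\ p' z = b x.
  have [x|||c cP] := lin_graph (Q := Q); last by exists c.
  - by have [z] := ex _ _ (ab x); exists z.
  - by move=> k x x' y y' [e1 e2] [e3 e4]; rewrite /Q !linearP e1 e2 e3 e4.
  by move=> y; rewrite /Q !linear0 => -[e1 e2]; apply: un; rewrite linear0.
have [y|i' i'P] := univ Y i \0; first by rewrite (ses0 _ ip) linear0.
exists E', i', p', v; split=> //; last by move=> y; have [] := i'P y.
split; first split=> [y y' e|z].
- by apply: (ses_inj ip); have [<- _] := i'P y; have [<- _] := i'P y'; rewrite e.
- split=> [pz|[y <-]]; last by have [] := i'P y.
  have [|y iy] := ses_ker (e := v z) ip; first by rewrite comm pz linear0.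
  exists y; have [e1 e2] := i'P y; apply: un; first by rewrite e1.
  by rewrite e2 pz.
- move=> m; have [e pe] := ses_surj ip (g m).
  by have [z [_ <-]] := ex _ _ pe; exists z.
Qed.

Lemma pushout_ses Y E M X (i : {linear Y -> E}) (p : {linear E -> M})
    (u : {linear Y -> X}) : ses i p ->
  exists E' (i' : {linear X -> E'}) (p' : {linear E' -> M}) (v : {linear E -> E'}),
  [/\ ses i' p', forall y, v (i y) = i' (u y) & forall e, p' (v e) = p e].
Proof.
move=> ip; pose d : {linear Y -> (X * E)%type} := pair_lin u (\0 \- i).
have [E' [c [cs cP]]] := coker_ex d.
have [|p' p'P] := lift_surj (f := copair_lin (\0 : {linear X -> M}) p) cs.
  move=> b /cP[y <-].
  by rewrite copair_linE /= !add0r linearN (ses0 _ ip) oppr0.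
exists E', (c \o inl_lin X E), p', (c \o inr_lin X E); split.
- split; first split.
  + apply: lin_inj => x /= /cP[y [<-]] /=.
    rewrite sub0r => /eqP; rewrite oppr_eq0 => /eqP e.
    by rewrite (_ : y = 0) ?linear0 //; apply: (ses_inj ip); rewrite e linear0.
  + move=> z; have [[x e] <-] := cs z; rewrite p'P copair_linE /= add0r.
    split=> [pe|[x' /esym e']]; last first.
      have := p'P (x, e); rewrite e' /= p'P !copair_linE /= !add0r => <-.
      by rewrite linear0.
    have [y iy] := ses_ker ip pe; exists (x + u y) => /=.
    apply/subr0_eq; rewrite -linearB; apply/cP; exists y.
    by rewrite /= /pair_lin /=; congr (_, _); rewrite /= ?sub0r ?iy // addrC addKr.
  + move=> m; have [e <-] := ses_surj ip m; exists (c (0, e)).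
    by rewrite p'P copair_linE /= add0r.
- move=> y /=; apply/subr0_eq; rewrite -linearB; apply/cP; exists (- y) => /=.
  by congr (_, _) => /=; rewrite ?linearN /= ?sub0r ?subr0 ?opprK.
- by move=> e /=; rewrite p'P copair_linE /= add0r.
Qed.

(* Ext^1(M, X) = 0, stated as an extension property so that it applies to
   pushouts directly. *)
Definition ext0 M X := forall E Y (i : {linear Y -> E}) (p : {linear E -> M}),
  ses i p -> forall u : {linear Y -> X}, exists v : {linear E -> X},
    forall y, v (i y) = u y.

Lemma split_retr Y E M (i : {linear Y -> E}) (p : {linear E -> M}) :
  ses i p -> split_epi p -> exists r : {linear E -> Y}, cancel i r.
Proof.
move=> ip [s sK].
have [e|r rP] := ses_lift (f := idfun \- (s \o p)) ip.
  by rewrite /= linearB /= sK subrr.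
by exists r => y; apply: (ses_inj ip); rewrite rP /= (ses0 _ ip) linear0 subr0.
Qed.

Lemma retr_split Y E M (i : {linear Y -> E}) (p : {linear E -> M})
    (r : {linear E -> Y}) : ses i p -> cancel i r -> split_epi p.
Proof.
move=> ip rK.
have [y|s sP] := ses_desc (f := idfun \- (i \o r)) ip.
  by rewrite /= rK subrr.
exists s; apply: (surjK (ses_surj ip)) => e.
by rewrite sP /= linearB /= (ses0 _ ip) subr0.
Qed.

Lemma ext0_split Y E M (i : {linear Y -> E}) (p : {linear E -> M}) :
  ext0 M Y -> ses i p -> split_epi p.
Proof. by move=> MY ip; have [r rP] := MY _ _ _ _ ip idfun; apply: retr_split ip rP. Qed.

(** Pushing a sequence out along [u] gives one starting at [X]; a retraction of the latter extends
    [u]. *)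
Lemma ext0_of_split M X :
  (forall E (i : {linear X -> E}) (p : {linear E -> M}), ses i p -> split_epi p) ->
  ext0 M X.
Proof.
move=> sp E Y i p ip u; have [E' [i' [p' [v [ip' e1 e2]]]]] := pushout_ses u ip.
have [r rK] := split_retr ip' (sp _ _ _ ip').
by exists (r \o v) => y /=; rewrite e1 rK.
Qed.

Lemma ext0_lift Y E M X (i : {linear Y -> E}) (p : {linear E -> M})
    (f : {linear X -> M}) : ext0 X Y -> ses i p ->
  exists g : {linear X -> E}, forall x, p (g x) = f x.
Proof.
move=> XY ip; have [E' [i' [p' [v [ip' e1 e2 _]]]]] := pullback_ses f ip.
have [s sK] := ext0_split XY ip'.
by exists (v \o s) => x /=; rewrite e1 sK.
Qed.

(* The extension class of [Z] dies in [Z / Y], so it comes from [Y]; there it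
   dies as well because it factors through [X]. *)
Lemma ext0_mid M X Y Z C (y : {linear Y -> X}) (g : {linear X -> Z})
    (c : {linear Z -> C}) (j : {linear Y -> Z}) :
  (forall t, g (y t) = j t) -> ses j c -> ext0 M X -> ext0 M C -> ext0 M Z.
Proof.
move=> gy jc MX MC; apply: ext0_of_split => E i p ip.
have [w wi] := MC _ _ _ _ ip c.
have [E1 [k [kinj kP]]] := ker_ex w.
have [|j' j'P] := lift_inj (f := i \o j) kinj.
  by move=> t; apply/kP; rewrite /= wi (ses0 _ jc).
have jk : ses j' (p \o k).
  split; first split=> [t t' e|e1].
  - by apply: (ses_inj jc); apply: (ses_inj ip); rewrite -![i (j _)]j'P e.
  - split=> [/= pk|[t <-]]; last by rewrite /= j'P /= (ses0 _ ip).
    have [z iz] := ses_ker ip pk.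
    have [|t jt] := ses_ker (e := z) jc.
      by rewrite -wi iz; apply/kP; exists e1.
    by exists t; apply: kinj; rewrite j'P /= jt iz.
  - move=> m; have [e <-] := ses_surj ip m.
    have [z cz] := ses_surj jc (w e).
    have /kP[e1 ke1] : w (e - i z) = 0 by rewrite linearB wi cz subrr.
    by exists e1; rewrite /= ke1 linearB /= (ses0 _ ip) subr0.
have [v vP] := MX _ _ _ _ jk y.
have [|s sP] := ses_desc (f := k \- (i \o g \o v)) jk.
  by move=> t; rewrite /= j'P vP gy subrr.
exists s; apply: (surjK (ses_surj jk)) => e.
by rewrite sP /= linearB /= (ses0 _ ip) subr0.
Qed.

Lemma ext0_ext M X E Y (i : {linear X -> E}) (p : {linear E -> Y}) :
  ses i p -> ext0 M X -> ext0 M Y -> ext0 M E.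
Proof. by move=> ip; apply: (@ext0_mid _ _ _ _ _ idfun i p i). Qed.

(* The hypothesis says that the connecting map Hom(M, V) -> Ext^1(M, K) is 0. *)
Lemma ext0_ker M K X V (i : {linear K -> X}) (p : {linear X -> V}) :
  ses i p ->
  (forall m : {linear M -> V}, exists m' : {linear M -> X}, forall x, p (m' x) = m x) ->
  ext0 M X -> ext0 M K.
Proof.
move=> ip lift MX E Y j q jq u.
have [v vP] := MX _ _ _ _ jq (i \o u).
have [|m mP] := ses_desc (f := p \o v) jq.
  by move=> y; rewrite /= vP (ses0 _ ip).
have [m' m'P] := lift m.
have [|w wP] := ses_lift (f := v \- (m' \o q)) ip.
  by move=> e; rewrite /= linearB /= m'P mP subrr.
by exists w => y; apply: (ses_inj ip); rewrite wP /= vP (ses0 _ jq) linear0 subr0.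
Qed.

Lemma ext0_retrl M X A (s : {linear A -> M}) (r : {linear M -> A}) :
  cancel s r -> ext0 M X -> ext0 A X.
Proof.
move=> sK MX; apply: ext0_of_split => E i p ip.
have [g gP] := ext0_lift r MX ip.
by exists (g \o s) => a /=; rewrite gP sK.
Qed.

Lemma ext0_isol M N X : iso M N -> ext0 M X -> ext0 N X.
Proof. by move=> /isoP[f [g [fK gK]]]; apply: ext0_retrl gK. Qed.

Lemma ses_prod A B : ses (inl_lin A B) (snd : {linear (A * B)%type -> B}).
Proof.
split; first split=> [x y [] //|[x y] /=].
  by split=> [->|[a [_ <-]]] //; exists x.
by move=> y; exists (0, y).
Qed.

Lemma retract_iso_prod X A (s : {linear A -> X}) (r : {linear X -> A}) :
  cancel s r -> exists B (t : {linear B -> X}) (q : {linear X -> B}),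
  [/\ cancel t q, forall x, x = s (r x) + t (q x) & iso X (A * B)%type].
Proof.
move=> sK; have [B [t rt]] := ses_of_surj (p := r) (fun a => ex_intro _ (s a) (sK a)).
have [|q qP] := ses_lift (f := idfun \- (s \o r)) rt.
  by move=> x; rewrite /= linearB /= sK subrr.
have tq : cancel t q.
  by move=> b; apply: (ses_inj rt); rewrite qP /= (ses0 _ rt) linear0 subr0.
exists B, t, q; split=> // [x|]; first by rewrite qP /= addrC subrK.
apply: (@can_iso _ _ (pair_lin r q) (copair_lin s t)) => [x|[a b]].
  by rewrite copair_linE /= qP /= addrC subrK.
rewrite copair_linE /=; congr (_, _); rewrite linearD /=.
  by rewrite sK (ses0 _ rt) addr0.
rewrite tq -[RHS]add0r; congr (_ + _); apply: (ses_inj rt).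
by rewrite qP /= sK subrr linear0.
Qed.

End LinearMaps.

(** * Dimension *)

Section VectorSpaces.
Variables (K : fieldType) (V : lmodType K).

Definition lincomb (I : finType) (e : I -> V) (a : I -> K) : V := \sum_i a i *: e i.

Definition lin_indep n (e : 'I_n -> V) :=
  forall a, lincomb e a = 0 -> forall i, a i = 0.

Lemma lincomb_enum (I : finType) (e : I -> V) a :
  lincomb e a = lincomb (e \o enum_val) (a \o @enum_val I (mem I)).
Proof.
rewrite /lincomb /= -(big_enum_val (fun i => a i *: e i)).
exact: eq_bigl.
Qed.

Lemma lin_indep_le n m (e : 'I_n -> V) (f : 'I_m -> V) :
  lin_indep e -> (forall i, exists a, e i = lincomb f a) -> (n <= m)%N.
Proof.
move=> ie /choice[a aP]; rewrite leqNgt; apply/negP => lt_mn.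
pose A : 'M[K]_(n, m) := \matrix_(i, j) a i j.
have : kermx A != 0.
  rewrite kermx_eq0 /row_free; apply: contraTneq lt_mn => <-.
  by rewrite -leqNgt rank_leq_col.
case/rowV0Pn => u /sub_kermxP uA /eqP; apply.
apply/rowP => i; rewrite mxE; apply: (ie (fun i => u 0 i)).
rewrite /lincomb; under eq_bigr do rewrite aP /lincomb scaler_sumr.
rewrite exchange_big big1 //= => j _.
under eq_bigr do rewrite scalerA.
rewrite -scaler_suml; have := congr1 (fun v : 'rV_m => v 0 j) uA.
by rewrite !mxE; under eq_bigr do rewrite mxE; move=> ->; rewrite scale0r.
Qed.

(** A maximal independent family in [P] works. The form for subspaces yields finite generation of
    submodules in [fingen_inj] and finite dimension of Hom spaces in [hom_span]. *)
Lemma basis_ex (P : submod V) m (f : 'I_m -> V) :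
    (forall x, P x -> exists a, x = lincomb f a) ->
  exists n (e : 'I_n -> V), [/\ forall i, P (e i), lin_indep e &
    forall x, P x -> exists a, x = lincomb e a].
Proof.
move=> fP.
pose Q n := `[< exists e : 'I_n -> V, (forall i, P (e i)) /\ lin_indep e >].
have Q0 : exists n, Q n.
  by exists 0%N; apply/asboolP; exists (fun=> 0); split=> [i|a _ []//]; exact: submod0.
have Qm n : Q n -> (n <= m)%N.
  by move=> /asboolP[e [eP ie]]; apply: (lin_indep_le (f := f) ie) => i; apply: fP.
case: (ex_maxnP Q0 Qm) => n /asboolP[e [eP ie]] max_n; exists n, e; split=> // x Px.
pose e' (i : 'I_n.+1) := if unlift ord0 i is Some j then e j else x.
have : ~ lin_indep e'.
  move=> ie'; have := max_n n.+1; rewrite ltnn => H; suff: false by [].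
  apply: H; apply/asboolP; exists e'; split=> // i.
  by rewrite /e'; case: unlift.
move=> /existsNP[a /not_implyP[]].
rewrite /lincomb big_ord_recl /e' unlift_none; under eq_bigr do rewrite liftK.
move=> s0 /existsNP[i0 ai0].
have a0 : a ord0 != 0.
  apply/eqP => a0; apply: ai0; move: s0; rewrite a0 scale0r add0r => s0.
  by have := ie _ s0; case: (unliftP ord0 i0) => [j ->|-> //]; apply.
exists (fun i => - (a ord0)^-1 * a (lift ord0 i)).
rewrite /lincomb; under eq_bigr do rewrite -scalerA; rewrite -scaler_sumr.
rewrite scaleNr; move/eqP: s0; rewrite addrC addr_eq0 => /eqP ->.
by rewrite scalerN opprK scalerA mulVf // scale1r.
Qed.

End VectorSpaces.

Section Restriction.
Variables (K : fieldType) (L : falgType K) (M : lmodType L).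

(** A copy of the type [M], which already has its [L]-module structure, to carry the action of [K]
    through [k%:A]. *)
Definition kres : Type := M.
HB.instance Definition _ := GRing.Zmodule.on kres.
Definition kres_scale (k : K) (x : kres) : kres := (k%:A : L) *: (x : M).

Lemma kres_scaleA a b v : kres_scale a (kres_scale b v) = kres_scale (a * b) v.
Proof. by rewrite /kres_scale scalerA -scalerAl mul1r scalerA. Qed.
Lemma kres_scale1 : left_id 1 kres_scale.
Proof. by move=> v; rewrite /kres_scale !scale1r. Qed.
Lemma kres_scaleDr : right_distributive kres_scale +%R.
Proof. by move=> a u v; rewrite /kres_scale scalerDr. Qed.
Lemma kres_scaleDl v : {morph kres_scale^~ v : a b / a + b}.
Proof. by move=> a b; rewrite /kres_scale !scalerDl. Qed.
HB.instance Definition _ := GRing.Zmodule_isLmodule.Build K kres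
  kres_scaleA kres_scale1 kres_scaleDr kres_scaleDl.

Lemma kresZ k (x : kres) : k *: x = (k%:A : L) *: (x : M).
Proof. by []. Qed.
End Restriction.
Arguments kres {K L} M.

Section Dimension.
Variables (K : fieldType) (L : falgType K).
Implicit Types A B C E I M N P V X Y Z : lmodType L.

Lemma lin_kres M N (f : {linear M -> N}) (J : finType) (e : J -> kres M) a :
  f (lincomb e a) = lincomb (f \o e : J -> kres N) a.
Proof. by rewrite linear_sum; apply: eq_bigr => i _; rewrite kresZ linearZ. Qed.

Lemma kalg_comm (k : K) (a : L) : (k%:A : L) * a = a * k%:A.
Proof. by rewrite -scalerAl -scalerAr mul1r mulr1. Qed.

Lemma scale_alg_linear M (k : K) : linear (fun x : M => (k%:A : L) *: x).
Proof. by move=> a x y; rewrite scalerDr !scalerA kalg_comm. Qed.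

Definition kscale M (k : K) : {linear M -> M} := mklin (@scale_alg_linear M k).

Definition hasdim M n := exists e : 'I_n -> kres M,
  lin_indep e /\ forall x : kres M, exists a, x = lincomb e a.

Lemma hasdim_uniq M n m : hasdim M n -> hasdim M m -> n = m.
Proof.
move=> [e [ie se]] [f [jf sf]]; apply/eqP; rewrite eqn_leq.
by rewrite (lin_indep_le (f := f) ie) ?(lin_indep_le (f := e) jf).
Qed.

Definition setT_submod (W : lmodType K) : submod W.
Proof. by exists (fun=> True). Defined.

Lemma fingen_span M (J : finType) (f : J -> M) :
  (forall x : M, exists a : J -> L, x = \sum_j a j *: f j) -> fingen M.
Proof.
move=> fS; exists #|J|, (f \o enum_val) => x; have [a ->] := fS x.
exists (a \o enum_val) => /=.
rewrite -(big_enum_val (fun i => a i *: f i)) /=; exact: eq_bigl.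
Qed.

Lemma span_fingen M (J : finType) (f : J -> kres M) :
  (forall x : kres M, exists a, x = lincomb f a) -> fingen M.
Proof.
move=> fS; apply: (@fingen_span _ _ f) => x; have [a ->] := fS x.
by exists (fun i => (a i)%:A); rewrite /lincomb.
Qed.

Lemma fingen_kspan M : fingen M ->
  exists m (f : 'I_m -> kres M), forall x : kres M, exists a, x = lincomb f a.
Proof.
move=> [n [e eP]]; pose d := \dim {: L}; pose J : finType := ('I_n * 'I_d)%type.
pose f (j : J) : kres M := (vbasis {: L})`_j.2 *: e j.1.
exists #|J|, (f \o enum_val) => x; have [a xE] := eP x.
suff [b ->] : exists b, x = lincomb f b.
  by exists (b \o enum_val); rewrite lincomb_enum.
exists (fun j => coord (vbasis {: L}) j.2 (a j.1)).
rewrite xE /lincomb -(pair_big xpredT xpredT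
  (fun i k => coord (vbasis {: L}) k (a i) *: ((vbasis {: L})`_k *: e i : kres M))) /=.
apply: eq_bigr => i _; rewrite {1}(coord_vbasis (memvf (a i))) scaler_suml.
by apply: eq_bigr => j _; rewrite kresZ scalerA -scalerAl mul1r.
Qed.

Lemma fingen_hasdim M : fingen M -> exists n, hasdim M n.
Proof.
move=> /fingen_kspan[m [f fS]].
have [|n [e [_ ie se]]] := @basis_ex _ _ (@setT_submod (kres M)) m f; first by move=> x _; apply: fS.
by exists n, e; split=> // x; apply: se.
Qed.

(** The value 0 in the absence of a finite basis is a default. *)
Definition dim M : nat := if pselect (exists n, hasdim M n) is left h then sval (cid h) else 0%N.

Lemma hasdim_dim M : fingen M -> hasdim M (dim M).
Proof.
by move=> /fingen_hasdim h; rewrite /dim; case: pselect => // h'; case: cid.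
Qed.

Lemma dimE M n : hasdim M n -> dim M = n.
Proof.
move=> h; apply: hasdim_uniq (h); apply: hasdim_dim.
by case: h => e [_]; apply: span_fingen.
Qed.

Lemma fingen_surj M N (p : {linear M -> N}) : surj p -> fingen M -> fingen N.
Proof.
move=> ps [n [e eP]]; exists n, (p \o e) => y; have [x <-] := ps y.
have [a ->] := eP x; exists a; rewrite linear_sum.
by apply: eq_bigr => i _; rewrite linearZ.
Qed.

Lemma fingen_inj M N (i : {linear M -> N}) : injective i -> fingen N -> fingen M.
Proof.
move=> i_inj /fingen_kspan[m [f fS]].
have sub0 : exists x : M, i x = 0 by exists 0; apply: linear0.
have subL (a : K) (x y : kres N) : (exists z, i z = x) -> (exists z, i z = y) ->
    exists z, i z = a *: x + y.
  by move=> [z <-] [t <-]; exists ((a%:A : L) *: z + t); rewrite linearP kresZ.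
have [|n [e [eP _ eS]]] := @basis_ex _ _ (@Submod K (kres N) _ sub0 subL) m f.
  by move=> x _; apply: fS.
move/choice: eP => [g gP]; apply: (@span_fingen _ 'I_n g) => x.
have [|a aP] := eS (i x); first by exists x.
exists a; apply: i_inj; rewrite aP lin_kres /=.
by apply: eq_bigr => j _ /=; rewrite gP.
Qed.

Lemma hasdim_ses Y E M (i : {linear Y -> E}) (p : {linear E -> M}) n m :
  ses i p -> hasdim Y n -> hasdim M m -> hasdim E (n + m)%N.
Proof.
move=> ip [e [ie se]] [f [jf sf]].
have /choice[g gP] : forall j, exists x, p x = f j by move=> j; apply: (ses_surj ip).
exists (fun k => match split k with inl j => i (e j) : kres E | inr j => g j end); split.
  move=> a; rewrite /lincomb big_split_ord /=.
  under eq_bigr do rewrite (unsplitK (inl _)).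
  under [X in _ + X]eq_bigr do rewrite (unsplitK (inr _)).
  move=> s0; have rE : lincomb f (fun j => a (rshift n j)) = 0.
    have := congr1 p s0; rewrite linear0 linearD /=.
    rewrite (lin_kres p (g : 'I_m -> kres E) (fun j => a (rshift n j))).
    have -> : p (\sum_j a (lshift m j) *: (i (e j) : kres E)) = 0.
      rewrite linear_sum big1 // => j _.
      by rewrite kresZ linearZ /= (ses0 _ ip) scaler0.
    by rewrite add0r => <-; apply: eq_bigr => j _ /=; rewrite gP.
  have ra := jf _ rE; move: s0; rewrite [X in _ + X]big1 ?addr0 => [s0|j _]; last first.
    by rewrite ra scale0r.
  have la : lincomb e (fun j => a (lshift m j)) = 0.
    by apply: (ses_inj ip); rewrite lin_kres linear0.
  by move=> k; rewrite -(splitK k); case: (split k) => j /=; [apply: ie la j|apply: ra].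
move=> x; have [b bP] := sf (p x).
have [|y iy] := ses_ker (e := (x - lincomb (g : 'I_m -> kres E) b : E)) ip.
  rewrite linearB bP lin_kres; apply/eqP; rewrite subr_eq0; apply/eqP.
  by apply: eq_bigr => j _ /=; rewrite gP.
have [a aP] := se y.
exists (fun k => match split k with inl j => a j | inr j => b j end).
rewrite /lincomb big_split_ord /=.
under eq_bigr do rewrite (unsplitK (inl _)).
under [X in _ + X]eq_bigr do rewrite (unsplitK (inr _)).
move/(congr1 i): aP; rewrite lin_kres iy => /eqP; rewrite subr_eq => /eqP ->.
by [].
Qed.

Lemma fingen_ext Y E M (i : {linear Y -> E}) (p : {linear E -> M}) :
  ses i p -> fingen Y -> fingen M -> fingen E.
Proof.
move=> ip /hasdim_dim hY /hasdim_dim hM.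
by have [e [_]] := hasdim_ses ip hY hM; apply: span_fingen.
Qed.

Lemma dim_ses Y E M (i : {linear Y -> E}) (p : {linear E -> M}) :
  ses i p -> fingen E -> dim E = (dim Y + dim M)%N.
Proof.
move=> ip fE; apply/dimE/(hasdim_ses ip); apply: hasdim_dim.
  exact: fingen_inj (ses_inj ip) fE.
exact: fingen_surj (ses_surj ip) fE.
Qed.

Lemma dim_eq0 M : fingen M -> dim M = 0%N -> zero_module M.
Proof.
move=> /hasdim_dim h d0; move: h; rewrite d0 => -[e [_ se]] x.
by have [a ->] := se x; rewrite /lincomb big_ord0.
Qed.

Lemma fingen0 M : zero_module M -> fingen M.
Proof.
move=> M0; apply: (@span_fingen M 'I_0 (fun=> 0)) => x.
by exists (fun=> 0); rewrite [LHS]M0 [RHS]M0.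
Qed.

Lemma zero_module_ex : exists Z, zero_module Z.
Proof.
have [Z [i [i_inj iP]]] := ker_ex (idfun : {linear L^o -> L^o}).
exists Z => x; apply: i_inj; rewrite linear0.
by apply/iP; exists x.
Qed.

Lemma fingen_iso M N : iso M N -> fingen M -> fingen N.
Proof. by move=> [f /bij_surj fs]; apply: fingen_surj fs. Qed.

Lemma fingen_prod M N : fingen M -> fingen N -> fingen (M * N)%type.
Proof. exact: fingen_ext (ses_prod M N). Qed.

Lemma dim_inj M N (i : {linear M -> N}) :
  injective i -> fingen N -> (dim M <= dim N)%N.
Proof.
move=> i_inj fN; have [C [p ip]] := ses_of_inj i_inj.
by rewrite (dim_ses ip fN) leq_addr.
Qed.

Lemma dim_inj_surj M N (i : {linear M -> N}) :
  injective i -> fingen N -> (dim N <= dim M)%N -> surj i.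
Proof.
move=> i_inj fN; have [C [p ip]] := ses_of_inj i_inj.
rewrite (dim_ses ip fN) -[X in (_ <= X)%N]addn0 leq_add2l leqn0 => /eqP C0.
move=> y; apply: (ses_ker ip).
exact: dim_eq0 (fingen_surj (ses_surj ip) fN) C0 _.
Qed.

Lemma dim_surj M N (p : {linear M -> N}) :
  surj p -> fingen M -> (dim N <= dim M)%N.
Proof.
move=> ps fM; have [Y [i ip]] := ses_of_surj ps.
by rewrite (dim_ses ip fM) leq_addl.
Qed.

Lemma dim_surj_inj M N (p : {linear M -> N}) :
  surj p -> fingen M -> (dim M <= dim N)%N -> injective p.
Proof.
move=> ps fM; have [Y [i ip]] := ses_of_surj ps.
rewrite (dim_ses ip fM) -[X in (_ <= X)%N]add0n leq_add2r leqn0 => /eqP Y0.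
apply: lin_inj => x /(ses_ker ip)[y <-].
by rewrite [y](dim_eq0 (fingen_inj (ses_inj ip) fM) Y0) linear0.
Qed.

Lemma dim_iso M N : iso M N -> fingen M -> dim M = dim N.
Proof.
move=> MN fM; have fN := fingen_iso MN fM; have [f [g [fK gK]]] := isoP MN.
by apply/eqP; rewrite eqn_leq (dim_inj (can_inj fK) fN) (dim_inj (can_inj gK) fM).
Qed.

Lemma endo_surj M (f : {linear M -> M}) : fingen M -> surj f -> bijective f.
Proof. by move=> fM fs; apply: inj_surj_bij => //; apply: dim_surj_inj. Qed.

Lemma dim_prod M N : fingen M -> fingen N -> dim (M * N)%type = (dim M + dim N)%N.
Proof. by move=> fM fN; apply: dim_ses (ses_prod M N) (fingen_prod fM fN). Qed.

Lemma fingen_ffun n M : fingen M -> fingen {ffun 'I_n -> M}.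
Proof.
move=> [m [e eP]]; pose f (j : 'I_n * 'I_m) : {ffun 'I_n -> M} :=
  [ffun i => if i == j.1 then e j.2 else 0].
apply: (@fingen_span _ _ f) => x.
have /choice[a aP] : forall i, exists b : 'I_m -> L, x i = \sum_j b j *: e j by [].
exists (fun j => a j.1 j.2); apply/ffunP => i; rewrite sum_ffunE aP.
rewrite -(pair_big xpredT xpredT (fun k l => (a k l *: f (k, l)) i)) /=.
rewrite (bigD1 i) //= [X in _ + X]big1 ?addr0 => [|k ki].
  by apply: eq_bigr => l _; rewrite !ffunE eqxx.
by rewrite big1 // => l _; rewrite !ffunE eq_sym (negbTE ki) scaler0.
Qed.

(** A homomorphism is determined by its values on generators of [N], so Hom(N, Z) is a [K]-subspace
    of the finite-dimensional [Z^n]. *)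
Lemma hom_span N Z : fingen N -> fingen Z ->
  exists m (F : 'I_m -> {linear N -> Z}), forall f : {linear N -> Z},
  exists a : 'I_m -> K, forall x, f x = \sum_j kscale Z (a j) (F j x).
Proof.
move=> [n [e eP]] fZ; pose V : lmodType L := {ffun 'I_n -> Z}.
have [m [b bP]] := fingen_kspan (fingen_ffun n fZ : fingen V).
pose P (v : kres V) := exists f : {linear N -> Z}, forall i, (v : V) i = f (e i).
have P0 : P 0 by exists \0 => i; rewrite ffunE.
have PL a x y : P x -> P y -> P (a *: x + y).
  move=> [f fE] [g gE]; exists ((kscale Z a \o f) \+ g) => i.
  by rewrite /= -fE -gE kresZ !ffunE.
have [|r [c [cP _ cS]]] := @basis_ex _ _ (Submod P0 PL) m b; first by move=> x _; apply: bP.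
move/choice: cP => [F FP]; exists r, F => f.
have [|a aE] := cS [ffun i => f (e i)]; first by exists f => i; rewrite ffunE.
exists a => x; have [k ->] := eP x; rewrite linear_sum.
under [RHS]eq_bigr do rewrite !linear_sum.
rewrite exchange_big; apply: eq_bigr => i _ /=.
rewrite linearZ; under [RHS]eq_bigr do rewrite linearZ /= scalerA kalg_comm -scalerA.
rewrite -scaler_sumr; congr (_ *: _).
have := congr1 (fun v : V => v i) aE; rewrite ffunE => ->.
by rewrite /lincomb sum_ffunE; apply: eq_bigr => j _; rewrite kresZ !ffunE FP.
Qed.

End Dimension.

(** * Indecomposable modules and the Harada-Sai lemma *)

Section Indecomposables.
Variables (K : fieldType) (L : falgType K).
Implicit Types A B C E I M N P V X Y Z : lmodType L.

Definition fgindec M := fingen M /\ indecomposable M.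

Lemma indec_iso M N : iso M N -> indecomposable M -> indecomposable N.
Proof.
move=> MN [nzM dM]; split=> [N0|X Y NXY]; last exact: dM (iso_trans MN NXY).
have [f [g [fK gK]]] := isoP MN.
by apply: nzM => x; rewrite -[x]fK [f x]N0 linear0.
Qed.

Lemma fgindec_iso M N : iso M N -> fgindec M -> fgindec N.
Proof. by move=> MN [fM iM]; split; [apply: fingen_iso fM | apply: indec_iso iM]. Qed.

Lemma retract_indec A X (s : {linear A -> X}) (r : {linear X -> A}) :
  cancel s r -> indecomposable X -> ~ zero_module A -> cancel r s.
Proof.
move=> sK [_ dX] nzA; have [B [t [q [tK e XAB]]]] := retract_iso_prod sK.
have [//|B0] := dX _ _ XAB.
by move=> x; rewrite [RHS]e [q x]B0 linear0 addr0.
Qed.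

(* Krull-Schmidt in the form needed: the identity is a sum of projections onto
   indecomposable summands. *)
Lemma fgindec_decomp M (F : (M -> M) -> Prop) : fingen M ->
    F (fun=> 0) -> (forall e e', F e -> F e' -> F (fun x => e x + e' x)) ->
    (forall A (s : {linear A -> M}) (r : {linear M -> A}),
       fgindec A -> cancel s r -> F (s \o r)) ->
  F id.
Proof.
move=> fM F0 FD Fi.
suff H n : forall X (s : {linear X -> M}) (r : {linear M -> X}),
    cancel s r -> fingen X -> (dim X <= n)%N -> F (s \o r).
  by apply: (H (dim M) M idfun idfun).
elim: n => [|n IHn] X s r sK fX dX.
  rewrite (_ : _ \o _ = fun=> 0) //; apply/funext => x /=.
  by rewrite [r x](dim_eq0 fX) ?linear0 //; apply/eqP; rewrite -leqn0.
have [iX|] := pselect (indecomposable X); first exact: Fi.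
case/not_andP => [/contrapT X0|].
  rewrite (_ : _ \o _ = fun=> 0) //; apply/funext => x /=.
  by rewrite [r x]X0 linear0.
move=> /existsNP[A /existsNP[B /not_implyP[XAB /not_orP[nzA nzB]]]].
have [f [g [fK gK]]] := isoP XAB.
have fAB := fingen_iso XAB fX.
have fA : fingen A by apply: (fingen_surj (p := fst : {linear (A * B)%type -> A})) fAB => a; exists (a, 0).
have fB : fingen B by apply: (fingen_surj (p := snd : {linear (A * B)%type -> B})) fAB => b; exists (0, b).
have dAB : dim X = (dim A + dim B)%N by rewrite (dim_iso XAB fX) dim_prod.
have A_gt0 : (0 < dim A)%N by rewrite lt0n; apply/eqP => /(dim_eq0 fA).
have B_gt0 : (0 < dim B)%N by rewrite lt0n; apply/eqP => /(dim_eq0 fB).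
have FA : F ((s \o g \o inl_lin A B) \o (fst \o f \o r)).
  apply: IHn => // [a /=|]; first by rewrite sK gK.
  by rewrite -ltnS; apply: leq_trans dX; rewrite dAB -addn1 leq_add2l.
have FB : F ((s \o g \o inr_lin A B) \o (snd \o f \o r)).
  apply: IHn => // [b /=|]; first by rewrite sK gK.
  by rewrite -ltnS; apply: leq_trans dX; rewrite dAB -add1n leq_add2r.
rewrite (_ : _ \o _ = fun x => s (g (inl_lin A B (f (r x)).1)) + s (g (inr_lin A B (f (r x)).2))).
  exact: FD FA FB.
apply/funext => x /=; rewrite -!linearD /= -[in LHS](fK (r x)); congr (s (g _)).
by case: (f (r x)) => a b; congr (_, _); rewrite /= ?addr0 ?add0r.
Qed.

Definition nonzero_map (S : Type) (V : zmodType) (f : S -> V) := exists x, f x <> 0.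

Lemma nonzero_mapP (S : Type) (V : zmodType) (f : S -> V) :
  ~ (forall x, f x = 0) -> nonzero_map f.
Proof. by move=> /existsNP. Qed.

Lemma indec_source X Y (f : {linear X -> Y}) : fingen X -> nonzero_map f ->
  exists A (s : {linear A -> X}) (r : {linear X -> A}),
    [/\ fgindec A, cancel s r & nonzero_map (f \o s)].
Proof.
move=> fX [x fx]; apply: contrapT => H.
suff f0 : forall x, f x = 0 by apply: fx.
apply: (@fgindec_decomp X (fun e => forall x, f (e x) = 0) fX).
- by move=> ?; rewrite linear0.
- by move=> e e' he he' z; rewrite linearD he he' addr0.
- move=> A s r iA sK z; apply: contrapT => fz; apply: H; exists A, s, r; split=> //.
  by exists (r z).
Qed.

Lemma indec_target X Y (g : {linear X -> Y}) : fingen Y -> nonzero_map g ->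
  exists A (s : {linear A -> Y}) (r : {linear Y -> A}),
    [/\ fgindec A, cancel s r & nonzero_map (r \o g)].
Proof.
move=> fY [x gx]; apply: contrapT => H; apply: gx; move: x.
apply: (@fgindec_decomp Y (fun e => forall x, e (g x) = 0) fY) => //.
- by move=> e e' he he' z; rewrite he he' addr0.
- move=> A s r iA sK z /=; apply: contrapT => fz; apply: H; exists A, s, r; split=> //.
  by exists z => /= rz; apply: fz; rewrite rz linear0.
Qed.

Lemma indec_ext M Y : fingen Y -> ~ ext0 M Y ->
  exists A (s : {linear A -> Y}) (r : {linear Y -> A}),
    [/\ fgindec A, cancel s r & ~ ext0 M A].
Proof.
move=> fY nMY; apply: contrapT => H; apply: nMY.
pose F (e : Y -> Y) := forall E X (i : {linear X -> E}) (p : {linear E -> M}),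
  ses i p -> forall u : {linear X -> Y}, exists v : {linear E -> Y},
    forall x, v (i x) = e (u x).
apply: (@fgindec_decomp Y F fY) => [E X i p ip u|e e' he he' E X i p ip u|A s r iA sK E X i p ip u].
- by exists \0.
- have [v vP] := he _ _ _ _ ip u; have [v' v'P] := he' _ _ _ _ ip u.
  by exists (v \+ v') => x /=; rewrite vP v'P.
- have [MA|nMA] := pselect (ext0 M A); last by case: H; exists A, s, r.
  have [v vP] := MA _ _ _ _ ip (r \o u).
  by exists (s \o v) => x /=; rewrite vP.
Qed.

Definition rank M N (f : {linear M -> N}) : nat := dim (sval (cid (im_ex f))).

Lemma rank_factor M N X (h : {linear M -> N}) (p : {linear M -> X}) (i : {linear X -> N}) :
  fingen X -> (forall x, h x = i (p x)) -> (rank h <= dim X)%N.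
Proof.
move=> fX e; rewrite /rank; case: cid => I /= [q [j [qs j_inj jq]]].
have [S [a [b [as_ b_inj ba]]]] := im_ex p.
have fS := fingen_inj b_inj fX.
have [|c cP] := lift_surj (f := q) as_.
  move=> x ax; apply: j_inj; rewrite jq e -ba ax !linear0 //.
apply: leq_trans (dim_inj b_inj fX); apply: (dim_surj (p := c)) fS => y.
by have [x <-] := qs y; exists (a x).
Qed.

Lemma rankE M N I (f : {linear M -> N}) (p : {linear M -> I}) (i : {linear I -> N}) :
  fingen M -> surj p -> injective i -> (forall x, i (p x) = f x) -> rank f = dim I.
Proof.
move=> fM ps i_inj ip; have fI := fingen_surj ps fM.
apply/eqP; rewrite eqn_leq (@rank_factor _ _ _ _ p i) //=.
rewrite /rank; case: cid => J /= [q [j [qs j_inj jq]]].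
have [|c cP] := lift_surj (f := p) qs.
  by move=> x qx; apply: i_inj; rewrite ip -jq qx !linear0.
apply: (dim_surj (p := c)) (fingen_surj qs fM) => y.
by have [x <-] := ps y; exists (q x).
Qed.

(** If no rank is lost, the image of [u] is a complement of the kernel of [v] in [Y]. As [Y] is
    indecomposable and the composite is nonzero, that kernel is 0. *)
Lemma rank_full_split X Y Z (u : {linear X -> Y}) (v : {linear Y -> Z}) :
  fingen X -> fgindec Y -> nonzero_map (v \o u) ->
  (rank u <= rank (v \o u))%N -> (rank v <= rank (v \o u))%N ->
  surj u /\ injective v.
Proof.
move=> fX [fY iY] nz ru rv.
have [I [pu [iu [pus iu_inj uE]]]] := im_ex u.
have [J [pv [iv [pvs iv_inj vE]]]] := im_ex v.
have [T [pt [it [pts it_inj tE]]]] := im_ex (pv \o iu).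
have fI := fingen_surj pus fX; have fJ := fingen_surj pvs fY.
have fT := fingen_surj pts fI.
have vuE : rank (v \o u) = dim T.
  apply: (@rankE _ _ _ _ (pt \o pu) (iv \o it)) => //.
  - exact: surj_comp.
  - exact: inj_comp.
  - by move=> x /=; rewrite tE /= uE vE.
rewrite vuE (rankE fX pus iu_inj uE) in ru.
rewrite vuE (rankE fY pvs iv_inj vE) in rv.
have pt_inj := dim_surj_inj pts fI ru.
have it_s := dim_inj_surj it_inj fJ rv.
have [w [wK Kw]] : exists w : {linear J -> I}, cancel (pv \o iu) w /\ cancel w (pv \o iu).
  apply: lin_inv => [x y /= e|y].
    by apply: pt_inj; apply: it_inj; rewrite !tE.
  have [t <-] := it_s y; have [x <-] := pts t.
  by exists x; rewrite tE.
have sK : cancel (iu \o w) pv by move=> j; apply: Kw.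
have [x vux] := nz.
have nzJ : ~ zero_module J.
  by move=> J0; apply: vux; rewrite /= -vE [pv _]J0 linear0.
have rK := retract_indec sK iY nzJ; split=> [y|].
  have [z zE] := pus (w (pv y)); exists z.
  by rewrite -uE zE; apply: rK.
by move=> y y'; rewrite -!vE => /iv_inj e; rewrite -[y]rK -[y']rK e.
Qed.

(* [h] is a composite of [n + 1] non-isomorphisms between indecomposables. *)
Fixpoint rad_path n M N (h : {linear M -> N}) : Prop :=
  match n with
  | 0 => [/\ fgindec M, fgindec N & ~ bijective h]
  | m.+1 => exists P (f : {linear M -> P}) (g : {linear P -> N}),
      [/\ rad_path m f, fgindec P, fgindec N, ~ bijective g & forall x, h x = g (f x)]
  end.

Lemma rad_path_fgindec n M N (h : {linear M -> N}) :
  rad_path n h -> fgindec M /\ fgindec N.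
Proof.
by elim: n N h => [|n IHn] N h /= => [[]|[P [f [g [/IHn[iM _] _ iN _ _]]]]].
Qed.

Lemma rad_path_split a b M N (h : {linear M -> N}) : rad_path (a + b).+1 h ->
  exists P (f : {linear M -> P}) (g : {linear P -> N}),
    [/\ rad_path a f, rad_path b g & forall x, h x = g (f x)].
Proof.
elim: b N h => [|b IHb] N h.
  by rewrite addn0 => -[P [f [g [hf iP iN gb e]]]]; exists P, f, g.
rewrite addnS => -[P [f [g [/IHb[Q [f1 [f2 [h1 h2 e]]]] iP iN gb hE]]]].
exists Q, f1, (g \o f2); split=> // [|x]; last by rewrite hE e.
by exists P, f2, g.
Qed.

Lemma rad_path_cat a b M N P (f : {linear M -> P}) (g : {linear P -> N})
    (h : {linear M -> N}) : rad_path a f -> rad_path b g ->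
  (forall x, h x = g (f x)) -> rad_path (a + b).+1 h.
Proof.
move=> hf; elim: b N g h => [|b IHb] N g h.
  by move=> [iP iN gb] e; rewrite addn0; exists P, f, g.
move=> [Q [g1 [g2 [hg1 iQ iN g2b e]]]] hE; rewrite addnS.
exists Q, (g1 \o f), g2; split=> // [|x]; last by rewrite hE e.
exact: IHb hg1 _.
Qed.

(* [hs_length m] is 2^(m+1) - 2, so that [rad_path (hs_length m)] means
   2^(m+1) - 1 factors. *)
Fixpoint hs_length m := if m is m'.+1 then ((hs_length m').+1 + hs_length m').+1 else 0%N.

(** For [m = 0], a non-isomorphism between modules of dimension at most [d] has rank below [d]. For
    the step, the path is written [c b a] with [b] a single factor and [a], [c] of the previous
    length. If the rank did not drop below their common bound, [rank_full_split] applied before and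
    after [b] would make [b] bijective. *)
Lemma harada_sai d : (forall M, fgindec M -> (dim M <= d)%N) ->
  forall m M N (h : {linear M -> N}), rad_path (hs_length m) h ->
  nonzero_map h -> (rank h + m < d)%N.
Proof.
move=> dP; elim=> [|m IHm] M N h.
  move=> [iM iN hb] _; rewrite addn0 ltnNge; apply/negP => d_le; apply: hb.
  have [I [p [i [ps i_inj ip]]]] := im_ex h.
  rewrite (rankE iM.1 ps i_inj ip) in d_le.
  have p_inj := dim_surj_inj ps iM.1 (leq_trans (dP _ iM) d_le).
  have i_s := dim_inj_surj i_inj iN.1 (leq_trans (dP _ iN) d_le).
  apply: inj_surj_bij => [x y|y]; first by rewrite -!ip => /i_inj/p_inj.
  by have [z <-] := i_s y; have [x <-] := ps z; exists x; rewrite ip.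
move=> /(@rad_path_split (hs_length m).+1 (hs_length m))[P [ba [c [hba hc hE]]]] nz.
have [Q [a [b [ha iQ iP bb baE]]]] := hba.
rewrite ltnNge; apply/negP => d_le; apply: bb.
have [iM iQ'] := rad_path_fgindec ha; have [_ iN] := rad_path_fgindec hc.
have nz_of X (u : {linear M -> X}) (v : {linear X -> N}) :
    (forall x, h x = v (u x)) -> nonzero_map u /\ nonzero_map v.
  move=> e; have [x hx] := nz; split.
    by exists x => ux; apply: hx; rewrite e ux linear0.
  by exists (u x); rewrite -e.
have rank_congr X (u v : {linear M -> X}) : (forall x, u x = v x) -> rank u = rank v.
  move=> e; have [I [p [i [ps i_inj ip]]]] := im_ex u.
  rewrite (rankE iM.1 ps i_inj ip); apply/esym/(rankE iM.1 ps i_inj) => x.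
  by rewrite ip.
have rkh X (u : {linear M -> X}) (v : {linear X -> N}) : (forall x, h x = v (u x)) ->
    rank (v \o u) = rank h by move=> e; apply: rank_congr => x; rewrite e.
have hE1 x : h x = (c \o b) (a x) by rewrite hE baE.
have [nza nzcb] := nz_of _ _ _ hE1; have [nzba nzc] := nz_of _ _ _ hE.
have rle A B C (u : {linear A -> B}) (v : {linear B -> C}) (w : {linear A -> C}) :
    fingen A -> fingen B -> (forall x, w x = v (u x)) ->
    (rank w <= rank u)%N /\ (rank w <= rank v)%N.
  move=> fA fB e.
  have [I [p [i [ps i_inj ip]]]] := im_ex u.
  have [J [q [j [qs j_inj jq]]]] := im_ex v.
  rewrite (rankE fA ps i_inj ip) (rankE fB qs j_inj jq); split.
    apply: (@rank_factor _ _ _ _ p (v \o i)); first exact: fingen_surj ps fA.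
    by move=> x; rewrite /= ip.
  apply: (@rank_factor _ _ _ _ (q \o u) j); first exact: fingen_surj qs fB.
  by move=> x; rewrite /= jq.
have small k : (k + m < d -> k <= rank h)%N.
  by move=> lt; rewrite -(leq_add2r m.+1); apply: leq_trans d_le; rewrite addnS.
have ra := small _ (IHm _ _ _ ha nza); have rc := small _ (IHm _ _ _ hc nzc).
have [_ cb_inj] : surj a /\ injective (c \o b).
  apply: rank_full_split => //; [exact: iM.1 | | |].
  - by have [x hx] := nz; exists x; rewrite /= -baE -hE.
  - by rewrite (rkh _ _ _ hE1).
  - rewrite (rkh _ _ _ hE1); apply: leq_trans rc.
    by have [] := rle _ _ _ b c (c \o b) iQ.1 iP.1 (fun=> erefl).
have [ba_s _] : surj ba /\ injective c.
  apply: rank_full_split => //; [exact: iM.1 | | |].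
  - by have [x hx] := nz; exists x; rewrite /= -hE.
  - rewrite (rkh _ _ _ hE); apply: leq_trans ra.
    by have [] := rle _ _ _ a b ba iM.1 iQ.1 baE.
  - by rewrite (rkh _ _ _ hE).
apply: inj_surj_bij => [x y e|y]; first by apply: cb_inj; rewrite /= e.
by have [x <-] := ba_s y; exists (a x); rewrite baE.
Qed.

(** Inserting the decomposition of the identity of [Z] turns the composite into a sum over
    indecomposable summands of [Z]. A bijective component would split [h] or [g]. *)
Lemma rad_path0_split M N Z (h : {linear M -> Z}) (g : {linear Z -> N}) :
  fgindec M -> fgindec N -> fingen Z -> ~ split_mono h -> ~ split_epi g ->
  forall F : (M -> N) -> Prop, F (fun=> 0) ->
  (forall e e', F e -> F e' -> F (fun x => e x + e' x)) ->
  (forall h' : {linear M -> N}, rad_path 1 h' -> F h') -> F (g \o h).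
Proof.
move=> iM iN fZ nsm nse F F0 FD F1.
apply: (@fgindec_decomp Z (fun e => F (fun x => g (e (h x)))) fZ).
- by rewrite (_ : (fun=> _) = (fun=> 0)) //; apply/funext => x; rewrite linear0.
- move=> e e' he he'; rewrite (_ : (fun=> _) = fun x => g (e (h x)) + g (e' (h x))).
    exact: FD.
  by apply/funext => x; rewrite linearD.
- move=> A s r iA sK; apply: (F1 (g \o s \o (r \o h))).
  exists A, (r \o h), (g \o s); split=> //.
  + split=> // /bij_inv[k [kK _]]; apply: nsm; exists (k \o r) => x; exact: kK.
  + by move=> /bij_inv[k [_ Kk]]; apply: nse; exists (s \o k) => x; apply: Kk.
Qed.

(* As long as no path of irreducible maps joins [M] to [N], some factor is not
   irreducible and can be written as a sum of longer composites. *)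
Lemma rad_path_refine n M N (h : {linear M -> N}) : rad_path n h ->
  ~ clos_trans (lmodType L) (@AR_arrow L) M N ->
  forall F : (M -> N) -> Prop, F (fun=> 0) ->
  (forall e e', F e -> F e' -> F (fun x => e x + e' x)) ->
  (forall h' : {linear M -> N}, rad_path n.+1 h' -> F h') -> F h.
Proof.
have base M' N' (g : {linear M' -> N'}) : rad_path 0 g ->
    ~ clos_trans (lmodType L) (@AR_arrow L) M' N' ->
    forall F : (M' -> N') -> Prop, F (fun=> 0) ->
    (forall e e', F e -> F e' -> F (fun x => e x + e' x)) ->
    (forall g' : {linear M' -> N'}, rad_path 1 g' -> F g') -> F g.
  move=> [iM iN gb] np F F0 FD F1.
  have : ~ irreducible_map g.
    by move=> irr; apply: np; apply: t_step; split; [exact: iM|exact: iN|exists g].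
  case/not_and3P.
  - move=> /contrapT[r rK]; case: gb; exists r => //.
    exact: retract_indec rK iN.2 iM.2.1.
  - move=> /contrapT[s sK]; case: gb; exists s => //.
    exact: retract_indec sK iM.2 iN.2.1.
  - move=> /existsNP[Z /existsNP[k /existsNP[l]]].
    move=> /not_implyP[fZ /not_implyP[e /not_orP[nsm nse]]].
    have -> : (g : M' -> N') = l \o k by apply/funext.
    exact: rad_path0_split.
elim: n N h => [|n IHn] N h; first exact: base.
move=> hp np F F0 FD F1; have [P [f [g [hf iP iN gb hE]]]] := hp.
have -> : (h : M -> N) = g \o f by apply/funext.
(* The missing path from [M] to [N] means that none joins [P] to [N] or none joins [M] to [P]: the
   last factor or the initial part can be refined. *)
have [MP|nMP] := pselect (clos_trans (lmodType L) (@AR_arrow L) M P).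
  have nPN : ~ clos_trans (lmodType L) (@AR_arrow L) P N.
    by move=> PN; apply: np; apply: t_trans MP PN.
  apply: (base _ _ g _ nPN (fun g' => F (g' \o f))) => //= [e e' he he'|g' hg'].
    exact: FD he he'.
  apply: (F1 (g' \o f)).
  by have := @rad_path_cat n 1 _ _ _ f g' (g' \o f) hf hg' (fun=> erefl); rewrite addn1.
refine (IHn _ f hf nMP (fun f' : M -> P => F (fun x => g (f' x))) _ _ _).
- by rewrite (_ : (fun=> _) = fun=> 0) //; apply/funext => x /=; rewrite linear0.
- move=> e e' he he'; rewrite (_ : (fun=> _) = fun x => g (e x) + g (e' x)).
    exact: FD.
  by apply/funext => x /=; rewrite linearD.
- by move=> f' hf'; apply: (F1 (g \o f')); exists P, f', g.
Qed.

(** Without a path, [f] could be rewritten as a sum of ever longer composites, which eventually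
    vanish: at length [hs_length d] a nonzero one would satisfy [rank h + d < d]. *)
Lemma AR_path d : (forall M, fgindec M -> (dim M <= d)%N) ->
  forall M N (f : {linear M -> N}), fgindec M -> fgindec N -> ~ bijective f ->
  nonzero_map f -> clos_trans (lmodType L) (@AR_arrow L) M N.
Proof.
move=> dP M N f iM iN fb nz; apply: contrapT => np.
suff H n : exists2 h : {linear M -> N}, rad_path n h & nonzero_map h.
  have [h hp hnz] := H (hs_length d); have := harada_sai dP hp hnz.
  by rewrite ltnNge leq_addl.
elim: n => [|n [h hp hnz]]; first by exists f.
apply: contrapT => H; have [x hx] := hnz; apply: hx; move: x.
apply: (rad_path_refine hp np (F := fun e => forall x, e x = 0)) => //.
  by move=> e e' he he' x; rewrite he he' addr0.
move=> h' hp' x; apply: contrapT => hx; apply: H; exists h' => //.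
by exists x.
Qed.

End Indecomposables.

(** * A numbering of the indecomposables that increases along nonzero non-isomorphisms *)

Section RankFunction.
Variables (K : fieldType) (L : falgType K).
Implicit Types A B C E I M N P V X Y Z : lmodType L.

(* [rho] is a linear extension of the order generated by nonzero
   non-isomorphisms between indecomposables. *)
Record directing (rho : lmodType L -> nat) (bound dmax : nat) : Prop := Directing {
  rho_bound : forall M, fgindec M -> (rho M < bound)%N;
  dim_bound : forall M, fgindec M -> (dim M <= dmax)%N;
  rho_map : forall M N (f : {linear M -> N}), fgindec M -> fgindec N ->
    nonzero_map f -> bijective f \/ (rho M < rho N)%N;
  rho_iso : forall M N, fgindec M -> fgindec N -> rho M = rho N -> iso M N;
  iso_rho : forall M N, iso M N -> rho M = rho N }.

Definition rad_step M N := [/\ fgindec M, fgindec N &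
  exists f : {linear M -> N}, nonzero_map f /\ ~ bijective f].
Definition rad_lt := clos_trans (lmodType L) rad_step.

Lemma nonzero_comp_bij M M' N (g : {linear M' -> M}) (f : {linear M -> N}) :
  surj g -> nonzero_map f -> nonzero_map (f \o g).
Proof. by move=> gs [x fx]; have [y e] := gs x; exists y; rewrite /= e. Qed.

Lemma rad_lt_isol M M' N : iso M M' -> rad_lt M N -> rad_lt M' N.
Proof.
move=> MM' MN; elim: MN M' MM' => [X Y [iX iY [f [nz fb]]] X' XX'|X Y Z _ IH YZ _ X' XX'].
  have [a [b [aK bK]]] := isoP XX'; apply: t_step; split=> //.
    exact: fgindec_iso XX' iX.
  exists (f \o b); split; first by apply: nonzero_comp_bij => // x; exists (a x).
  move=> fbb; apply: fb; apply: (eq_bij (bij_comp fbb (Bijective aK bK))).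
  by move=> x /=; rewrite aK.
exact: t_trans (IH _ XX') YZ.
Qed.

Lemma rad_lt_isor M N N' : iso N N' -> rad_lt M N -> rad_lt M N'.
Proof.
move=> NN' MN; elim: MN N' NN' => [X Y [iX iY [f [nz fb]]] Y' YY'|X Y Z XY _ _ IH Z' ZZ'].
  have [a [b [aK bK]]] := isoP YY'; apply: t_step; split=> //.
    exact: fgindec_iso YY' iY.
  exists (a \o f); split.
    have [x fx] := nz; exists x => /= e; apply: fx.
    by rewrite -[f x]aK e linear0.
  move=> fbb; apply: fb; apply: (eq_bij (bij_comp (Bijective bK aK) fbb)).
  by move=> x /=; rewrite aK.
exact: t_trans XY (IH _ ZZ').
Qed.

Lemma directing_ex : representation_directed L ->
  exists rho bound dmax, directing rho bound dmax.
Proof.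
move=> [[n [T TP]] acyc].
pose dmax := \max_(i < n) dim (T i).
have dP M : fgindec M -> (dim M <= dmax)%N.
  move=> [fM iM]; have [i MTi] := TP M fM iM.
  by rewrite (dim_iso MTi fM); apply: (leq_bigmax i).
have irr M : ~ rad_lt M M.
  have path N P : rad_lt N P -> clos_trans (lmodType L) (@AR_arrow L) N P.
    elim=> [X Y [iX iY [f [nz fb]]]|X Y Z _ XY _ YZ].
      exact: (AR_path dP iX iY fb nz).
    exact: t_trans XY YZ.
  by move=> /path; apply: acyc.
pose idx M := [pick i : 'I_n | `[< iso M (T i) >]].
pose num M : nat := if idx M is Some i then (i : nat) else 0.
(* The number of representatives below [M]; by irreflexivity it strictly increases along every
   [rad_step]. *)
pose h M := #|[set i : 'I_n | `[< rad_lt (T i) M >]]|.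
have idxP M : fgindec M -> exists i, idx M = Some i /\ iso M (T i).
  move=> [fM iM]; rewrite /idx; case: pickP => [i /asboolP|H]; first by exists i.
  by have [i MTi] := TP M fM iM; have /asboolP := H i.
have num_lt M : fgindec M -> (num M < n)%N.
  by move=> /idxP[i [e _]]; rewrite /num e.
have iso_num M N : iso M N -> num M = num N.
  move=> MN; rewrite /num (_ : idx M = idx N) //.
  apply: eq_pick => i; apply/asboolP/asboolP => H.
    exact: iso_trans (iso_sym MN) H.
  exact: iso_trans MN H.
have iso_h M N : iso M N -> h M = h N.
  move=> MN; congr #|pred_of_set _|; apply/setP => i; rewrite !inE.
  apply/asboolP/asboolP; first exact: rad_lt_isor.
  exact: rad_lt_isor (iso_sym MN).
have h_lt M N : rad_step M N -> (h M < h N)%N.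
  move=> MN; have [iM iN _] := MN; have [i [_ MTi]] := idxP _ iM.
  apply: proper_card; apply/properP; split.
    apply/subsetP => j; rewrite !inE => /asboolP jM.
    by apply/asboolP; apply: t_trans jM (t_step _ _ _ _ MN).
  exists i; rewrite !inE.
    by apply/asboolP; apply: rad_lt_isol MTi (t_step _ _ _ _ MN).
  by apply/asboolP => /(rad_lt_isol (iso_sym MTi)); apply: irr.
(* The lexicographic order on the pairs of [h M] and [num M], written in base [n]: the index [num M]
   separates classes with equal [h]. Since [h M] is at most [n], all values are below [n.+1 * n]. *)
exists (fun M => h M * n + num M)%N, (n.+1 * n)%N, dmax; split=> //.
- move=> M iM; rewrite mulSn addnC; apply: leq_trans (_ : n + h M * n <= _)%N.
    by rewrite ltn_add2r num_lt.
  rewrite leq_add2l leq_mul2r; apply/orP; right.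
  by rewrite -[n in X in (_ <= X)%N]card_ord max_card.
- move=> M N f iM iN nz; have [fb|fb] := pselect (bijective f); [by left|right].
  have lt := h_lt M N (And3 iM iN (ex_intro _ f (conj nz fb))).
  apply: (@leq_trans ((h M).+1 * n)%N).
    by rewrite mulSn addnC ltn_add2r num_lt.
  by apply: leq_trans (leq_addr _ _); rewrite leq_mul2r lt orbT.
- move=> M N iM iN e; have := congr1 (modn^~ n) e.
  rewrite /= !modnMDl !modn_small ?num_lt // => e'.
  have [i [iE Mi]] := idxP _ iM; have [j [jE Nj]] := idxP _ iN.
  move: e'; rewrite /num iE jE => /val_inj ij.
  by apply: iso_trans Mi _; rewrite ij; apply: iso_sym.
- by move=> M N MN; rewrite (iso_h _ _ MN) (iso_num _ _ MN).
Qed.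

End RankFunction.

(** * Approximations in wide subcategories *)

Section WideClosure.
Variables (R : nzRingType) (W : subcategory R) (hW : wide W).
Implicit Types A B C E I L M N P V X Y Z : lmodType R.

Lemma wide_zero Z : zero_module Z -> W Z.
Proof.
move=> Z0; have [M WM] := wide_nonempty hW.
apply: (wide_ker hW (f := (idfun : {linear M -> M})) (i := \0) WM WM); split.
  by move=> x y _; rewrite [x]Z0 [y]Z0.
by move=> y; split=> [/= ->|[x <-]] //; exists 0.
Qed.

Lemma wide_ses Y E M (i : {linear Y -> E}) (p : {linear E -> M}) :
  ses i p -> W Y -> W M -> W E.
Proof. by move=> [ip ps] WY WM; apply: wide_ext ip ps. Qed.

Lemma wide_ses_sub Y E M (i : {linear Y -> E}) (p : {linear E -> M}) :
  ses i p -> W E -> W M -> W Y.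
Proof. by move=> [ip ps] WE WM; apply: wide_ker ip. Qed.

Lemma wide_ses_quo Y E M (i : {linear Y -> E}) (p : {linear E -> M}) :
  ses i p -> W Y -> W E -> W M.
Proof. by move=> /ses_coker ip WY WE; apply: wide_coker ip. Qed.

Lemma wide_prod M N : W M -> W N -> W (M * N)%type.
Proof. exact: wide_ses (ses_prod M N). Qed.

Lemma wide_im X Y I (f : {linear X -> Y}) (p : {linear X -> I}) (i : {linear I -> Y}) :
  W X -> W Y -> surj p -> injective i -> (forall x, i (p x) = f x) -> W I.
Proof.
move=> WX WY ps i_inj ip; have [C [c [cs cP]]] := coker_ex f.
have WC : W C by apply: (wide_coker hW (f := f) (c := c)).
apply: (wide_ker hW (f := c) (i := i) WY WC); split=> // y.
split=> [/cP[x <-]|[z <-]]; first by exists (p x); rewrite ip.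
by apply/cP; have [x <-] := ps z; exists x; rewrite ip.
Qed.

Lemma wide_retract X A (s : {linear A -> X}) (r : {linear X -> A}) :
  cancel s r -> W X -> W A.
Proof.
move=> sK WX; apply: (wide_im (f := s \o r) WX WX (p := r) (i := s)) => //.
  by move=> a; exists (s a).
exact: can_inj sK.
Qed.
End WideClosure.

Section Approximations.
Variables (K : fieldType) (L : falgType K).
Implicit Types A B C E I M N P Q V X Y Z : lmodType L.
Variables (rho : lmodType L -> nat) (bound dmax : nat).
Hypothesis D : directing rho bound dmax.

Inductive sums M : lmodType L -> Prop :=
| sums_zero Z : zero_module Z -> sums M Z
| sums_prod Q : sums M Q -> sums M (M * Q)%type.

(** The source is one copy of [M] for each [F j]; for a spanning family of Hom(M, Y) this gives a
    right approximation. *)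
Lemma right_approx_seq M Y n (F : 'I_n -> {linear M -> Y}) :
  exists Q (h : {linear Q -> Y}), sums M Q /\
    forall j, exists m : {linear M -> Q}, forall x, h (m x) = F j x.
Proof.
elim: n F => [|n IHn] F.
  have [Z Z0] := zero_module_ex L.
  by exists Z, \0; split=> [|[]//]; apply: sums_zero.
have [Q [h [sQ hP]]] := IHn (F \o lift ord0).
exists (M * Q)%type, (copair_lin (F ord0) h); split; first exact: sums_prod.
move=> j; case: (unliftP ord0 j) => [k ->|->].
  have [m mP] := hP k; exists (inr_lin M Q \o m) => x.
  by rewrite copair_linE /= linear0 add0r mP.
by exists (inl_lin M Q) => x; rewrite copair_linE /= linear0 addr0.
Qed.

Lemma right_approx_ex M Y : fingen M -> fingen Y ->
  exists Q (h : {linear Q -> Y}), sums M Q /\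
    forall m : {linear M -> Y}, exists m' : {linear M -> Q}, forall x, h (m' x) = m x.
Proof.
move=> fM fY; have [n [F FP]] := hom_span fM fY.
have [Q [h [sQ hP]]] := right_approx_seq F.
exists Q, h; split=> // m; have [a aP] := FP m.
have : forall k, (k <= n)%N -> exists m' : {linear M -> Q},
    forall x, h (m' x) = \sum_(j < n | (j < k)%N) kscale Y (a j) (F j x).
  elim=> [_|k IHk lt_kn]; first by exists \0 => x; rewrite linear0 big_pred0.
  have [m' m'P] := IHk (ltnW lt_kn); have [q qP] := hP (Ordinal lt_kn).
  exists (m' \+ (kscale Q (a (Ordinal lt_kn)) \o q)) => x.
  rewrite linearD m'P /= linearZ /= qP [RHS](bigD1 (Ordinal lt_kn)) //= addrC.
  congr (_ + _); apply: eq_bigl => j.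
  by rewrite ltnS -(inj_eq val_inj) /=; case: ltngtP.
move=> /(_ n (leqnn n))[m' m'P]; exists m' => x.
by rewrite m'P aP; apply: eq_bigl => j; rewrite ltn_ord.
Qed.

Lemma sums_ind' M (F : lmodType L -> Prop) :
  (forall Z, zero_module Z -> F Z) -> F M -> (forall X Y, F X -> F Y -> F (X * Y)%type) ->
  forall Q, sums M Q -> F Q.
Proof. by move=> F0 FM FD Q; elim=> [Z /F0 //|Q' _]; apply: FD. Qed.

Lemma sums_wide (W : subcategory L) M Q : wide W -> W M -> sums M Q -> W Q.
Proof.
move=> hW WM; apply: (sums_ind' (F := W)) => // [Z Z0|X Y WX WY].
  exact: (wide_zero hW Z0).
exact: (wide_prod hW WX WY).
Qed.

Lemma sums_hom0 M N Q : hom_zero N M -> sums M Q -> hom_zero N Q.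
Proof.
move=> NM; apply: (sums_ind' (F := hom_zero N)) => // [Z Z0 f x|X Y NX NY f x]; first exact: Z0.
rewrite [LHS]surjective_pairing.
by have /= -> := NX (fst \o f) x; have /= -> := NY (snd \o f) x.
Qed.

Lemma sums_hom0_dom M N Q : hom_zero M N -> sums M Q -> hom_zero Q N.
Proof.
move=> NM; apply: (sums_ind' (F := fun X => hom_zero X N)) => // [Z Z0 f x|X Y NX NY f [x y]].
  by rewrite [x]Z0 linear0.
rewrite -[(x, y)]/((x, y) : (X * Y)%type).
have -> : (x, y) = inl_lin X Y x + inr_lin X Y y.
  by congr (_, _); rewrite /= ?addr0 ?add0r.
by rewrite linearD; have /= -> := NX (f \o inl_lin X Y) x; have /= -> := NY (f \o inr_lin X Y) y; rewrite addr0.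
Qed.

Section LeftApproximation.
Variables (T : lmodType L -> Prop) (N : lmodType L).
Hypotheses (T_fingen : forall X, T X -> fingen X)
  (T_zero : forall Z, zero_module Z -> T Z)
  (T_prod : forall X Y, T X -> T Y -> T (X * Y)%type)
  (T_retract : forall X A (s : {linear A -> X}) (r : {linear X -> A}),
     cancel s r -> T X -> T A)
  (T_im : forall X I (p : {linear X -> I}) (i : {linear I -> X}),
     surj p -> injective i -> T X -> T I)
  (N_fingen : fingen N).

Definition factors Z X (g : {linear N -> Z}) (f : {linear N -> X}) :=
  exists g' : {linear X -> Z}, forall x, g' (f x) = g x.

Lemma left_approx_seq Z n (F : 'I_n -> {linear N -> Z}) : T Z ->
  exists X (f : {linear N -> X}), T X /\ forall j, factors (F j) f.
Proof.
move=> TZ; elim: n F => [|n IHn] F.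
  have [Y Y0] := zero_module_ex L.
  by exists Y, \0; split=> [|[]//]; apply: T_zero.
have [X [f [TX fP]]] := IHn (F \o lift ord0).
exists (Z * X)%type, (pair_lin (F ord0) f); split; first exact: T_prod.
move=> j; case: (unliftP ord0 j) => [k ->|->]; last by exists fst.
by have [g gP] := fP k; exists (g \o snd).
Qed.

Lemma left_approx_one Z : T Z ->
  exists X (f : {linear N -> X}), T X /\ forall g : {linear N -> Z}, factors g f.
Proof.
move=> TZ; have [n [F FP]] := hom_span N_fingen (T_fingen TZ).
have [X [f [TX fP]]] := left_approx_seq F TZ.
exists X, f; split=> // m; have [a aP] := FP m.
have : forall k, (k <= n)%N -> exists m' : {linear X -> Z},
    forall x, m' (f x) = \sum_(j < n | (j < k)%N) kscale Z (a j) (F j x).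
  elim=> [_|k IHk lt_kn]; first by exists \0 => x; rewrite big_pred0.
  have [m' m'P] := IHk (ltnW lt_kn); have [q qP] := fP (Ordinal lt_kn).
  exists (m' \+ (kscale Z (a (Ordinal lt_kn)) \o q)) => x.
  rewrite /= m'P qP [RHS](bigD1 (Ordinal lt_kn)) //= addrC.
  congr (_ + _); apply: eq_bigl => j.
  by rewrite ltnS -(inj_eq val_inj) /=; case: ltngtP.
move=> /(_ n (leqnn n))[m' m'P]; exists m' => x.
by rewrite m'P aP; apply: eq_bigl => j; rewrite ltn_ord.
Qed.

Definition left_approx X (f : {linear N -> X}) :=
  T X /\ forall Z (g : {linear N -> Z}), T Z -> factors g f.

(** Indecomposables are exhausted by the values of [rho] below [bound], so the induction adds one
    isomorphism class of targets at a time. [fgindec_decomp] then extends the factorization to all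
    targets in [T]. *)
Lemma left_approx_ex : exists X (f : {linear N -> X}), left_approx f.
Proof.
have [X [f [TX fP]]] : exists X (f : {linear N -> X}), T X /\
    forall Z (g : {linear N -> Z}), T Z -> fgindec Z -> (rho Z < bound)%N -> factors g f.
  elim: bound => [|k [X [f [TX fP]]]].
    have [Y Y0] := zero_module_ex L.
    by exists Y, \0; split=> //; apply: T_zero.
  have [[Z [TZ iZ rZ]]|nZ] := pselect (exists Z, [/\ T Z, fgindec Z & rho Z = k]).
    have [X' [f' [TX' fP']]] := left_approx_one TZ.
    exists (X * X')%type, (pair_lin f f'); split; first exact: T_prod.
    move=> Y g TY iY; rewrite ltnS leq_eqVlt => /orP[/eqP rY|lt].
      have [a [b [aK bK]]] := isoP (rho_iso D iY iZ (etrans rY (esym rZ))).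
      have [h hP] := fP' (a \o g); exists (b \o h \o snd) => x /=.
      by rewrite hP /= aK.
    by have [h hP] := fP Y g TY iY lt; exists (h \o fst).
  exists X, f; split=> // Y g TY iY; rewrite ltnS leq_eqVlt => /orP[/eqP rY|lt].
    by case: nZ; exists Y.
  exact: fP.
exists X, f; split=> // Z g TZ; rewrite /factors.
apply: (@fgindec_decomp _ _ Z (fun e => exists g' : {linear X -> Z}, forall x, g' (f x) = e (g x)) (T_fingen TZ)).
- by exists \0.
- by move=> e e' [h hP] [h' hP']; exists (h \+ h') => x /=; rewrite hP hP'.
- move=> A s r iA sK.
  have [h hP] := fP A (r \o g) (T_retract sK TZ) iA (rho_bound D iA).
  by exists (s \o h) => x /=; rewrite hP.
Qed.

(** An approximation of least dimension: if [f] factors through a subobject lying in [T], that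
    subobject again carries an approximation, so it is everything. Applied to the image of [h], this
    makes [h] onto, hence bijective. *)
Lemma min_left_approx_ex : exists X (f : {linear N -> X}),
  [/\ left_approx f,
      forall X' (f' : {linear N -> X'}) (j : {linear X' -> X}), T X' ->
        injective j -> (forall x, j (f' x) = f x) -> surj j &
      forall h : {linear X -> X}, (forall x, h (f x) = f x) -> bijective h].
Proof.
pose q n := `[< exists X (f : {linear N -> X}), left_approx f /\ dim X = n >].
have Qex : exists n, q n.
  by have [X [f fP]] := left_approx_ex; exists (dim X); apply/asboolP; exists X, f.
case: (ex_minnP Qex) => n /asboolP[X [f [[TX fP] dX]]] min_n.
have H X' (f' : {linear N -> X'}) (j : {linear X' -> X}) : T X' ->
    injective j -> (forall x, j (f' x) = f x) -> surj j.
  move=> TX' j_inj jf; apply: dim_inj_surj => //; first exact: T_fingen.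
  rewrite dX; apply: min_n; apply/asboolP; exists X', f'; split=> //; split=> //.
  by move=> Z g TZ; have [h hP] := fP Z g TZ; exists (h \o j) => x /=; rewrite jf.
exists X, f; split=> // h hf; apply: endo_surj; first exact: T_fingen.
have [I [p [i [ps i_inj ip]]]] := im_ex h.
have i_s : surj i.
  apply: (H I (p \o f) i) => //; first exact: T_im ps i_inj TX.
  by move=> x; rewrite /= ip.
by move=> y; have [z <-] := i_s y; have [x <-] := ps z; exists x; rewrite ip.
Qed.

End LeftApproximation.
End Approximations.

(** * Tau-perpendicular subcategories *)

Section TauPerpendicular.
Variables (K : fieldType) (L : falgType K).
Implicit Types A B C E I M N P Q V X Y Z : lmodType L.
Implicit Types (U W : subcategory L).

(* For [M] and [X] in [W], this is equivalent to Hom(X, tau_W M) = 0: see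
   [tau_in_qext]. *)
Definition qext W M X := forall Y (q : {linear X -> Y}), W Y -> surj q -> ext0 M Y.

(* J_W(M). *)
Definition perp W M : subcategory L := fun X => [/\ W X, hom_zero M X & qext W M X].

(* [M] is indecomposable in [W] with [U] contained in J_W(M). *)
Definition perp_above U W M := [/\ W M, fgindec M & forall V, U V -> hom_zero M V /\ qext W M V].

Lemma qext_ext0 W M X : W X -> qext W M X -> ext0 M X.
Proof. by move=> WX /(_ _ idfun WX); apply=> x; exists x. Qed.

Lemma qext_quo W M X Y (q : {linear X -> Y}) : surj q -> qext W M X -> qext W M Y.
Proof. by move=> qs MX Z r WZ rs; apply: (MX _ (r \o q)) => //; apply: surj_comp. Qed.

Lemma qext_iso W M X Y : iso X Y -> qext W M X -> qext W M Y.
Proof. by move=> [f /bij_surj fs]; apply: qext_quo fs. Qed.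

Lemma qext_retract W M X A (s : {linear A -> X}) (r : {linear X -> A}) :
  cancel s r -> qext W M X -> qext W M A.
Proof. by move=> sK; apply: (qext_quo (q := r)) => a; exists (s a). Qed.

(** A quotient [Z] of [E] is an extension of a quotient of [Y] by the image of [X]. *)
Lemma qext_ses W M X E Y (i : {linear X -> E}) (p : {linear E -> Y}) : wide W ->
  ses i p -> W X -> qext W M X -> qext W M Y -> qext W M E.
Proof.
move=> hW ip WX MX MY Z q WZ qs.
have [I [a [b [as_ b_inj ba]]]] := im_ex (q \o i).
have WI : W I by apply: (wide_im hW WX WZ as_ b_inj ba).
have [C [c bc]] := ses_of_inj b_inj.
have WC : W C := wide_ses_quo hW bc WI WZ.
have [|d dP] := ses_desc (f := c \o q) ip.
  by move=> y; rewrite /= -[q (i y)]/((q \o i) y) -ba (ses0 _ bc).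
apply: (ext0_ext bc); first exact: MX as_.
apply: (MY _ d) => // z; have [t <-] := ses_surj bc z; have [e <-] := qs t.
by exists (p e); rewrite dP.
Qed.

Lemma qext_zero W M Z : zero_module Z -> qext W M Z.
Proof.
move=> Z0 Y q _ qs E X i p ip u; exists \0 => x.
by have [z <-] := qs (u x); rewrite [z]Z0 linear0.
Qed.

Lemma qext_prod W M X Y : wide W -> W X -> qext W M X -> qext W M Y -> qext W M (X * Y)%type.
Proof. by move=> hW; apply: qext_ses (ses_prod X Y). Qed.

Lemma qext_sums W M N Q : wide W -> W M -> qext W N M -> sums M Q -> qext W N Q.
Proof.
move=> hW WM NM sQ; suff [] : W Q /\ qext W N Q by [].
apply: (sums_ind' (F := fun X => W X /\ qext W N X)) sQ => // [Z Z0|X Y [WX NX] [WY NY]].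
  by split; [apply: (wide_zero hW Z0) | apply: qext_zero].
by split; [apply: (wide_prod hW WX WY) | apply: qext_prod].
Qed.

(** A quotient [Z] of the kernel is pushed out to a quotient of [X], on which Ext^1(M, -) vanishes.
    The lifting hypothesis kills the connecting map that could contribute to Ext^1(M, Z). *)
Lemma qext_ker W M X N Y (i : {linear N -> X}) (p : {linear X -> Y}) :
  wide W -> ses i p -> W Y -> W X ->
  (forall m : {linear M -> Y}, exists m' : {linear M -> X}, forall x, p (m' x) = m x) ->
  qext W M X -> qext W M N.
Proof.
move=> hW ip WY WX lift MX Z q WZ qs.
have [E [j [r [v [jr e1 e2]]]]] := pushout_ses q ip.
have vs : surj v.
  move=> e; have [x px] := ses_surj ip (r e).
  have [|z jz] := ses_ker (e := e - v x) jr; first by rewrite linearB e2 px subrr.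
  have [k qk] := qs z; exists (x + i k).
  by rewrite linearD e1 qk jz addrC subrK.
have WE : W E := wide_ses hW jr WZ WY.
apply: ext0_ker jr _ _; last exact: MX vs.
by move=> m; have [m' m'P] := lift m; exists (v \o m') => x; rewrite /= e2.
Qed.

Lemma hom_zero_inj M X Y (i : {linear X -> Y}) : injective i -> hom_zero M Y -> hom_zero M X.
Proof. by move=> i_inj MY f x; apply: i_inj; rewrite linear0; apply: (MY (i \o f)). Qed.

Lemma qext_ker_map W M X V N (i : {linear N -> X}) (a : {linear X -> V}) :
  wide W -> is_kernel a i -> W X -> W V -> hom_zero M V -> qext W M X -> qext W M N.
Proof.
move=> hW [i_inj iP] WX WV MV MX.
have [I [p [j [ps j_inj jp]]]] := im_ex a.
have WI := wide_im hW WX WV ps j_inj jp.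
have ip : ses i p.
  split=> //; split=> // x; rewrite -iP -jp.
  by split=> [->|e]; [rewrite linear0 | apply: j_inj; rewrite linear0].
apply: (qext_ker hW ip WI WX) MX => m; exists \0 => x.
by rewrite linear0 (hom_zero_inj j_inj MV).
Qed.

Lemma perp_wide W M : wide W -> wide (perp W M).
Proof.
move=> hW; split.
- by move=> X [/(wide_fingen hW)].
- move=> X Y [WX MX qX] XY; split; first exact: wide_iso hW _ _ WX XY.
    have [f [g [fK gK]]] := isoP XY.
    exact: hom_zero_inj (can_inj gK) MX.
  exact: qext_iso XY qX.
- have [Z Z0] := zero_module_ex L; exists Z; split.
  + exact: (wide_zero hW Z0).
  + by move=> f x; apply: Z0.
  + exact: qext_zero.
- move=> X Y Z f i [WX MX qX] [WY MY qY] fi; split.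
  + exact: wide_ker hW _ _ _ _ _ WX WY fi.
  + by case: fi => i_inj _; apply: hom_zero_inj i_inj MX.
  + exact: qext_ker_map hW fi WX WY MY qX.
- move=> X Y C f c [WX MX qX] [WY MY qY] fc; split.
  + exact: wide_coker hW _ _ _ _ _ WX WY fc.
  + have [I [p [j [ps j_inj jp]]]] := im_ex f.
    have WI := wide_im hW WX WY ps j_inj jp.
    have jc : ses j c.
      case: fc => cs cP; split=> //; split=> // y; rewrite cP; split=> [[x <-]|[z <-]].
        by exists (p x).
      by have [x <-] := ps z; exists x.
    (* The image of [f] is a quotient of [X], so Ext^1(M, -) vanishes on it and every map from [M]
       to [C] lifts to [Y]. *)
    move=> m x; have [m' <-] := ext0_lift m (qX _ p WI ps) jc.
    by rewrite MY linear0.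
  + by case: fc => cs _; apply: qext_quo cs qY.
- move=> X E Y i p [WX MX qX] [WY MY qY] kip ps; split.
  + exact: wide_ext hW _ _ _ _ _ WX WY kip ps.
  + move=> m x; have [|m' m'P] := ses_lift (f := m) (conj kip ps).
      by move=> z; apply: (MY (p \o m)).
    by rewrite -m'P MX linear0.
  + exact: qext_ses hW (conj kip ps) WX qX qY.
Qed.

Lemma perp_above_sub U W M V : (forall X, U X -> W X) -> perp_above U W M -> U V -> perp W M V.
Proof. by move=> UW [_ _ H] UV; have [] := H _ UV; split=> //; apply: UW. Qed.

Lemma perp_above_perp W M : W M -> fgindec M -> perp_above (perp W M) W M.
Proof. by move=> WM iM; split=> // V []. Qed.

Lemma hom_zero_self M : hom_zero M M -> zero_module M.
Proof. by move=> H x; apply: (H idfun x). Qed.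

Lemma perp_notin W M : fgindec M -> ~ perp W M M.
Proof. by move=> [_ [nz _]] [_ /hom_zero_self]. Qed.

Lemma perp_above_self U M : ~ perp_above U U M.
Proof. by move=> [UM [_ [nz _]] /(_ _ UM)[/hom_zero_self]]. Qed.

Lemma perp_above_mono U U' W M : (forall X, U X -> U' X) -> perp_above U' W M -> perp_above U W M.
Proof. by move=> UU' [WM iM H]; split=> // V /UU' /H. Qed.

Section Directed.
Variables (rho : lmodType L -> nat) (bound dmax : nat).
Hypothesis D : directing rho bound dmax.

Lemma rho_hom0 M N : fgindec M -> fgindec N -> (rho N < rho M)%N -> hom_zero M N.
Proof.
move=> iM iN lt; apply: contrapT => /existsNP[f /nonzero_mapP nz].
have [fb|] := rho_map D iM iN nz; last by rewrite ltnNge (ltnW lt).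
have MN : iso M N by exists f.
by move: lt; rewrite (iso_rho D MN) ltnn.
Qed.

Lemma rho_le M N (f : {linear M -> N}) : fgindec M -> fgindec N -> nonzero_map f ->
  (rho M <= rho N)%N.
Proof.
move=> iM iN [x fx]; rewrite leqNgt; apply/negP => lt; apply: fx.
exact: rho_hom0 lt _ _.
Qed.

Lemma indec_endo_bij M (f : {linear M -> M}) : fgindec M -> nonzero_map f -> bijective f.
Proof. by move=> iM nz; have [//|] := rho_map D iM iM nz; rewrite ltnn. Qed.

Lemma fgindec_nz A : fgindec A -> exists x : A, x <> 0.
Proof. by move=> [_ [/existsNP[x x0] _]]; exists x. Qed.

(** If the component of [i] at [A] were bijective, the sequence would split. If [A] mapped to 0 in
    [M], it would lie in [Y] and that component would be bijective. If [A] mapped isomorphically to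
    [M], the sequence would split again. *)
Lemma ses_mid Y E M A (i : {linear Y -> E}) (p : {linear E -> M})
    (s : {linear A -> E}) (r : {linear E -> A}) :
  fgindec Y -> fgindec M -> ses i p -> ~ split_epi p -> fgindec A -> cancel s r ->
  nonzero_map (r \o i) -> (rho Y < rho A < rho M)%N.
Proof.
move=> iY iM ip nsp iA sK nz.
have nb : ~ bijective (r \o i).
  move=> /bij_inv[k [kK _]]; apply: nsp.
  exact: (retr_split (r := k \o r) ip).
have nzps : nonzero_map (p \o s).
  apply: nonzero_mapP => ps0.
  have [t tP] := ses_lift (f := s) ip ps0.
  have tK : cancel t (r \o i) by move=> a; rewrite /= tP sK.
  by apply: nb; exists t => //; apply: retract_indec tK iY.2 iA.2.1.
have nb' : ~ bijective (p \o s).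
  by move=> /bij_inv[k [_ Kk]]; apply: nsp; exists (s \o k) => x; apply: Kk.
by have [//|->] := rho_map D iY iA nz; have [//|->] := rho_map D iA iM nzps.
Qed.

Lemma ext0_nsplit M X : ~ ext0 M X ->
  exists E (i : {linear X -> E}) (p : {linear E -> M}), ses i p /\ ~ split_epi p.
Proof.
move=> H; apply: contrapT => H'; apply: H; apply: ext0_of_split => E i p ip.
by apply: contrapT => nsp; apply: H'; exists E, i, p.
Qed.

Lemma ext0_rho M Y : fgindec M -> fgindec Y -> ~ ext0 M Y -> (rho Y < rho M)%N.
Proof.
move=> iM iY /ext0_nsplit[E [i [p [ip nsp]]]].
have nzi : nonzero_map i.
  have [y ny] := fgindec_nz iY; exists y => e; apply: ny.
  by apply: (ses_inj ip); rewrite e linear0.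
have [A [s [r [iA sK nz]]]] := indec_target (fingen_ext ip iY.1 iM.1) nzi.
by have /andP[a b] := ses_mid iY iM ip nsp iA sK nz; apply: ltn_trans a b.
Qed.

Lemma ext0_indec_bound M Y : fgindec M -> fingen Y ->
  (forall A (q : {linear Y -> A}), fgindec A -> surj q -> (rho M <= rho A)%N) -> ext0 M Y.
Proof.
move=> iM fY H; apply: contrapT => /(indec_ext fY)[A [s [r [iA sK nA]]]].
have := H A r iA (fun a => ex_intro _ (s a) (sK a)).
by rewrite leqNgt (ext0_rho iM iA nA).
Qed.

Lemma qext_bound W M X : wide W -> fgindec M ->
  (forall A (q : {linear X -> A}), fgindec A -> surj q -> (rho M <= rho A)%N) -> qext W M X.
Proof.
move=> hW iM H Y q WY qs; apply: ext0_indec_bound => // [|A r iA rs].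
  exact: wide_fingen hW _ WY.
by apply: (H A (r \o q)) => //; apply: surj_comp.
Qed.

Lemma surj_nz X A (q : {linear X -> A}) : fgindec A -> surj q -> nonzero_map q.
Proof.
by move=> /fgindec_nz[a na] qs; have [x qx] := qs a; exists x; rewrite qx.
Qed.

(** An indecomposable quotient of [M] receives a nonzero map from [M], so its [rho] is too large for
    an extension with [M]. *)
Lemma qext_rigid W M : wide W -> fgindec M -> qext W M M.
Proof.
move=> hW iM; apply: qext_bound => // A q iA qs.
exact: rho_le (q) iM iA (surj_nz iA qs).
Qed.

Lemma sums_rho M Q A (q : {linear Q -> A}) : fgindec M -> sums M Q -> fgindec A ->
  surj q -> (rho M <= rho A)%N.
Proof.
move=> iM sQ iA qs; rewrite leqNgt; apply/negP => lt.
have [x] := surj_nz iA qs; apply.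
exact: (sums_hom0_dom (rho_hom0 iM iA lt) sQ).
Qed.

(* [I] is the trace of [M] in [X]. *)
Lemma trace_ex W M X : wide W -> W M -> fgindec M -> W X -> exists Q I C
    (h : {linear Q -> I}) (i : {linear I -> X}) (c : {linear X -> C}),
  [/\ sums M Q, surj h, ses i c, W C & hom_zero M C] /\
  [/\ W Q, W I, qext W M Q & forall m : {linear M -> X},
     exists m' : {linear M -> Q}, forall x, i (h (m' x)) = m x].
Proof.
move=> hW WM iM WX.
have [Q [g [sQ gP]]] := right_approx_ex iM.1 (wide_fingen hW WX).
have WQ := sums_wide hW WM sQ.
have [I [h [i [hs i_inj ih]]]] := im_ex g.
have WI := wide_im hW WQ WX hs i_inj ih.
have [C [c ic]] := ses_of_inj i_inj.
have WC : W C := wide_ses_quo hW ic WI WX.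
have qQ : qext W M Q := qext_sums hW WM (qext_rigid hW iM) sQ.
exists Q, I, C, h, i, c; split; split=> //.
  (* A map from [M] to the cokernel lifts to [X], as the trace is a quotient of [Q]; the lift lands
     in the trace, so the map was 0. *)
  move=> m x; have [m1 <-] := ext0_lift m (qQ _ h WI hs) ic.
  by have [m2 <-] := gP m1; rewrite -ih (ses0 _ ic).
by move=> m; have [m' m'P] := gP m; exists m' => x; rewrite ih.
Qed.

End Directed.
End TauPerpendicular.

(** * Projective objects of a wide subcategory *)

Section Projectives.
Variables (K : fieldType) (L : falgType K).
Implicit Types A B C E I M N P Q S V X Y Z : lmodType L.
Variables (rho : lmodType L -> nat) (bound dmax : nat).
Hypothesis D : directing rho bound dmax.
Variables (W : subcategory L) (hW : wide W).

Definition proj_in P := forall X Y (p : {linear X -> Y}) (f : {linear P -> Y}),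
  W X -> W Y -> surj p -> exists g : {linear P -> X}, forall x, p (g x) = f x.

Lemma proj_in_prod P Q : proj_in P -> proj_in Q -> proj_in (P * Q)%type.
Proof.
move=> hP hQ X Y p f WX WY ps.
have [g gE] := hP _ _ p (f \o inl_lin P Q) WX WY ps.
have [h hE] := hQ _ _ p (f \o inr_lin P Q) WX WY ps.
exists (copair_lin g h) => -[x y]; rewrite copair_linE linearD gE hE /= -linearD /=.
by congr (f _); congr (_, _); rewrite /= ?addr0 ?add0r.
Qed.

Lemma proj_in_split P : W P ->
  (forall E (p : {linear E -> P}), W E -> surj p -> split_epi p) -> proj_in P.
Proof.
move=> WP sp X Y p f WX WY ps; have [N [i ip]] := ses_of_surj ps.
have [E [i' [p' [v [ip' e1 e2 _]]]]] := pullback_ses f ip.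
have WN : W N := wide_ses_sub hW ip WX WY.
have [s sK] := sp _ p' (wide_ses hW ip' WN WP) (ses_surj ip').
by exists (v \o s) => x /=; rewrite e1 sK.
Qed.

Definition simple_in S := [/\ W S, ~ zero_module S &
  forall Y (i : {linear Y -> S}), W Y -> injective i -> zero_module Y \/ surj i].

Lemma dim_gt0 M : fingen M -> ~ zero_module M -> (0 < dim M)%N.
Proof. by move=> fM nz; rewrite lt0n; apply/eqP => /(dim_eq0 fM). Qed.

Lemma simple_quo_ex X : W X -> ~ zero_module X ->
  exists S (q : {linear X -> S}), simple_in S /\ surj q.
Proof.
move=> WX nz.
pose T n := `[< exists S (q : {linear X -> S}), [/\ W S, ~ zero_module S, surj q & dim S = n] >].
have Tex : exists n, T n.
  by exists (dim X); apply/asboolP; exists X, idfun; split=> // x; exists x.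
case: (ex_minnP Tex) => n /asboolP[S [q [WS nzS qs dS]]] min_n.
exists S, q; split=> //; split=> // Y i WY i_inj.
have [Y0|nY] := pselect (zero_module Y); [by left|right].
have [C [c ic]] := ses_of_inj i_inj.
have WC : W C := wide_ses_quo hW ic WY WS.
have [C0|nC] := pselect (zero_module C); first by move=> x; apply: (ses_ker ic).
have := min_n (dim C); rewrite -dS (dim_ses ic (wide_fingen hW WS)).
rewrite -[X in (_ <= X)%N]add0n leq_add2r leqNgt dim_gt0 //; last exact: wide_fingen hW _ WY.
move=> H; suff: false by []; apply: H; apply/asboolP; exists C, (c \o q); split=> //.
exact: surj_comp (ses_surj ic).
Qed.

Lemma simple_map S X (f : {linear X -> S}) : simple_in S -> W X ->
  (forall x, f x = 0) \/ surj f.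
Proof.
move=> [WS nzS sS] WX; have [I [p [i [ps i_inj ip]]]] := im_ex f.
have [I0|is_] := sS I i (wide_im hW WX WS ps i_inj ip) i_inj.
  by left=> x; rewrite -ip [p x]I0 linear0.
by right=> y; have [z <-] := is_ y; have [x <-] := ps z; exists x.
Qed.

(** An essential epimorphism in [W]. *)
Definition topped S Z (t : {linear Z -> S}) := [/\ W Z, surj t &
  forall Y (i : {linear Y -> Z}), W Y -> injective i -> surj (t \o i) -> surj i].

(** One of two complementary summands already maps onto the simple object [S], so it is
    everything. *)
Lemma topped_indec S Z (t : {linear Z -> S}) : simple_in S -> topped t -> fgindec Z.
Proof.
move=> sS [WZ ts tP]; split; first exact: wide_fingen hW _ WZ.
split=> [Z0|A B ZAB].
  by case: sS => _ nz _; apply: nz => x; have [z <-] := ts x; rewrite [z]Z0 linear0.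
have [f [g [fK gK]]] := isoP ZAB.
pose a : {linear A -> Z} := g \o inl_lin A B; pose b : {linear B -> Z} := g \o inr_lin A B.
have aK : cancel a (fst \o f) by move=> x; rewrite /= gK.
have bK : cancel b (snd \o f) by move=> x; rewrite /= gK.
have WA := wide_retract hW aK WZ; have WB := wide_retract hW bK WZ.
have gE x y : g (x, y) = a x + b y.
  by rewrite /a /b /= -linearD; congr (g _); congr (_, _); rewrite /= ?addr0 ?add0r.
have [ta0|tas] := simple_map (t \o a) sS WA; last first.
  right=> y; have [x e] := tP _ _ WA (can_inj aK) tas (b y).
  by rewrite -[y]bK -e /= gK.
left=> x; have tbs : surj (t \o b).
  move=> s; have [z <-] := ts s; exists (f z).2.
  rewrite -[in RHS](fK z) [in RHS](surjective_pairing (f z)) gE linearD.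
  by rewrite -[t (a _)]/((t \o a) _) ta0 add0r.
have [y e] := tP _ _ WB (can_inj bK) tbs (a x).
by rewrite -[x]aK -e /= gK.
Qed.

(* Among the objects of [W] with simple top [S], one of maximal dimension is
   projective in [W]. *)
Lemma proj_cover_simple S : simple_in S -> exists P (t : {linear P -> S}),
  [/\ W P, proj_in P & topped t].
Proof.
move=> sS; have [WS nzS _] := sS.
pose T n := `[< exists Z (t : {linear Z -> S}), topped t /\ dim Z = n >].
have Tex : exists n, T n.
  exists (dim S); apply/asboolP; exists S, idfun; split=> //.
  by split=> // x; exists x.
have Tb n : T n -> (n <= dmax)%N.
  by move=> /asboolP[Z [t [tt <-]]]; apply: (dim_bound D); apply: topped_indec sS tt.
case: (ex_maxnP Tex Tb) => n /asboolP[Z [t [tt dZ]]] max_n.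
have [WZ ts tP] := tt; exists Z, t; split=> //; apply: proj_in_split => // E p WE ps.
(* [E] is cut down to a smallest subobject [E'] still mapping onto [Z]. It is [topped] again, so by
   maximality of [dim Z] it is mapped isomorphically to [Z]. *)
pose T' n := `[< exists Y (j : {linear Y -> E}),
  [/\ W Y, injective j, surj (p \o j) & dim Y = n] >].
have Tex' : exists n, T' n by exists (dim E); apply/asboolP; exists E, idfun; split.
case: (ex_minnP Tex') => m /asboolP[E' [j [WE' j_inj pjs dE']]] min_m.
have fE' := wide_fingen hW WE'.
have tE' : topped (t \o (p \o j)).
  split=> // [|Y i WY i_inj s]; first exact: surj_comp pjs ts.
  apply: dim_inj_surj => //; rewrite dE'; apply: min_m; apply/asboolP.
  exists Y, (j \o i); split=> //; first exact: inj_comp.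
  have [I [a [b [as_ b_inj ba]]]] := im_ex (p \o j \o i).
  have WI := wide_im hW WY WZ as_ b_inj ba.
  have bs : surj b.
    apply: (tP _ b WI b_inj) => x; have [y yP] := s x.
    by exists (a y); rewrite /= ba.
  by move=> z; have [u <-] := bs z; have [y <-] := as_ u; exists y; rewrite ba.
have dle : (dim E' <= dim Z)%N.
  by rewrite dZ; apply: max_n; apply/asboolP; exists E', (t \o (p \o j)).
have [k [_ kK]] := lin_inv (dim_surj_inj pjs fE' dle) pjs.
by exists (j \o k) => z; apply: kK.
Qed.

(** A map from a projective with image of maximal dimension is onto: otherwise the projective cover
    of a simple quotient of the cokernel lifts to [X] and enlarges the image. *)
Lemma enough_proj X : W X -> exists P (h : {linear P -> X}), [/\ W P, proj_in P & surj h].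
Proof.
move=> WX; have fX := wide_fingen hW WX.
pose T n := `[< exists P I (p : {linear P -> I}) (i : {linear I -> X}),
  [/\ W P, proj_in P, surj p, injective i & dim I = n] >].
have Tex : exists n, T n.
  have [Z Z0] := zero_module_ex L; exists (dim Z); apply/asboolP.
  exists Z, Z, idfun, \0; split=> //; first exact: (wide_zero hW Z0).
  - by move=> A B p f _ _ _; exists \0 => x; rewrite [x]Z0 !linear0.
  - by move=> x; exists x.
  - by move=> x y _; rewrite [x]Z0 [y]Z0.
have Tb n : T n -> (n <= dim X)%N.
  by move=> /asboolP[P [I [p [i [_ _ _ i_inj <-]]]]]; apply: dim_inj i_inj fX.
case: (ex_maxnP Tex Tb) => n /asboolP[P [I [p [i [WP hP ps i_inj dI]]]]] max_n.
exists P, (i \o p); split=> //; apply: surj_comp => //.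
have WI : W I by apply: (wide_im hW WP WX ps i_inj (f := i \o p)).
have [C [c ic]] := ses_of_inj i_inj.
have WC : W C := wide_ses_quo hW ic WI WX.
have [C0|nC] := pselect (zero_module C); first by move=> x; apply: (ses_ker ic).
have [S [q [sS qs]]] := simple_quo_ex WC nC.
have [Q [t [WQ hQ [_ ts _]]]] := proj_cover_simple sS.
have [WS nzS _] := sS.
have [g gP] := hQ _ _ (q \o c) t WX WS (surj_comp (ses_surj ic) qs).
have [J [a [b [as_ b_inj ba]]]] := im_ex (copair_lin (i \o p) g).
have fJ := fingen_inj b_inj fX.
have [|e eP] := lift_inj (f := i) b_inj.
  by move=> y; have [x <-] := ps y; exists (a (x, 0)); rewrite ba copair_linE /= linear0 addr0.
have e_inj : injective e by move=> x y exy; apply: i_inj; rewrite -!eP exy.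
have es : surj e.
  apply: dim_inj_surj => //; rewrite dI; apply: max_n; apply/asboolP.
  by exists (P * Q)%type, J, a, b; split=> //; [apply: wide_prod|apply: proj_in_prod].
case: nzS => s; have [y <-] := ts s; rewrite -gP /=.
have [z zP] := es (a (0, y)).
have -> : g y = i z by rewrite -eP zP ba copair_linE /= !linear0 add0r.
by rewrite (ses0 _ ic) linear0.
Qed.

End Projectives.

(** * Comparison of J_W(M) for different M *)

Section Exchange.
Variables (K : fieldType) (L : falgType K).
Implicit Types A B C E I M N P Q V X Y Z : lmodType L.
Implicit Types (U W : subcategory L).
Variables (rho : lmodType L -> nat) (bound dmax : nat).
Hypothesis D : directing rho bound dmax.

(** A quotient [Y] of [V] is divided by the trace of [M]. Indecomposable quotients of the trace have
    [rho] at least [rho M], which excludes extensions with [M1]; the remaining quotient lies in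
    [perp W M], where the hypothesis on [M1] applies. *)
Lemma perp_above_exchange U W M M1 : wide W -> (forall V, U V -> W V) ->
  perp_above U W M -> perp_above U (perp W M) M1 -> (rho M1 < rho M)%N ->
  perp_above U W M1.
Proof.
move=> hW UW CM [[WM1 _ _] iM1 H] lt; have [WM iM HM] := CM.
split=> // V UV; have [h0 qV] := H _ UV; split=> // Y q WY qs.
have [Q [I [C [h [i [c [[sQ hs ic WC MC] [WQ WI qQ _]]]]]]]] := trace_ex D hW WM iM WY.
apply: (ext0_ext ic).
  apply: (ext0_indec_bound D) => // [|A r iA rs]; first exact: wide_fingen hW _ WI.
  apply: leq_trans (ltnW lt) _.
  by apply: (sums_rho D (q := r \o h)) sQ iA _ => //; apply: surj_comp.
have cqs := surj_comp qs (ses_surj ic).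
apply: (qV _ (c \o q)) => //; split=> //.
exact: qext_quo cqs (HM _ UV).2.
Qed.

(* Take an indecomposable quotient [Y] of [N], of minimal dimension with
   Ext^1(M, Y) <> 0, and then [X] with [rho X] maximal among the targets of [Y]
   obtained by successive extensions with quotients of [M]. *)
Lemma torsion_target W M N : wide W -> W M -> fgindec M -> W N -> fgindec N ->
  (rho N < rho M)%N -> exists X (g : {linear N -> X}),
  [/\ W X, fgindec X, qext W M X, (rho X < rho M)%N & nonzero_map g].
Proof.
move=> hW WM iM WN iN ltNM.
have [qN|] := pselect (qext W M N).
  by exists N, idfun; split=> //; have [x] := fgindec_nz iN; exists x.
move=> /existsNP[Y0 /existsNP[q0 /not_implyP[WY0 /not_implyP[q0s nY0]]]].
pose T n := `[< exists Y (q : {linear N -> Y}),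
  [/\ W Y, fgindec Y, surj q, ~ ext0 M Y & dim Y = n] >].
have quo_indec Z (r : {linear N -> Z}) : W Z -> surj r -> ~ ext0 M Z ->
    exists n, T n /\ (n <= dim Z)%N.
  move=> WZ rs nZ; have fZ := wide_fingen hW WZ.
  have [A [s [t [iA sK nA]]]] := indec_ext fZ nZ.
  exists (dim A); split; last exact: dim_inj (can_inj sK) fZ.
  apply/asboolP; exists A, (t \o r); split=> //; first exact: wide_retract sK WZ.
  by apply: surj_comp => // a; exists (s a).
have Tex : exists n, T n by have [n []] := quo_indec _ _ WY0 q0s nY0; exists n.
case: (ex_minnP Tex) => n /asboolP[Y [q [WY iY qs nY dY]]] min_n.
(* By minimality of its dimension, [Y] has no proper quotient in [W] with an extension by [M]. *)
have proper Y' (r : {linear Y -> Y'}) : W Y' -> surj r -> ~ injective r -> ext0 M Y'.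
  move=> WY' rs nr; apply: contrapT => nY'; apply: nr.
  have [m [/min_n nm mY']] := quo_indec _ _ WY' (surj_comp qs rs) nY'.
  by apply: dim_surj_inj iY.1 _ => //; rewrite dY; apply: leq_trans nm mY'.
pose Good X (g : {linear Y -> X}) := [/\ W X, fgindec X, (rho X < rho M)%N, nonzero_map g &
  forall Z (r : {linear X -> Z}), W Z -> surj r -> (forall y, r (g y) = 0) -> ext0 M Z].
pose T' k := `[< exists X (g : {linear Y -> X}), Good X g /\ rho X = k >].
have Tex' : exists k, T' k.
  exists (rho Y); apply/asboolP; exists Y, idfun; split=> //; split=> //.
  - exact: (ext0_rho D iM iY nY).
  - by have [y] := fgindec_nz iY; exists y.
  - move=> Z r WZ rs r0; apply: (qext_zero (W := W) (M := M) (Z := Z) _ (q := idfun)) => //.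
      by move=> z; have [y <-] := rs z; apply: r0.
    by move=> z; exists z.
have Tb k : T' k -> (k <= rho M)%N.
  by move=> /asboolP[X [g [[_ _ /ltnW lt _ _] <-]]].
case: (ex_maxnP Tex' Tb) => k /asboolP[X [g [[WX iX ltX nzg cokg] rX]]] max_k.
(* Otherwise a summand [A] of a nonsplit extension of [M] by [X], met by the image of [Y], would
   again be [Good] with [rho X < rho A < rho M], against the choice of [X]. *)
have MX : ext0 M X.
  apply: contrapT => /ext0_nsplit[E [i [p [ip nsp]]]].
  have WE := wide_ses hW ip WX WM.
  have nzig : nonzero_map (i \o g).
    have [y gy] := nzg; exists y => /= e; apply: gy.
    by apply: (ses_inj ip); rewrite e linear0.
  have [A [s [r [iA sK nzA]]]] := indec_target (wide_fingen hW WE) nzig.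
  have nzri : nonzero_map (r \o i).
    by have [y ny] := nzA; exists (g y).
  have /andP[lt1 lt2] := ses_mid D iX iM ip nsp iA sK nzri.
  have WA := wide_retract hW sK WE.
  have := max_k (rho A); rewrite -rX leqNgt lt1 => H; suff: false by [].
  apply: H; apply/asboolP; exists A, (r \o i \o g); split=> //; split=> //.
  move=> Z t WZ ts t0.
  have [I [a [b [as_ b_inj ba]]]] := im_ex (t \o (r \o i)).
  have WI := wide_im hW WX WZ as_ b_inj ba.
  have [C [c bc]] := ses_of_inj b_inj.
  have WC : W C := wide_ses_quo hW bc WI WZ.
  apply: (ext0_ext bc).
    by apply: (cokg _ a) => // y; apply: b_inj; rewrite ba linear0 /= t0.
  have [|d dP] := ses_desc (f := c \o t \o r) ip.
    by move=> x; rewrite /= -[t _]/((t \o (r \o i)) x) -ba (ses0 _ bc).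
  apply: (qext_rigid D hW iM (q := d)) => // z.
  have [u <-] := ses_surj bc z; have [v <-] := ts u.
  by exists (p (s v)); rewrite dP /= sK.
exists X, (g \o q); split=> //; last by apply: nonzero_comp_bij.
(* A quotient [Z] of [X] is an extension of a quotient that kills [Y] by the image of [Y]. If that
   image is a proper quotient of [Y], minimality of [Y] applies; if it is [Y] itself, the class
   comes from [X] and [ext0_mid] applies. *)
move=> Z r WZ rs.
have [I [a [b [as_ b_inj ba]]]] := im_ex (r \o g).
have WI := wide_im hW WY WZ as_ b_inj ba.
have [C [c bc]] := ses_of_inj b_inj.
have WC : W C := wide_ses_quo hW bc WI WZ.
have MC : ext0 M C.
  apply: (cokg _ (c \o r)) => // [|y]; first exact: surj_comp (ses_surj bc).
  by rewrite /= -[r _]/((r \o g) y) -ba (ses0 _ bc).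
have [a_inj|na] := pselect (injective a); last first.
  exact: (ext0_ext bc (proper _ a WI as_ na)).
have [a' [aK Ka]] := lin_inv a_inj as_.
apply: (ext0_mid (y := g \o a') (g := r) _ bc MX MC) => z.
by rewrite /= -[r _]/((r \o g) _) -ba Ka.
Qed.

Definition torsion W M : lmodType L -> Prop := fun X => W X /\ qext W M X.

Lemma torsion_left_approx W M N : wide W -> fingen N -> exists X (f : {linear N -> X}),
  [/\ left_approx (torsion W M) f,
      forall X' (f' : {linear N -> X'}) (j : {linear X' -> X}), torsion W M X' ->
        injective j -> (forall x, j (f' x) = f x) -> surj j &
      forall h : {linear X -> X}, (forall x, h (f x) = f x) -> bijective h].
Proof.
move=> hW fN; apply: (min_left_approx_ex D) => // [X|Z|X Y|X A s r sK|X I p i ps i_inj].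
- by case=> WX _; apply: wide_fingen hW _ WX.
- by move=> Z0; split; [apply: (wide_zero hW Z0)|apply: qext_zero].
- by move=> [WX qX] [WY qY]; split; [apply: (wide_prod hW WX WY)|apply: qext_prod].
- by move=> [WX qX]; split; [apply: wide_retract sK WX|apply: qext_retract sK qX].
- move=> [WX qX]; split; last exact: qext_quo ps qX.
  exact: (wide_im hW WX WX ps i_inj (f := i \o p)).
Qed.

(* [T] is a summand of the minimal left approximation of [N] by the torsion
   class of all [X] with Hom(X, tau_W M) = 0. *)
Lemma perp_above_smaller U W M N : wide W -> (forall V, U V -> W V) ->
  perp_above U W N -> perp_above U W M -> (rho N < rho M)%N ->
  exists T, perp_above U (perp W M) T /\ (rho T < rho M)%N.
Proof.
move=> hW UW [WN iN HN] CM ltNM; have [WM iM HM] := CM.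
have UJ V : U V -> perp W M V by apply: perp_above_sub.
have [X [g [WX iX qX ltX nzg]]] := torsion_target hW WM iM WN iN ltNM.
have [T [f [[[WT qT] fP] minf bijf]]] := torsion_left_approx M hW iN.1.
have [h hP] := fP X g (conj WX qX).
have nzh : nonzero_map h by have [x gx] := nzg; exists (f x); rewrite hP.
(* The nonzero map to [X] selects a summand [A] of [T] whose [rho] is at most [rho X], hence below
   [rho M]. *)
have [A [s [r [iA sK nzA]]]] := indec_source (wide_fingen hW WT) nzh.
have ltA : (rho A < rho M)%N := leq_ltn_trans (rho_le D iA iX nzA) ltX.
have WA := wide_retract hW sK WT.
have JA : perp W M A.
  by split=> //; [apply: (rho_hom0 D)|apply: qext_retract sK qT].
exists A; split=> //; split=> // V UV; have [NV qNV] := HN _ UV.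
have [WV MV qV] := UJ _ UV; split.
  suff TV : hom_zero T V by move=> m a; have := TV (m \o r) (s a); rewrite /= sK.
  (* [N] has no nonzero map to [V], so [f] factors through the kernel of [m]. This kernel is in the
     torsion class, so by minimality it is all of [T]. *)
  move=> m t; have [B [i im]] := ker_ex m; have [i_inj iP] := im.
  have [|f' f'P] := lift_inj (f := f) i_inj.
    by move=> x; apply/iP; apply: (NV (m \o f)).
  have TB : torsion W M B.
    split; last exact: qext_ker_map hW im WT WV MV qT.
    exact: wide_ker hW _ _ _ _ _ WT WV im.
  by apply/iP; apply: (minf B f' i).
(* As Ext^1(N, Y) = 0, [f] lifts to the extension [E], which is in the torsion class, and the lift
   factors through [f]. The resulting endomorphism of [T] fixes [f], so it is bijective and splits
   [p]. *)
move=> Y q [WY _ _] qs; apply: (ext0_retrl sK); apply: ext0_of_split => E i p ip.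
have WE := wide_ses hW ip WY WT.
have qE : qext W M E := qext_ses hW ip WY (qext_quo qs qV) qT.
have [e eP] := ext0_lift f (qNV _ q WY qs) ip.
have [k kP] := fP E e (conj WE qE).
have [|b [_ bK]] := bij_inv (bijf (p \o k) _); first by move=> x; rewrite /= kP eP.
by exists (k \o b) => x; apply: bK.
Qed.

(* Otherwise [M'] is generated by [M] and is also a summand of the minimal left
   approximation of a projective [P]; but the component [P -> M'] factors through
   a power of [M], which contradicts minimality. *)
Lemma perp_generated W M M' : wide W -> W M -> fgindec M -> fgindec M' ->
  (rho M < rho M')%N -> perp W M' M -> W M' ->
  ~ forall V, perp W M V -> perp W M' V.
Proof.
move=> hW WM iM iM' lt [_ M'M qM'M] WM' HU.
have hM'Q Q : sums M Q -> hom_zero M' Q by apply: sums_hom0.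
have qM' : qext W M M'.
  apply: (qext_bound D) => // A q iA qs; apply: leq_trans (ltnW lt) _.
  exact: (rho_le D iM' iA (surj_nz iA qs)).
have [Q [I [C [h [i [c [[sQ hs ic WC MC] [WQ WI qQ QP]]]]]]]] := trace_ex D hW WM iM WM'.
have qC : qext W M C := qext_quo (ses_surj ic) qM'.
(* The cokernel of the trace of [M] in [M'] lies in [perp W M], hence in [perp W M']; so the
   projection from [M'] to it is 0 and [M] generates [M']. *)
have [_ M'C _] := HU C (And3 WC MC qC).
have is_ : surj i by move=> x; apply: (ses_ker ic); apply: M'C.
pose g : {linear Q -> M'} := i \o h.
have gs : surj g by apply: surj_comp.
have [P [pi [WP hP pis]]] := enough_proj D hW WM'.
have [T [f [[[WT qT] fP] _ bijf]]] := torsion_left_approx M hW (wide_fingen hW WP).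
have [p0 p0P] := fP _ pi (conj WM' qM').
pose phi := copair_lin p0 g.
have phis : surj phi.
  by move=> x; have [y <-] := gs x; exists (0, y); rewrite copair_linE /= linear0 add0r.
have [N [k kphi]] := ses_of_surj phis.
have WTQ := wide_prod hW WT WQ.
have WN : W N := wide_ses_sub hW kphi WTQ WM'.
have qN : qext W M N.
  apply: (qext_ker hW kphi WM' WTQ) (qext_prod hW WT qT qQ) => m.
  have [m' m'P] := QP m; exists (inr_lin T Q \o m') => x.
  by rewrite copair_linE /= linear0 add0r m'P.
have [Q2 [I2 [C2 [h2 [i2 [c2 [[sQ2 hs2 ic2 WC2 MC2] [WQ2 WI2 _ _]]]]]]]] :=
  trace_ex D hW WM iM WN.
(* The kernel of [phi] is again divided by its trace of [M]: Ext^1(M', -) vanishes on the trace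
   since [M] is in [perp W M'], and on the quotient since it lies in [perp W M]. So [phi] splits,
   and as Hom(M', Q) = 0 already [p0] does. *)
have M'N : ext0 M' N.
  apply: (ext0_ext ic2).
    exact: (qext_sums hW WM qM'M sQ2 (q := h2)).
  have [_ _ q2] := HU C2 (And3 WC2 MC2 (qext_quo (ses_surj ic2) qN)).
  exact: qext_ext0 WC2 q2.
have [sg sgP] := ext0_split M'N kphi.
pose s : {linear M' -> T} := fst \o sg.
have sK : cancel s p0.
  move=> x; have := sgP x; rewrite copair_linE /=.
  by have /= -> := hM'Q _ sQ (snd \o sg) x; rewrite !linear0 addr0.
have [h0 h0P] := hP _ _ g pi WQ WM' gs.
have [kk kkP] := fP _ h0 (conj WQ qQ).
(* Replacing [s \o p0] by [s \o g \o kk] does not change the composite with [f], so this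
   endomorphism is bijective. It kills [s] because Hom(M', Q) = 0. *)
have [|e [eK _]] := bij_inv (bijf ((idfun \- (s \o p0)) \+ (s \o g \o kk)) _).
  by move=> x; rewrite /= p0P kkP -[i (h _)]/(g _) h0P subrK.
case: iM' => _ [nzM' _]; apply: nzM' => x.
suff s0 : s x = 0 by rewrite -[x]sK s0 linear0.
rewrite -[s x]eK /= -/(s x) sK subrr add0r.
by have /= -> := hM'Q _ sQ (kk \o s) x; rewrite !linear0.
Qed.

(** If [rho M < rho M'], [perp_above_smaller] and then the exchange give a [T] of smaller [rho] than
    [M'] to which the induction applies. So [T] is isomorphic to [M] and [M] lies in [perp W M'],
    which [perp_generated] excludes. If [rho M' < rho M], the same lemma gives a module above
    [perp W M] inside itself. *)
Lemma perp_inj W M M' : wide W -> W M -> fgindec M -> W M' -> fgindec M' ->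
  (forall V, perp W M V -> perp W M' V) -> iso M M'.
Proof.
move=> hW WM iM; have [n] := ubnP (rho M').
elim: n M' => // n IHn M' ltn WM' iM' HU.
have UW V : perp W M V -> W V by case.
have CM := perp_above_perp WM iM.
have CM' : perp_above (perp W M) W M'.
  by split=> // V /HU[].
have [lt|lt|e] := ltngtP (rho M) (rho M'); last exact: (rho_iso D iM iM' e).
  have [T [CT ltT]] := perp_above_smaller hW UW CM CM' lt.
  have CT' := perp_above_exchange hW UW CM' CT ltT.
  have [WT iT _] := CT'.
  have MT : iso M T.
    apply: IHn => // [|V UV]; first exact: leq_trans ltT _.
    exact: perp_above_sub UW CT' UV.
  have JM : perp W M' M.
    by have [JT _ _] := CT; apply: (wide_iso (perp_wide M' hW) JT); apply: iso_sym.
  by case: (perp_generated hW WM iM iM' lt JM WM' HU).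
have [T [CT _]] := perp_above_smaller hW UW CM' CM lt.
by case: (perp_above_self CT).
Qed.

End Exchange.

(** * Existence of labels *)

Section Existence.
Variables (K : fieldType) (L : falgType K).
Implicit Types A B C E I M N P Q S T V X Y Z : lmodType L.
Variables (rho : lmodType L -> nat) (bound dmax : nat).
Hypothesis D : directing rho bound dmax.
Variables (U W : subcategory L).
Hypotheses (hU : wide U) (hW : wide W) (UW : forall V, U V -> W V).

Definition gen_by Y := W Y /\ exists V (q : {linear V -> Y}), U V /\ surj q.

(* The torsion class generated by [U] in [W]. *)
Inductive filt : lmodType L -> Prop :=
| filt_zero Z : zero_module Z -> filt Z
| filt_step Y X Z (i : {linear Y -> X}) (p : {linear X -> Z}) :
    ses i p -> gen_by Y -> W X -> filt Z -> filt X.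

Lemma filt_wide X : filt X -> W X.
Proof. by case=> // Z; apply: (wide_zero hW). Qed.

Lemma filt_quo X : filt X -> forall Z (q : {linear X -> Z}), W Z -> surj q -> filt Z.
Proof.
elim=> [Z0 Z00|Y X0 Z0 i p ip [WY [V [r [UV rs]]]] WX _ IH] Z q WZ qs.
  by apply: filt_zero => z; have [x <-] := qs z; rewrite [x]Z00 linear0.
have [I [a [b [as_ b_inj ba]]]] := im_ex (q \o i).
have WI := wide_im hW WY WZ as_ b_inj ba.
have [C [c bc]] := ses_of_inj b_inj.
have WC : W C := wide_ses_quo hW bc WI WZ.
have [|d dP] := ses_desc (f := c \o q) ip.
  by move=> y; rewrite /= -[q _]/((q \o i) y) -ba (ses0 _ bc).
apply: (filt_step bc) => //.
  by split=> //; exists V, (a \o r); split=> //; apply: surj_comp.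
apply: (IH _ d WC) => z; have [t <-] := ses_surj bc z; have [x <-] := qs t.
by exists (p x); rewrite dP.
Qed.

Lemma filt_prod X X' : filt X -> filt X' -> filt (X * X')%type.
Proof.
move=> fX fX'; elim: fX => [Z Z0|Y X0 Z i p ip gY WX _ IH].
  apply: (filt_quo fX' (q := inr_lin Z X')) => [|[z x]].
    by apply: (wide_prod hW (wide_zero hW Z0) (filt_wide fX')).
  by exists x; congr (_, _); rewrite [RHS]Z0.
apply: (filt_step (i := inl_lin X0 X' \o i) (p := pair_lin (p \o fst) snd)) IH => //.
  split; first split=> [y y' [/(ses_inj ip)] //|[x x'] /=].
    split=> [[px ->]|[y [<- <-]]]; last by rewrite (ses0 _ ip).
    by have [y <-] := ses_ker ip px; exists y.
  by move=> [z x']; have [x <-] := ses_surj ip z; exists (x, x').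
exact: (wide_prod hW WX (filt_wide fX')).
Qed.

Lemma filt_of_sub V : U V -> filt V.
Proof.
move=> UV; have WV := UW UV; have [Z Z0] := zero_module_ex L.
apply: (filt_step (i := (idfun : {linear V -> V})) (p := (\0 : {linear V -> Z}))) (filt_zero Z0) => //.
  split; first by split=> // y; split=> // _; exists y.
  by move=> z; exists 0; rewrite [RHS]Z0.
by split=> //; exists V, idfun; split=> // x; exists x.
Qed.

(** Let [Y] be the first layer of [X], covered by [V'] in [U]. The image of [V'] in [V] and its
    cokernel are in [U], so the induction applies to the map induced on [X / Y]. The rest of the
    kernel is generated by the kernel of the map from [V'] to [V]. *)
Lemma filt_ker X : filt X -> forall V N (a : {linear X -> V}) (k : {linear N -> X}),
  U V -> is_kernel a k -> filt N.
Proof.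
elim=> [Z0 Z00|Y X0 Z i p ip [WY [V' [q [UV' qs]]]] WX fZ IH] V N a k UV ak.
  by apply: filt_zero => n; apply: ak.1; rewrite [LHS]Z00 [RHS]Z00.
have [k_inj kP] := ak.
have [I [b [j [bs j_inj jb]]]] := im_ex (a \o i \o q).
have UI := wide_im hU UV' UV bs j_inj jb.
have [C [c jc]] := ses_of_inj j_inj.
have UC : U C := wide_ses_quo hU jc UI UV.
have WN : W N := wide_ker hW WX (UW UV) ak.
have [|a' a'P] := ses_desc (f := c \o a) ip.
  by move=> y; have [v <-] := qs y; rewrite /= -[a _]/((a \o i \o q) v) -jb (ses0 _ jc).
have [N' [k' ak']] := ker_ex a'; have [k'_inj k'P] := ak'.
have fN' := IH _ _ _ _ UC ak'.
have [|n nP] := lift_inj (f := p \o k) k'_inj.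
  move=> x; apply/k'P; rewrite /= a'P /= (_ : a (k x) = 0) ?linear0 //.
  by apply/kP; exists x.
have ns : surj n.
  move=> z; have [x px] := ses_surj ip (k' z).
  have ca : c (a x) = 0 by rewrite -[c (a x)]/((c \o a) x) -a'P px; apply/k'P; exists z.
  have [t jt] := ses_ker jc ca; have [v bv] := bs t.
  have /kP[m km] : a (x - i (q v)) = 0.
    by rewrite linearB -[a (i _)]/((a \o i \o q) v) -jb bv jt subrr.
  exists m; apply: k'_inj; rewrite nP /= km linearB (ses0 _ ip) subr0 px //.
have [Y1 [i1 in1]] := ses_of_surj ns.
have WY1 : W Y1 := wide_ses_sub hW in1 WN (filt_wide fN').
apply: (filt_step in1) => //; split=> //.
have [V1 [k1 vk]] := ker_ex (a \o i \o q).
have UV1 : U V1 := wide_ker hU UV' UV vk; have [k1_inj k1P] := vk.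
have [|l lP] := lift_inj (f := i \o q \o k1) k_inj.
  by move=> v; apply/kP/k1P; exists v.
have [|l' l'P] := ses_lift (f := l) in1.
  by move=> v; apply: k'_inj; rewrite nP /= lP /= (ses0 _ ip) linear0.
exists V1, l'; split=> // y.
have [|z iz] := ses_ker (e := k (i1 y)) ip.
  by rewrite -[p _]/((p \o k) (i1 y)) -nP (ses0 _ in1) linear0.
have [v qv] := qs z.
have /k1P[v1 e1] : (a \o i \o q) v = 0.
  by rewrite /= qv iz; apply/kP; exists (i1 y).
exists v1; apply: (ses_inj in1); apply: k_inj.
by rewrite l'P lP /= e1 qv iz.
Qed.

Lemma filt_left_approx N : fingen N -> exists T (f : {linear N -> T}),
  [/\ left_approx filt f,
      forall X' (f' : {linear N -> X'}) (j : {linear X' -> T}), filt X' ->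
        injective j -> (forall x, j (f' x) = f x) -> surj j &
      forall h : {linear T -> T}, (forall x, h (f x) = f x) -> bijective h].
Proof.
move=> fN; apply: (min_left_approx_ex D) => // [X|Z|X Y|X A s r sK|X I p i ps i_inj].
- by move=> /filt_wide; apply: wide_fingen hW _.
- exact: filt_zero.
- exact: filt_prod.
- move=> fX; apply: (filt_quo fX (q := r)); first exact: (wide_retract hW sK (filt_wide fX)).
  by move=> a; exists (s a).
- move=> fX; apply: (filt_quo fX (q := p)) => //; have WX := filt_wide fX.
  exact: (wide_im hW WX WX ps i_inj (f := i \o p)).
Qed.

(** The kernel of a map from [T] to [V] that kills [f] is in [filt], so it is [T] by minimality. An
    extension of [C] by a quotient of [V] is pulled back to [T]; the pullback is in [filt], so the
    lift of [f] that is 0 in [E] factors through [f], and after correction by an automorphism of [T]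
    it descends to a splitting. *)
Lemma filt_coker P T C (f : {linear P -> T}) (c : {linear T -> C}) :
  is_cokernel f c -> proj_in W P -> left_approx filt f ->
  (forall X' (f' : {linear P -> X'}) (j : {linear X' -> T}), filt X' ->
        injective j -> (forall x, j (f' x) = f x) -> surj j) ->
  (forall h : {linear T -> T}, (forall x, h (f x) = f x) -> bijective h) ->
  W C -> forall V, U V -> hom_zero C V /\ qext W C V.
Proof.
move=> [cs cP] hP [fT fP] minf bijf WC V UV; split.
  move=> m; apply: (surjK (g := fun=> 0) cs) => t.
  have [N [k mk]] := ker_ex (m \o c); have [k_inj kP] := mk.
  have [|f' f'P] := lift_inj (f := f) k_inj.
    move=> x; apply/kP; rewrite /= (_ : c (f x) = 0) ?linear0 //.
    by apply/cP; exists x.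
  by apply/kP; apply: (minf N f' k) => //; apply: filt_ker mk.
move=> Y q WY qs; apply: ext0_of_split => E i p ip.
have [E' [i' [p' [v [ip' e1 e2 univ]]]]] := pullback_ses c ip.
have [|l lP] := univ P \0 f.
  by move=> x; rewrite linear0; apply/esym/cP; exists x.
have fE' : filt E'.
  apply: (filt_step ip') => //; first by split=> //; exists V, q.
  exact: (wide_ses hW ip' WY (filt_wide fT)).
have [g gP] := fP E' l fE'.
have pgf x : p' (g (f x)) = f x by rewrite gP; have [] := lP x.
have [b [bK Kb]] := bij_inv (bijf (p' \o g) pgf).
have bf x : b (f x) = f x by rewrite -[in LHS](pgf x) -[p' _]/((p' \o g) _) bK.
have [|s sP] := lift_surj (f := v \o g \o b) cs.
  by move=> _ /cP[x <-]; rewrite /= bf gP; have [] := lP x.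
exists s; apply: (surjK cs) => t.
by rewrite sP /= e1 -[p' _]/((p' \o g) _) Kb.
Qed.

(** The first layer [Y] of [X] is the image of a map inside [U], so it is in [U], and [X / Y] embeds
    into the cokernel of [Y] in [V]. *)
Lemma filt_sub_closed X : filt X -> forall V (j : {linear X -> V}),
  injective j -> U V -> U X.
Proof.
elim=> [Z Z0|Y X0 Z i p ip [WY [V' [q [UV' qs]]]] WX _ IH] V j j_inj UV.
  by move=> *; apply: (wide_zero hU Z0).
have UY : U Y.
  by apply: (wide_im hU UV' UV qs (i := j \o i) (f := j \o i \o q)) => //; apply: inj_comp (ses_inj ip).
have [C [c jc]] := ses_of_inj (inj_comp j_inj (ses_inj ip) : injective (j \o i)).
have UC : U C := wide_ses_quo hU jc UY UV.
have [|d dP] := ses_desc (f := c \o j) ip; first by move=> y; apply: (ses0 y jc).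
apply: (wide_ses hU ip UY); apply: (IH C d) => //.
apply: lin_inj => z; have [x <-] := ses_surj ip z.
rewrite dP => /(ses_ker jc)[y /j_inj <-]; exact: ses0 ip.
Qed.

(* If some projective [P] of [W] has a left approximation by [filt] that is not
   onto, a summand of its cokernel works.  Otherwise [U] is closed under
   subobjects in [W], and the projective cover of a simple outside [U] works. *)
Lemma perp_above_ex : (exists X, W X /\ ~ U X) -> exists M, perp_above U W M.
Proof.
move=> [X0 [WX0 nUX0]].
have [[P [T [f [[WP hP nfs] lf minf bijf]]]]|allP] := pselect (exists P T (f : {linear P -> T}),
  [/\ [/\ W P, proj_in W P & ~ surj f], left_approx filt f,
      forall X' (f' : {linear P -> X'}) (j : {linear X' -> T}), filt X' ->
        injective j -> (forall x, j (f' x) = f x) -> surj j &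
      forall h : {linear T -> T}, (forall x, h (f x) = f x) -> bijective h]).
  have [C [c cc]] := coker_ex f.
  have WC : W C := wide_coker hW WP (filt_wide lf.1) cc.
  have HC := filt_coker cc hP lf minf bijf WC.
  have nzC : nonzero_map (idfun : {linear C -> C}).
    apply: nonzero_mapP => C0; apply: nfs => t; apply/(iffLR (cc.2 t)).
    exact: C0.
  have [A [s [r [iA sK _]]]] := indec_source (wide_fingen hW WC) nzC.
  exists A; split=> //; first exact: wide_retract hW _ _ _ _ sK WC.
  move=> V UV; have [CV qCV] := HC V UV; split.
    by move=> m a; have := CV (m \o r) (s a); rewrite /= sK.
  by move=> Y q WY qs; apply: (ext0_retrl sK); apply: (qCV _ q).
(* The approximation [f] of a projective over [X] is onto, and the map to [V] factors through it;
   hence so does the map onto [X], and [X] is a quotient of an object of [filt]. *)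
have sub_closed V X (j : {linear X -> V}) : U V -> W X -> injective j -> U X.
  move=> UV WX j_inj; apply: (filt_sub_closed _ j_inj UV).
  have [P [h [WP hP hs]]] := enough_proj D hW WX.
  have [T [f [lf minf bijf]]] := filt_left_approx (wide_fingen hW WP).
  have fs : surj f.
    by apply: contrapT => nfs; apply: allP; exists P, T, f.
  have [g gP] := lf.2 _ (j \o h) (filt_of_sub UV).
  have [|h' h'P] := lift_surj (f := h) fs.
    by move=> x fx; apply: j_inj; rewrite -[j _]/((j \o h) x) -gP fx !linear0.
  apply: (filt_quo lf.1 (q := h')) => // x; have [y <-] := hs x.
  by exists (f y).
(* An object of [W] outside [U] of least dimension is simple in [W]: a proper subobject and its
   quotient would both be in [U]. *)
pose q n := `[< exists S, [/\ W S, ~ U S & dim S = n] >].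
have qex : exists n, q n by exists (dim X0); apply/asboolP; exists X0.
case: (ex_minnP qex) => n /asboolP[S [WS nUS dS]] min_n.
have smaller Y : W Y -> (dim Y < dim S)%N -> U Y.
  move=> WY lt; apply: contrapT => nUY; have := min_n (dim Y).
  rewrite -dS leqNgt lt => H; suff: false by [].
  by apply: H; apply/asboolP; exists Y.
have sS : simple_in W S.
  split=> // [S0|Y i WY i_inj]; first by apply: nUS; apply: (wide_zero hU S0).
  have [Y0|nY] := pselect (zero_module Y); [by left|right].
  have [C [c ic]] := ses_of_inj i_inj.
  have WC : W C := wide_ses_quo hW ic WY WS.
  have dE := dim_ses ic (wide_fingen hW WS).
  have UC : U C by apply: smaller => //; rewrite dE -[X in (X < _)%N]add0n ltn_add2r dim_gt0 //; apply: wide_fingen hW _ WY.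
  have [C0|nC] := pselect (zero_module C); first by move=> x; apply: (ses_ker ic).
  have UY : U Y by apply: smaller => //; rewrite dE -[X in (X < _)%N]addn0 ltn_add2l dim_gt0 //; apply: wide_fingen hW _ WC.
  by case: nUS; apply: (wide_ses hU ic).
have [P [t [WP hP tt]]] := proj_cover_simple D hW sS.
have [_ ts tP] := tt.
exists P; split=> //; first exact: topped_indec hW _ _ _ sS tt.
move=> V UV; split.
  move=> m x; have [I [a [b [as_ b_inj ba]]]] := im_ex m.
  have WI := wide_im hW WP (UW UV) as_ b_inj ba.
  have UI := sub_closed _ _ b UV WI b_inj.
  have [N [k mk]] := ker_ex m; have [k_inj kP] := mk.
  have WN : W N := wide_ker hW WP (UW UV) mk.
  (* If the kernel of [m] maps onto [S], it is all of [P]. Otherwise [S] is a quotient of the image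
     of [m], with kernel again in [U], so [S] would be in [U]. *)
  have [tk0|tks] := simple_map hW (t \o k) sS WN; last first.
    by apply/kP; apply: (tP _ k WN k_inj tks).
  have [|d dP] := lift_surj (f := t) as_.
    move=> y ay; have /kP[z <-] : m y = 0 by rewrite -ba ay linear0.
    exact: tk0.
  have ds : surj d by move=> s; have [y <-] := ts s; exists (a y).
  have [N' [k' kd]] := ses_of_surj ds.
  have WN' : W N' := wide_ses_sub hW kd WI WS.
  have UN' := sub_closed _ _ k' UI WN' (ses_inj kd).
  by case: nUS; apply: (wide_ses_quo hU kd).
move=> Y r WY rs; apply: ext0_of_split => E i p ip.
have [s sP] := hP _ _ p idfun (wide_ses hW ip WY WP) WP (ses_surj ip).
by exists s.
Qed.

End Existence.

(** * The EL-labeling *)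

Section Chains.
Variables (P Q : Type) (leP : relation P) (leQ : relation Q).
Hypothesis leP_order : Relation_Definitions.order P leP.
Variable lam : labeling Q leP.

Lemma labeled_chain_rcons x y z s l (h : covers leP y z) :
  labeled_chain lam x y s l ->
  labeled_chain lam x z (rcons s z) (rcons l (lam h)).
Proof.
move=> c; elim: c h => [a|a b c s' l' h' _ IH] h; last by apply: chain_cons; apply: IH.
exact: chain_cons (chain_nil lam z).
Qed.

(** Chains are built from the bottom, while the induction on intervals removes the top cover. *)
Lemma labeled_chain_inv x z s l : labeled_chain lam x z s l ->
  [/\ x = z, s = [:: x] & l = [::]] \/
  exists y (h : covers leP y z) s' l',
    [/\ labeled_chain lam x y s' l', s = rcons s' z & l = rcons l' (lam h)].
Proof.
elim=> [a|a b c s' l' h' cs IH]; [by left|right].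
case: IH => [[e -> ->]|[y [h [s1 [l1 [c1 -> ->]]]]]].
  by subst c; exists a, h', [:: a], [::]; split=> //; apply: chain_nil.
by exists y, h, (a :: s1), (lam h' :: l1); split=> //; apply: chain_cons.
Qed.

Lemma labeled_chain_le x z s l : labeled_chain lam x z s l -> leP x z.
Proof.
have [refl trans _] := leP_order.
by elim=> [a|a b c s' l' [[ab _] _] _ bc]; [apply: refl|apply: trans ab bc].
Qed.

Lemma labeled_chain_self x s l : labeled_chain lam x x s l -> s = [:: x] /\ l = [::].
Proof.
have [_ _ anti] := leP_order.
move=> /labeled_chain_inv[[_ -> ->] //|[y [h [s' [l' [/labeled_chain_le xy _ _]]]]]].
by have [[yx ne] _] := h; case: ne; apply: anti.
Qed.

Lemma Sorted_rcons (R : relation Q) l a b :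
  Sorted R (rcons (rcons l a) b) <-> Sorted R (rcons l a) /\ R a b.
Proof.
elim: l => [|x l IHl] /=.
  split=> [H|[_ ab]]; last by do !constructor.
  have [_ h] := Sorted_inv H; have ab := HdRel_inv h.
  by split=> //; do !constructor.
have hd : HdRel R x (rcons (rcons l a) b) <-> HdRel R x (rcons l a).
  by case: l {IHl} => [|y l] /=; split=> h; have xy := HdRel_inv h; constructor.
split=> [H|[H ab]]; have [s h] := Sorted_inv H.
  by have [s' ab] := IHl.1 s; split=> //; constructor=> //; apply/hd.
by constructor; [apply/IHl|apply/hd].
Qed.

Lemma Sorted_belast (R : relation Q) l a : Sorted R (rcons l a) -> Sorted R l.
Proof. by case/lastP: l => [|l b] // H; have [] := (Sorted_rcons R l b a).1 H. Qed.

End Chains.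

(** * Covers and labels in the lattice of wide subcategories *)

Section WideLattice.
Variables (K : fieldType) (L : falgType K).
Implicit Types M N X : lmodType L.
Implicit Types U V W : wide_subcat L.

Lemma wide_le_order : Relation_Definitions.order (wide_subcat L) (@wide_le L).
Proof.
split=> [U M //|U V W UV VW M /UV /VW //|[U hU] [V hV] /= UV VU].
have e : U = V by apply/funext => M; apply/propext; split=> [/UV|/VU].
by subst V; congr (exist _ _ _); apply: Prop_irrelevance.
Qed.

Lemma wide_zero_module : wide (fun M => zero_module M).
Proof.
have mono M N (i : {linear M -> N}) : injective i -> zero_module N -> zero_module M.
  by move=> i_inj N0 x; apply: i_inj; rewrite [LHS]N0 [RHS]N0.
have epi M N (p : {linear M -> N}) : surj p -> zero_module M -> zero_module N.
  by move=> ps M0 x; have [y <-] := ps x; rewrite [y]M0 linear0.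
split=> [M /fingen0 //|M N M0 [f /bij_surj fs]||||].
- exact: epi fs M0.
- exact: zero_module_ex.
- by move=> M N X f i M0 _ [i_inj _]; apply: mono i_inj M0.
- by move=> M N X f c _ N0 [cs _]; apply: epi cs N0.
- move=> X E Y i p X0 Y0 [_ ip] ps e.
  by have /ip[x <-] : p e = 0 by []; rewrite [x]X0 linear0.
Qed.

Lemma wide_fingen_module : wide (fun M : lmodType L => fingen M).
Proof.
split=> [//|M N fM MN||M N X f i fM _ [i_inj _]|M N X f c _ fN [cs _]|X E Y i p fX fY ip ps].
- exact: fingen_iso MN fM.
- by have [Z Z0] := zero_module_ex L; exists Z; apply: fingen0.
- exact: fingen_inj i_inj fM.
- exact: fingen_surj cs fN.
- exact: fingen_ext (conj ip ps) fX fY.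
Qed.

Lemma wide_bounded : bounded_poset (@wide_le L).
Proof.
split; first exact: wide_le_order.
- exists (exist _ _ wide_zero_module) => -[U hU] M /= M0; exact: wide_zero hU _ M0.
- exists (exist _ _ wide_fingen_module) => -[U hU] M /= UM; exact: wide_fingen hU _ UM.
Qed.

Definition wide_perp W M : wide_subcat L := exist _ _ (perp_wide M (svalP W)).

Lemma wide_perp_le W M : wide_le (wide_perp W M) W.
Proof. by move=> X []. Qed.

Lemma perp_iso (W : subcategory L) M N X : iso M N -> perp W M X -> perp W N X.
Proof.
move=> MN [WX MX qX]; split=> //.
  move=> f x; have [a [b [aK bK]]] := isoP MN.
  by rewrite -[x]bK; apply: (MX (f \o a)).
by move=> Y q WY qs; apply: (ext0_isol MN); apply: (qX _ q).
Qed.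

Variables (rho : lmodType L -> nat) (bound dmax : nat).
Hypothesis D : directing rho bound dmax.

Lemma fgindec_brick M : fgindec M -> brick M.
Proof.
move=> iM; split; [exact: iM.1|exact: iM.2.1|move=> f /nonzero_mapP nz].
exact: bij_inv (indec_endo_bij D iM nz).
Qed.

Lemma brick_fgindec M : brick M -> fgindec M.
Proof.
move=> [fM nzM bM]; split=> //; split=> // X Y MXY.
have [f [g [fK gK]]] := isoP MXY.
pose e : {linear M -> M} := g \o (inl_lin X Y \o (fst \o f)).
have [[x0 ex]|e0] := pselect (exists x, e x <> 0).
  right=> y; have [|h [hK Kh]] := bM e; first by move/(_ x0).
  have e0 : e (g (0, y)) = 0 by rewrite /e /= gK; apply: (linear0 g).
  have := hK (g (0, y)); rewrite e0 linear0.
  by move/(congr1 f); rewrite gK linear0 => -[].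
left=> x; apply: contrapT => nx; apply: e0; exists (g (x, 0)) => ex; apply: nx.
by move/(congr1 f): ex; rewrite /e /= !gK linear0 => -[].
Qed.

Definition brick_of M (iM : fgindec M) : brick_class L :=
  exist _ (iso M) (ex_intro _ M (conj (fgindec_brick iM) (fun X => iff_refl (iso M X)))).

Definition brick_rho (c : brick_class L) : nat := rho (sval (cid (svalP c))).

Lemma brick_rhoE (c : brick_class L) M : sval c M -> brick_rho c = rho M.
Proof.
rewrite /brick_rho; case: cid => B /= [_ cB] /cB BM.
exact: (iso_rho D BM).
Qed.

Definition brick_le : relation (brick_class L) := fun c d => (brick_rho c <= brick_rho d)%N.

Lemma brick_rho_inj c d : brick_rho c = brick_rho d -> c = d.
Proof.
case: c d => [c hc] [d hd]; rewrite /brick_rho /=.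
case: cid => B /= [/brick_fgindec iB cB]; case: cid => B' /= [/brick_fgindec iB' dB'].
move=> /(rho_iso D iB iB') BB'.
have e : c = d.
  apply/funext => X; apply/propext; rewrite cB dB'; split; apply: iso_trans => //.
  exact: iso_sym.
by subst d; congr (exist _ _ _); apply: Prop_irrelevance.
Qed.

Lemma brick_le_order : Relation_Definitions.order (brick_class L) brick_le.
Proof.
split=> [c|c d e|c d]; rewrite /brick_le //; first exact: leq_trans.
by move=> cd dc; apply: brick_rho_inj; apply/eqP; rewrite eqn_leq cd.
Qed.

Lemma brick_lt c d : (brick_rho c < brick_rho d)%N -> strict brick_le c d.
Proof. by move=> lt; split; [exact: ltnW|move=> e; rewrite e ltnn in lt]. Qed.

Lemma not_wide_le U W : wide_le U W -> U <> W -> exists X, sval W X /\ ~ sval U X.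
Proof.
have [_ _ anti] := wide_le_order.
move=> UW ne; apply: contrapT => H; apply: ne; apply: anti => // X WX.
by apply: contrapT => nUX; apply: H; exists X.
Qed.

Lemma perp_above_wide U W : wide_le U W -> U <> W ->
  exists M, perp_above (sval U) (sval W) M.
Proof.
move=> UW ne; apply: (perp_above_ex D (svalP U) (svalP W) UW).
exact: not_wide_le.
Qed.

(** [perp W M] lies between [U] and [W] and does not contain [M], so the cover relation forces it to
    be [U]. *)
Lemma cover_label U W : covers (@wide_le L) U W ->
  exists M, perp_above (sval U) (sval W) M /\ U = wide_perp W M.
Proof.
move=> [[UW ne] H]; have [M CM] := perp_above_wide UW ne; exists M; split=> //.
have UJ : wide_le U (wide_perp W M) by move=> V; apply: perp_above_sub CM.
apply: contrapT => neJ; apply: H; exists (wide_perp W M); split; first by split.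
split; first exact: wide_perp_le.
by have [WM iM _] := CM => e; apply: (@perp_notin _ _ (sval W) M iM); rewrite -[perp _ _]/(sval (wide_perp W M)) e.
Qed.

Lemma wide_perp_inj W M N : sval W M -> fgindec M -> sval W N -> fgindec N ->
  wide_le (wide_perp W M) (wide_perp W N) -> iso M N.
Proof. by move=> WM iM WN iN; apply: (perp_inj D (svalP W)). Qed.

Lemma wide_perp_iso W M N : iso M N -> wide_perp W M = wide_perp W N.
Proof.
have [_ _ anti] := wide_le_order.
by move=> MN; apply: anti => X; apply: perp_iso => //; apply: iso_sym.
Qed.

(** A wide subcategory strictly in between would lie in some [perp W N]; by injectivity [N] is
    isomorphic to [M]. *)
Lemma wide_perp_cover W M : sval W M -> fgindec M -> covers (@wide_le L) (wide_perp W M) W.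
Proof.
move=> WM iM; split.
  split; first exact: wide_perp_le.
  by move=> e; apply: (@perp_notin _ _ (sval W) M iM); rewrite -[perp _ _]/(sval (wide_perp W M)) e.
move=> [V [[JV neJ] [VW neV]]]; have [N CN] := perp_above_wide VW neV.
have [WN iN _] := CN.
have VJ : wide_le V (wide_perp W N) by move=> X; apply: perp_above_sub CN.
have MN : iso M N by apply: (wide_perp_inj WM iM WN iN) => X /JV /VJ.
have [_ _ anti] := wide_le_order.
by apply: neJ; apply: anti => //; rewrite (wide_perp_iso W MN).
Qed.

Definition label_of U W (h : covers (@wide_le L) U W) : lmodType L :=
  sval (cid (cover_label h)).

Lemma label_ofP U W (h : covers (@wide_le L) U W) :
  perp_above (sval U) (sval W) (label_of h) /\ U = wide_perp W (label_of h).
Proof. exact: (svalP (cid (cover_label h))). Qed.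

Lemma label_of_fgindec U W (h : covers (@wide_le L) U W) : fgindec (label_of h).
Proof. by have [[]] := label_ofP h. Qed.

Definition brick_label : labeling (brick_class L) (@wide_le L) :=
  fun U W h => brick_of (label_of_fgindec h).

Lemma brick_rho_label U W (h : covers (@wide_le L) U W) :
  brick_rho (brick_label h) = rho (label_of h).
Proof. by apply: brick_rhoE => /=; apply: iso_refl. Qed.

(** The number of isomorphism classes of indecomposables in [W], counted by their [rho]; the measure
    for the induction on intervals. *)
Definition wide_size W : nat :=
  #|[set k : 'I_bound | `[< exists M, [/\ sval W M, fgindec M & rho M = k] >]]|.

Lemma wide_size_cover U W : covers (@wide_le L) U W -> (wide_size U < wide_size W)%N.
Proof.
move=> h; have [[WM iM _] UE] := label_ofP h; set M := label_of h in WM iM UE.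
apply: proper_card; apply/properP; split.
  apply/subsetP => k; rewrite !inE => /asboolP[N [UN iN rN]].
  by apply/asboolP; exists N; split=> //; case: h {M WM iM UE} => -[UW _] _; apply: UW.
exists (Ordinal (rho_bound D iM)); rewrite !inE.
  by apply/asboolP; exists M.
apply/asboolP => -[N [UN iN /= rN]]; apply: (@perp_notin _ _ (sval W) M iM).
rewrite -[perp _ _]/(sval (wide_perp W M)) -UE.
by apply: (wide_iso (svalP U) UN); apply: (rho_iso D iN iM rN).
Qed.

(** The last clause, a bound for the top label of the increasing chain, strengthens the induction:
    uniqueness applies it to the interval below the top cover. *)
Lemma EL_interval n U W : (wide_size W < n)%N -> wide_le U W -> exists s l,
  [/\ labeled_chain brick_label U W s l, increasing_labels brick_le l,
      forall s' l', labeled_chain brick_label U W s' l' -> increasing_labels brick_le l' ->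
        s' = s /\ l' = l,
      forall s' l', labeled_chain brick_label U W s' l' -> reflected_lex_le brick_le l l' &
      forall T, perp_above (sval U) (sval W) T ->
        exists l0 a, l = rcons l0 a /\ (brick_rho a <= rho T)%N].
Proof.
have [_ trans anti] := wide_le_order.
elim: n W => // n IHn W ltW UW.
have [e|ne] := pselect (U = W).
  subst W; exists [:: U], [::]; split=> //.
  - exact: chain_nil.
  - by move=> s' l' /(labeled_chain_self wide_le_order).
  - by move=> T /perp_above_self.
pose q k := `[< exists M, perp_above (sval U) (sval W) M /\ rho M = k >].
have qex : exists k, q k.
  by have [M CM] := perp_above_wide UW ne; exists (rho M); apply/asboolP; exists M.
case: (ex_minnP qex) => k /asboolP[M [CM rM]] min_k.
have minM N : perp_above (sval U) (sval W) N -> (rho M <= rho N)%N.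
  by move=> CN; rewrite rM; apply: min_k; apply/asboolP; exists N.
have [WM iM _] := CM; pose V := wide_perp W M.
have UV : wide_le U V by move=> X; apply: perp_above_sub CM.
pose h : covers (@wide_le L) V W := wide_perp_cover WM iM.
have rh : brick_rho (brick_label h) = rho M.
  rewrite brick_rho_label; apply/esym/(iso_rho D).
  have [[WM' iM' _] e] := label_ofP h.
  by apply: (wide_perp_inj WM iM WM' iM'); rewrite -e.
have smaller V' : covers (@wide_le L) V' W -> (wide_size V' < n)%N.
  by move=> h'; apply: leq_trans (wide_size_cover h') _.
have [s [l [cs inc_l uniq_l min_l top_l]]] := IHn V (smaller V h) UV.
have above V' (h' : covers (@wide_le L) V' W) : wide_le U V' ->
    perp_above (sval U) (sval W) (label_of h').
  by move=> UV'; have [C' _] := label_ofP h'; apply: perp_above_mono C'.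
have same V' (h' : covers (@wide_le L) V' W) : rho M = rho (label_of h') -> V' = V.
  move=> e; have [[_ iM' _] ->] := label_ofP h'.
  by apply: wide_perp_iso; apply: (rho_iso D) => //; apply: iso_sym.
exists (rcons s W), (rcons l (brick_label h)); split.
- exact: labeled_chain_rcons.
- rewrite /increasing_labels.
  have [[_ _ ->]|[y [h1 [s1 [l1 [c1 _ el]]]]]] := labeled_chain_inv cs.
    by do !constructor.
  move: inc_l; rewrite el /increasing_labels => inc_l; apply/Sorted_rcons; split=> //.
  apply: brick_lt; rewrite rh brick_rho_label.
  have [C1 _] := label_ofP h1; set M1 := label_of h1 in C1 *.
  have [VM1 iM1 _] := C1.
  have C1' : perp_above (sval U) (perp (sval W) M) M1.
    by apply: perp_above_mono C1 => X; apply: (labeled_chain_le wide_le_order c1).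
  (* A label [M1] below the top cover with smaller [rho] could be exchanged into [W], against the
     choice of [M]; with equal [rho] it would put [M] into [perp W M]. *)
  have [//|lt|e] := ltngtP (rho M) (rho M1).
    have := minM _ (perp_above_exchange D (svalP W) UW CM C1' lt).
    by rewrite leqNgt lt.
  case: (@perp_notin _ _ (sval W) M iM).
  apply: (wide_iso (svalP V) VM1).
  by apply: iso_sym; apply: (rho_iso D iM iM1 e).
- move=> s' l' c'; have [[e _ _]|] := labeled_chain_inv c'; first by case: ne.
  move=> [y [h' [s1 [l1 [c1 -> ->]]]]] inc.
  have Uy := labeled_chain_le wide_le_order c1.
  have C' := above y h' Uy.
  have := minM _ C'; rewrite leq_eqVlt => /orP[/eqP e|lt].
    have ey := same y h' e; subst y.
    have -> : h' = h by apply: Prop_irrelevance.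
    by have [-> ->] := uniq_l _ _ c1 (Sorted_belast inc).
  (* If the top label is not the least one, some [T] below it is available in the interval under the
     cover. The increasing chain there ends with a label at most [rho T], so the whole chain is not
     increasing. *)
  have [T [CT ltT]] := perp_above_smaller D (svalP W) UW CM C' lt.
  have CT' : perp_above (sval U) (sval y) T by have [_ ->] := label_ofP h'.
  have [s2 [l2 [_ _ uniq2 _ top2]]] := IHn y (smaller y h') Uy.
  have [_ e1] := uniq2 _ _ c1 (Sorted_belast inc).
  have [l0 [a [e2 le_a]]] := top2 T CT'.
  rewrite e1 e2 in inc; have [_ [le' _]] := (Sorted_rcons _ _ _ _).1 inc.
  move: le'; rewrite /brick_le brick_rho_label => le'.
  by have := leq_ltn_trans (leq_trans le' le_a) ltT; rewrite ltnn.
- move=> s' l' c'; have [[e _ _]|] := labeled_chain_inv c'; first by case: ne.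
  move=> [y [h' [s1 [l1 [c1 _ ->]]]]].
  have C' := above y h' (labeled_chain_le wide_le_order c1).
  rewrite /reflected_lex_le !rev_rcons /=.
  have := minM _ C'; rewrite leq_eqVlt => /orP[/eqP e|lt]; last first.
    by left; apply: brick_lt; rewrite rh brick_rho_label.
  have ey := same y h' e; subst y; right; split; last exact: min_l c1.
  by congr (brick_label _); apply: Prop_irrelevance.
- by move=> T CT; exists l, (brick_label h); split=> //; rewrite rh; apply: minM.
Qed.

Lemma brick_label_EL : EL_labeling brick_le brick_label.
Proof.
split; [exact: wide_bounded|exact: brick_le_order|move=> U W UW].
have [s [l [c inc uniq_l min_l _]]] := EL_interval (ltnSn (wide_size W)) UW.
by exists s, l; split=> // s' l' c' inc'; have [] := uniq_l _ _ c' inc'.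
Qed.

(** Nonzero endomorphisms are bijective, so the sum defining [beta] has no terms. *)
Lemma is_beta_fgindec M : fgindec M -> is_beta M M.
Proof.
move=> iM; exists idfun; split=> [x|x /=]; first by exists x.
split=> [->|[n [g [y [gp ->]]]]].
  by exists 0%N, (fun=> \0), (fun=> 0); split=> [[]//|]; rewrite big_ord0.
case: n g y gp => [|n] g y gp; first by rewrite big_ord0.
have [nz ns] := gp ord0; case: ns; apply: bij_surj.
exact: (indec_endo_bij D iM (nonzero_mapP nz)).
Qed.

Lemma fgindec_basic M : fgindec M -> basic_module M.
Proof.
move=> [fM iM] X Y [nzX _] MXY; have [f [g [fK gK]]] := isoP MXY.
pose s : {linear X -> M} := g \o inl_lin (X * X)%type Y \o inl_lin X X.
have sK : cancel s (fst \o fst \o f) by move=> x; rewrite /s /= gK.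
have rK := retract_indec sK iM nzX.
apply: nzX => x; have := rK (g (0, x, 0)); rewrite /= gK /= linear0.
by move/(congr1 f); rewrite gK linear0 => -[].
Qed.

End WideLattice.

(** * Maps into the Auslander-Reiten translate *)

Section Functionals.
Variable K : fieldType.

Lemma coord_ex (V : lmodType K) n (e : 'I_n -> V) : lin_indep e -> (forall x, exists a, x = lincomb e a) ->
  forall i, exists phi : {linear V -> K^o}, forall a, phi (lincomb e a) = a i.
Proof.
move=> ie se i.
have [x|a x x' _ _ [b [-> ->]] [b' [-> ->]]|y [a [e0 ->]]|phi phiP] :=
  @lin_graph _ V (K^o : lmodType K) (fun x k => exists a, x = lincomb e a /\ k = a i).
- by have [a ->] := se x; exists (a i), a.
- exists (fun j => a * b j + b' j); split=> //.
  rewrite /lincomb scaler_sumr -big_split /=; apply: eq_bigr => j _.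
  by rewrite scalerDl scalerA.
- by apply: ie; rewrite -e0.
exists phi => a; have [b [e1 ->]] := phiP (lincomb e a).
apply/subr0_eq; apply: (ie (fun j => b j - a j)).
rewrite /lincomb; under eq_bigr do rewrite scalerBl.
by rewrite sumrB -/(lincomb e b) -/(lincomb e a) -e1 subrr.
Qed.

(** A nonzero coordinate of the class of [w] in the quotient by [S]. *)
Lemma separate (V : lmodType K) m (f : 'I_m -> V) (S : submod V) w :
  (forall x, exists a, x = lincomb f a) -> ~ S w ->
  exists phi : {linear V -> K^o}, (forall x, S x -> phi x = 0) /\ phi w <> 0.
Proof.
move=> sf nSw; have [Q [p [ps pS]]] := quotient_ex S.
pose TT := @Submod K Q (fun=> True) I (fun _ _ _ _ _ => I).
have [|n [e [_ ie se]]] := @basis_ex _ _ TT m (p \o f).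
  move=> x _; have [y <-] := ps x; have [a ->] := sf y; exists a.
  by rewrite linear_sum; apply: eq_bigr => j _; rewrite linearZ.
have [a pw] := se (p w) I.
have [i ai] : exists i, a i <> 0.
  apply: contrapT => H; apply: nSw; apply/pS; rewrite pw /lincomb big1 // => i _.
  rewrite (_ : a i = 0) ?scale0r //; apply: contrapT => ai; apply: H; by exists i.
have [phi phiP] := coord_ex ie (fun x => se x I) i.
exists (phi \o p); split=> [x Sx|] /=; last by rewrite pw phiP.
by rewrite (iffRL (pS x) Sx) linear0.
Qed.

End Functionals.

Section Transpose.
Variables (K : fieldType) (A : falgType K).
Implicit Types C E I M N P Q V X Y Z : lmodType A.

Lemma lcomb_linear n P (e : 'I_n -> P) :
  linear (fun a : {ffun 'I_n -> A^o} => \sum_i (a i : A) *: e i).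
Proof.
move=> k a b; rewrite scaler_sumr -big_split; apply: eq_bigr => i _ /=.
by rewrite !ffunE scalerDl scalerA.
Qed.

Definition lcomb n P (e : 'I_n -> P) : {linear {ffun 'I_n -> A^o} -> P} :=
  mklin (lcomb_linear e).

Lemma dual_basis P : projective P -> fingen P ->
  exists n (e : 'I_n -> P) (d : 'I_n -> {linear P -> A^o}),
    forall y, y = \sum_i (d i y : A) *: e i.
Proof.
move=> hP [n [e eP]].
have [|s sP] := hP _ _ (lcomb e) idfun.
  move=> y; have [a ->] := eP y; exists [ffun i => a i].
  by apply: eq_bigr => i _; rewrite ffunE.
by exists n, e, (fun i => fproj A^o i \o s) => y; rewrite -[LHS]sP.
Qed.

(** Lifts of finitely many generators of the image generate [P] by the covering property. *)
Lemma proj_cover_fingen P M (p : {linear P -> M}) :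
  proj_cover_of_image p -> fingen M -> fingen P.
Proof.
move=> [_ cov] fM; have [I [a [b [as_ b_inj ba]]]] := im_ex p.
have [n [e eP]] := fingen_inj b_inj fM.
have /choice[g gP] : forall i, exists y, a y = e i by move=> i; apply: as_.
have gs : surj (lcomb g).
  apply: cov => y; have [c cP] := eP (a y); exists [ffun i => c i].
  rewrite -!ba cP; congr (b _); rewrite /= linear_sum.
  by apply: eq_bigr => i _; rewrite ffunE linearZ gP.
exists n, g => y; have [c <-] := gs y; by exists c.
Qed.

Lemma rank1_linear P X (h : {linear P -> A^o}) (x : X) :
  linear (fun y => (h y : A) *: x).
Proof. by move=> k y z; rewrite linearP scalerDl scalerA. Qed.

Definition rank1 P X (h : {linear P -> A^o}) (x : X) : {linear P -> X} :=
  mklin (rank1_linear h x).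

Lemma rmul_linear P (h : {linear P -> A^o}) (a : A) : linear (fun y => (h y : A) * a : A^o).
Proof. by move=> k y z; rewrite linearP mulrDl -mulrA. Qed.

Definition rmul P (h : {linear P -> A^o}) (a : A) : {linear P -> A^o} :=
  mklin (rmul_linear h a).

Section Tau.
Variables (M N : lmodType A) (T : lmodType A^c) (P1 P0 : lmodType A)
  (p1 : {linear P1 -> P0}) (p0 : {linear P0 -> M}) (q : {linear P1 -> A^o} -> T).
Hypotheses (pres : min_proj_presentation p1 p0) (qs : surj q)
  (qD : forall h h1 h2 : {linear P1 -> A^o},
          (forall x, h x = h1 x + h2 x) -> q h = q h1 + q h2)
  (qZ : forall (a : A) (h h1 : {linear P1 -> A^o}),
          (forall x, h x = (h1 x : A) * a) -> q h = (a : A^c) *: q h1)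
  (q0 : forall h : {linear P1 -> A^o},
          q h = 0 <-> exists g : {linear P0 -> A^o}, forall x, h x = g (p1 x)).
Variable theta : N -> T -> K.
Hypotheses (thetaK : forall x, K_functional (theta x))
  (thetaD : forall x y t, theta (x + y) t = theta x t + theta y t)
  (thetaZ : forall (a : A) x t, theta (a *: x) t = theta x ((a : A^c) *: t))
  (theta_inj : forall x y, theta x =1 theta y -> x = y)
  (theta_surj : forall phi : T -> K, K_functional phi -> exists x, theta x =1 phi).
Hypotheses (fP1 : fingen P1) (fP0 : fingen P0).

Lemma theta0 t : theta 0 t = 0.
Proof. by apply: (addrI (theta 0 t)); rewrite -thetaD !addr0. Qed.

Lemma theta_linear x : {morph theta x : s t / s + t}.
Proof. by move=> s t; have := thetaK x 1 s t; rewrite !scale1r mul1r. Qed.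

Lemma theta_r0 x : theta x 0 = 0.
Proof. by apply: (addrI (theta x 0)); rewrite -theta_linear !addr0. Qed.

Lemma theta_sum x n (t : 'I_n -> T) : theta x (\sum_i t i) = \sum_i theta x (t i).
Proof. exact: (big_morph (theta x) (theta_linear x) (theta_r0 x)). Qed.

Lemma lin_sum_ex n X Y (h : 'I_n -> {linear X -> Y}) :
  exists g : {linear X -> Y}, forall x, g x = \sum_i h i x.
Proof.
have L : linear (fun x => \sum_i h i x).
  move=> k x y; rewrite scaler_sumr -big_split; apply: eq_bigr => i _.
  exact: linearP.
by exists (mklin L).
Qed.

Lemma q_sum n (h : 'I_n -> {linear P1 -> A^o}) (g : {linear P1 -> A^o}) :
  (forall x, g x = \sum_i h i x) -> q g = \sum_i q (h i).
Proof.
elim: n h g => [|n IHn] h g gE.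
  by rewrite big_ord0; apply/q0; exists \0 => x; rewrite gE big_ord0.
have [g' g'P] := lin_sum_ex (fun i => h (lift ord0 i)).
rewrite big_ord_recl -(IHn (fun i => h (lift ord0 i)) g') //.
by apply: qD => x; rewrite gE big_ord_recl g'P.
Qed.

Definition ext_surj X := forall u : {linear P1 -> X},
  exists v : {linear P0 -> X}, forall x, u x = v (p1 x).

(* [X] has no nonzero map to tau M = D Tr M if and only if Hom(p1, X) is onto,
   since Hom(Tr M (x) X, K) is the dual of the cokernel of Hom(p1, X). *)
Lemma tau_hom_zero X : ext_surj X -> hom_zero X N.
Proof.
move=> hX f x; have [[hP1 _] [hP0 _] _] := pres.
have [n [e [d dP]]] := dual_basis hP1 fP1.
have [m [b [g gP]]] := dual_basis hP0 fP0.
apply: theta_inj => t; rewrite theta0; have [h <-] := qs t.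
(* Hom(P1, X) is spanned by the rank one maps, by the dual basis; [phi] is the functional on it that
   pairs [rank1 h' z] with the value of [f z] at [q h']. *)
pose phi (u : P1 -> X) := \sum_i theta (f (u (e i))) (q (d i)).
have key (h' : {linear P1 -> A^o}) z : phi (rank1 h' z) = theta (f z) (q h').
  rewrite /phi; under eq_bigr do rewrite /= linearZ /= thetaZ.
  rewrite -theta_sum; congr (theta _ _); apply/esym.
  rewrite (q_sum (h := fun i => rmul (d i) (h' (e i)))) => [|y]; last first.
    by rewrite [in LHS](dP y) linear_sum; apply: eq_bigr => i _; rewrite linearZ.
  by apply: eq_bigr => i _; apply: qZ.
rewrite -key; have [v vP] := hX (rank1 h x).
(* Extended over [P0], the map becomes a sum of rank one maps with functionals [g j \o p1], which
   [q] sends to 0. *)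
have {vP}vP y : rank1 h x y = \sum_j rank1 (g j \o p1) (v (b j)) y.
  rewrite vP [in LHS](gP (p1 y)) linear_sum; apply: eq_bigr => j _.
  by rewrite linearZ.
have -> : phi (rank1 h x) = \sum_j phi (rank1 (g j \o p1) (v (b j))).
  rewrite /phi exchange_big; apply: eq_bigr => i _.
  rewrite vP linear_sum.
  by rewrite (big_morph (fun z => theta z (q (d i))) (fun s t => thetaD s t _) (theta0 _)).
rewrite big1 // => j _; rewrite key.
have -> : q (g j \o p1) = 0 by apply/q0; exists (g j).
exact: theta_r0.
Qed.

(** A map [u] that does not extend over [P0] is detected by a functional [psi] on Hom(P1, X)
    vanishing on all maps that do. Evaluated at rank one maps, [psi] descends to the transpose and
    defines a map from [X] to [N]. This map is 0, but [u] is a sum of rank one maps, so [psi] would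
    vanish on [u]. *)
Lemma tau_ext_surj X : fingen X -> hom_zero X N -> ext_surj X.
Proof.
move=> fX XN u; apply: contrapT => nu; have [[hP1 _] [hP0 _] _] := pres.
have [n [e [d dP]]] := dual_basis hP1 fP1.
pose V : lmodType A := {ffun 'I_n -> X}.
have [m [B BP]] := fingen_kspan (fingen_ffun n fX : fingen V).
pose S (v : kres V) := exists g : {linear P0 -> X}, forall i, (v : V) i = g (p1 (e i)).
have S0 : S 0 by exists \0 => i; rewrite ffunE.
have SL a x y : S x -> S y -> S (a *: x + y).
  move=> [f fE] [g gE]; exists ((kscale X a \o f) \+ g) => i.
  by rewrite /= -fE -gE kresZ !ffunE.
have [|psi [psi0 psiu]] := @separate K (kres V) m B (Submod S0 SL) [ffun i => u (e i)] BP.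
  move=> [g gE]; apply: nu; exists g => y.
  rewrite [y]dP !linear_sum; apply: eq_bigr => i _; rewrite !linearZ /=.
  by have := gE i; rewrite ffunE => ->.
pose ev (h : {linear P1 -> A^o}) (x : X) : K := psi [ffun i => (h (e i) : A) *: x].
have ev0 h x : q h = 0 -> ev h x = 0.
  move=> /q0[g gE]; apply: psi0; exists (rank1 g x) => i.
  by rewrite ffunE gE.
have evq h h' x : q h = q h' -> ev h x = ev h' x.
  move=> e'; apply/subr0_eq; rewrite /ev -linearB.
  have := @ev0 (h \- h') x; rewrite /ev => <-.
    by congr (psi _); apply/ffunP => i; rewrite !ffunE /= scalerBl.
  have := qD (h := h) (h1 := h \- h') (h2 := h') (fun x => esym (subrK _ _)).
  by rewrite e' => /esym/eqP; rewrite addrC -[X in _ == X]addr0 (inj_eq (addrI _)) => /eqP.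
have evL (k : K) (a : A) h x y : ev h ((k%:A : A) *: x + y) = k * ev h x + ev h y.
  rewrite /ev -[k * _]/(k *: (psi _ : K^o)) -linearZ -linearD.
  congr (psi _); apply/ffunP => i.
  by rewrite [RHS]ffunE kresZ !ffunE scalerDr !scalerA kalg_comm.
have /choice[lift liftP] : forall t, exists h, q h = t by exact: qs.
have phiP x : exists y : N, forall h, theta y (q h) = ev h x.
  have [|y yP] := @theta_surj (fun t => ev (lift t) x).
    move=> k s t.
    pose h0 := rmul (lift s) (k%:A) \+ lift t.
    have qh0 : q h0 = ((k%:A : A) : A^c) *: s + t.
      by rewrite (qD (h1 := rmul (lift s) k%:A) (h2 := lift t)) // (qZ (h1 := lift s) (a := k%:A)) // !liftP.
    rewrite (evq _ h0) ?liftP ?qh0 // /ev -[k * _]/(k *: (psi _ : K^o)) -linearZ -linearD.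
    congr (psi _); apply/ffunP => i.
    by rewrite [RHS]ffunE kresZ !ffunE /= scalerDl scalerA kalg_comm.
  by exists y => h; rewrite yP; apply: evq; rewrite liftP.
have [|a x x' y y' hy hy' h|y hy|f fP] :=
  @lin_graph _ X N (fun x y => forall h, theta y (q h) = ev h x).
- by move=> x; apply: phiP.
- rewrite thetaD thetaZ hy' -(qZ (h := rmul h a)) // hy /ev -linearD.
  by congr (psi _); apply/ffunP => i; rewrite !ffunE /= scalerDr scalerA.
- apply: theta_inj => t; rewrite theta0 -(liftP t) hy /ev.
  rewrite (_ : [ffun i => _] = 0) ?linear0 //.
  by apply/ffunP => i; rewrite !ffunE scaler0.
apply: psiu; have -> : [ffun i => u (e i)] = \sum_j [ffun i => (d j (e i) : A) *: u (e j)] :> kres V.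
  apply/ffunP => i; rewrite ffunE sum_ffunE {1}(dP (e i)) linear_sum.
  by apply: eq_bigr => j _; rewrite ffunE linearZ.
rewrite linear_sum big1 // => j _; rewrite -[psi _]/(ev (d j) (u (e j))) -fP XN.
exact: theta0.
Qed.

End Tau.

Lemma tau_presentation M N : fingen M -> is_tau M N ->
  exists P1 P0 (p1 : {linear P1 -> P0}) (p0 : {linear P0 -> M}),
  [/\ min_proj_presentation p1 p0, fingen P1, fingen P0 &
      forall X, fingen X -> (hom_zero X N <-> ext_surj p1 X)].
Proof.
move=> fM [T [[P1 [P0 [p1 [p0 [q [pres qs qD qZ q0]]]]]] [theta [t1 t2 t3 t4 t5]]]].
have [c1 c0 _] := pres; have fP0 := proj_cover_fingen c0 fM.
have fP1 := proj_cover_fingen c1 fP0.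
exists P1, P0, p1, p0; split=> // X fX; split.
  exact: (tau_ext_surj pres qs qD qZ q0 t2 t3 t4 t5 fP1 fX).
exact: (tau_hom_zero pres qs qD qZ q0 t1 t2 t3 t4 fP1 fP0).
Qed.

End Transpose.

(** * Projective presentations in a wide subcategory and their transport along an equivalence *)

Section Presentation.
Variables (K : fieldType) (L : falgType K).
Implicit Types C E I M N P Q V X Y Z : lmodType L.
Variables (W : subcategory L) (hW : wide W).

(* For the second implication: modulo the image of the kernel of [d1], the map
   [u] extends to [Q0]; the difference maps onto that image already from the
   kernel of [d1], so it vanishes by minimality of [Q1]. *)
Lemma presentation_qext M Q1 Q0 (d1 : {linear Q1 -> Q0}) (d0 : {linear Q0 -> M}) X :
    W M -> W Q1 -> W Q0 -> proj_in W Q1 -> proj_in W Q0 -> is_cokernel d1 d0 ->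
    (forall Y (g : {linear Y -> Q1}), W Y ->
       (forall y, exists x, d1 (g x) = d1 y) -> surj g) ->
    W X ->
  (forall u : {linear Q1 -> X}, exists v : {linear Q0 -> X}, forall x, u x = v (d1 x)) <->
  qext W M X.
Proof.
move=> WM WQ1 WQ0 hQ1 hQ0 [d0s d0P] minQ1 WX; split=> [hX Y r WY rs|qX u].
  apply: ext0_of_split => E i p ip.
  have WE := wide_ses hW ip WY WM.
  (* The lift of [d0] to [E] restricts to a map [w] from [Q1] to [Y]. Lifted to [X] and extended
     over [Q0], it can be subtracted from the lift, which then descends to a section on [M]. *)
  have [l lP] := hQ0 _ _ p d0 WE WM (ses_surj ip).
  have [|w wP] := ses_lift (f := l \o d1) ip.
    by move=> x; rewrite /= lP; apply/d0P; exists x.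
  have [u uP] := hQ1 _ _ r w WX WY rs.
  have [v vP] := hX u.
  have [|s sP] := lift_surj (f := l \- (i \o r \o v)) d0s.
    by move=> _ /d0P[x <-]; rewrite /= -vP uP wP /= subrr.
  exists s; apply: (surjK d0s) => x.
  by rewrite sP /= linearB /= lP (ses0 _ ip) subr0.
have [N [k dk]] := ker_ex d1; have [k_inj kP] := dk.
have WN : W N := wide_ker hW WQ1 WQ0 dk.
have [X' [a [b [as_ b_inj ba]]]] := im_ex (u \o k).
have WX' := wide_im hW WN WX as_ b_inj ba.
have [Y [c bc]] := ses_of_inj b_inj.
have WY : W Y := wide_ses_quo hW bc WX' WX.
have [I [e [j [es j_inj je]]]] := im_ex d1.
have jd0 : ses j d0.
  split=> //; split=> // y; rewrite d0P; split=> [[x <-]|[z <-]]; first by exists (e x).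
  by have [x <-] := es z; exists x.
have [|w wP] := lift_surj (f := c \o u) es.
  move=> x ex; have /kP[n <-] : d1 x = 0 by rewrite -je ex linear0.
  by rewrite /= -[u _]/((u \o k) n) -ba (ses0 _ bc).
have [w' w'P] := qX _ c WY (ses_surj bc) _ _ _ _ jd0 w.
have [v vP] := hQ0 _ _ c w' WX WY (ses_surj bc).
have [|h hP] := ses_lift (f := u \- (v \o d1)) bc.
  by move=> x; rewrite /= linearB vP -je w'P wP /= subrr.
have [N' [k' hk']] := ker_ex h; have [k'_inj k'P] := hk'.
have WN' : W N' := wide_ker hW WQ1 WX' hk'.
have dk0 n : d1 (k n) = 0 by apply/kP; exists n.
have hk n : h (k n) = a n.
  by apply: b_inj; rewrite hP ba /= dk0 linear0 subr0.
have k's : surj k'.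
  apply: (minQ1 N') => // y; have [n an] := as_ (h y).
  have /k'P[x xE] : h (y - k n) = 0 by rewrite linearB hk an subrr.
  by exists x; rewrite xE linearB dk0 subr0.
exists v => x; apply/subr0_eq.
have := hP x; rewrite /= => <-; rewrite (_ : h x = 0) ?linear0 //.
by apply/k'P; have [y <-] := k's x; exists y.
Qed.

Variables (A : falgType K) (F : equivalence W A).
Implicit Types a b c d : obj W.

Lemma eq_hom0 a b (f : {linear sval a -> sval b}) :
  (forall x, f x = 0) <-> forall z, eq_hom F f z = 0.
Proof.
have zero c d (g : {linear sval c -> sval d}) : (forall x, g x = 0) ->
    forall z, eq_hom F g z = 0.
  move=> g0 z; have := @eq_linear _ _ _ _ F c d 1 g g g _ z.
  rewrite !scale1r => /(_ _)/esym/eqP; rewrite -[X in _ == X]addr0 (inj_eq (addrI _)) => H.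
  by apply/eqP/H => x; rewrite g0 scaler0 addr0.
split=> [|f0]; first exact: zero.
move=> x; apply: (@eq_faithful _ _ _ _ F a b f \0) => z.
by rewrite f0 zero.
Qed.

Lemma eq_hom_comp a b c (f : {linear sval a -> sval b}) (g : {linear sval b -> sval c}) z :
  eq_hom F g (eq_hom F f z) = @eq_hom _ _ _ _ F a c (g \o f) z.
Proof. by apply/esym; apply: eq_comp. Qed.

Lemma eq_hom_ext a b (f g : {linear sval a -> sval b}) :
  (forall x, f x = g x) -> forall z, eq_hom F f z = eq_hom F g z.
Proof.
move=> fg z; rewrite (@eq_comp _ _ _ _ F a a b idfun g f) //=.
by rewrite (@eq_id _ _ _ _ F a idfun).
Qed.

Lemma eq_full_to a (X : lmodType A) (f : {linear X -> eq_ob F a}) : fingen X ->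
  exists b (al : {linear eq_ob F b -> X}) (g : {linear sval b -> sval a}),
    bijective al /\ forall z, eq_hom F g z = f (al z).
Proof.
move=> fX; have [b [al alb]] := eq_dense F fX.
have [g gP] := @eq_full _ _ _ _ F b a (f \o al); by exists b, al, g.
Qed.

Lemma eq_full_from a (X : lmodType A) (f : {linear eq_ob F a -> X}) : fingen X ->
  exists b (al : {linear X -> eq_ob F b}) (g : {linear sval a -> sval b}),
    bijective al /\ forall z, eq_hom F g z = al (f z).
Proof.
move=> fX; have [b /iso_sym[al alb]] := eq_dense F fX.
have [g gP] := @eq_full _ _ _ _ F a b (al \o f); by exists b, al, g.
Qed.

Lemma bij_eq0 (X Y : lmodType A) (f : {linear X -> Y}) : bijective f ->
  forall x, f x = 0 -> x = 0.
Proof. by move=> /bij_inj f_inj x; rewrite -[X in _ = X](linear0 f) => /f_inj. Qed.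

(** Surjections are the epimorphisms on both sides, since cokernels stay in the category; an
    equivalence preserves and reflects these. *)
Lemma eq_hom_surj a b (f : {linear sval a -> sval b}) :
  surj f <-> surj (eq_hom F f).
Proof.
split=> fs.
  have [C [c [cs cP]]] := coker_ex (eq_hom F f).
  have [d [al [g [alb gP]]]] := eq_full_from c (fingen_surj cs (eq_fingen F b)).
  move=> y; apply/cP; apply: (bij_eq0 alb); rewrite -gP.
  move: y; apply/eq_hom0; apply: (surjK (g := fun=> 0) fs).
  move=> x; rewrite -[g _]/((g \o f) x); move: x; apply/(@eq_hom0 a d) => z.
  rewrite -eq_hom_comp gP (_ : c _ = 0) ?linear0 //.
  by apply/cP; exists z.
have [C [c cc]] := coker_ex f; have [cs cP] := cc.
have WC := wide_coker hW (svalP a) (svalP b) cc.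
move=> y; apply/cP; move: y.
pose d : obj W := exist _ C WC.
apply/(@eq_hom0 b d); apply: (surjK (g := fun=> 0) fs) => z.
rewrite (@eq_hom_comp a b d); move: z; apply/(@eq_hom0 a d) => x /=.
by apply/cP; exists x.
Qed.

Lemma eq_hom_inj a b (f : {linear sval a -> sval b}) :
  injective f -> injective (eq_hom F f).
Proof.
move=> f_inj; have [N [k [k_inj kP]]] := ker_ex (eq_hom F f).
have [d [al [g [alb gP]]]] := eq_full_to k (fingen_inj k_inj (eq_fingen F a)).
have g0 x : g x = 0.
  apply: f_inj; rewrite linear0 -[f _]/((f \o g) x); move: x.
  apply/(@eq_hom0 d b) => z; rewrite -eq_hom_comp gP.
  by apply/kP; exists (al z).
apply: lin_inj => x /kP[z <-].
have [w <-] := bij_surj alb z.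
by rewrite -gP; move: w; apply/eq_hom0.
Qed.

Lemma eq_proj_in a (P : lmodType A) (al : {linear eq_ob F a -> P}) :
  bijective al -> projective P -> proj_in W (sval a).
Proof.
move=> /bij_inv[be [alK beK]] hP X Y p f WX WY ps.
pose x : obj W := exist _ X WX; pose y : obj W := exist _ Y WY.
have Fps : surj (@eq_hom _ _ _ _ F x y p) by apply/eq_hom_surj.
have [g gP] := hP _ _ _ (@eq_hom _ _ _ _ F a y f \o be) Fps.
have [h hP'] := @eq_full _ _ _ _ F a x (g \o al).
exists h; apply: (@eq_faithful _ _ _ _ F a y (p \o h) f) => z.
by rewrite -(@eq_hom_comp a x y) hP' /= gP /= alK.
Qed.

End Presentation.

Section TauInWide.
Variables (K : fieldType) (L : falgType K).
Implicit Types (W : subcategory L) (I M N X Y : lmodType L).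

(** The minimal presentation over [A] is carried back to [W], where [presentation_qext] applies. As
    [qext] does not mention the equivalence, all choices of a translate give the same condition on
    [X]. *)
Lemma tau_in_qext W M N X : wide W -> is_tau_in W M N -> W X ->
  hom_zero X N <-> qext W M X.
Proof.
move=> hW [A [F [WM [WN tauMN]]]] WX.
pose m : obj W := exist _ M WM; pose n : obj W := exist _ N WN; pose x : obj W := exist _ X WX.
have [P1 [P0 [p1 [p0 [[cov1 cov0 [p0s p0P]] fP1 fP0 HX]]]]] :=
  tau_presentation (eq_fingen F m) tauMN.
have [q1 [al1 al1b]] := eq_dense F fP1.
have [q0 [al0 al0b]] := eq_dense F fP0.
have [be1 [al1K be1K]] := bij_inv al1b; have [be0 [al0K be0K]] := bij_inv al0b.
have [d1 d1P] := @eq_full _ _ _ _ F q1 q0 (be0 \o p1 \o al1).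
have [d0 d0P] := @eq_full _ _ _ _ F q0 m (p0 \o al0).
have Q1 := eq_proj_in hW al1b cov1.1.
have Q0 := eq_proj_in hW al0b cov0.1.
have d0s : surj d0.
  apply/(eq_hom_surj hW F (a := q0) (b := m)) => z; have [y <-] := p0s z.
  by exists (be0 y); rewrite d0P /= be0K.
have d00 y : d0 (d1 y) = 0.
  rewrite -[d0 _]/((d0 \o d1) y); move: y.
  apply/(@eq_hom0 _ _ _ _ F q1 m) => z.
  rewrite -(@eq_hom_comp _ _ _ _ F q1 q0 m) d1P d0P /= be0K.
  by apply/p0P; exists (al1 z).
have dcok : is_cokernel d1 d0.
  split=> // y; split=> [|[z <-]]; last exact: d00.
  move=> dy; have [N' [k dk]] := ker_ex d0; have [k_inj kP] := dk.
  have WN' : W N' := wide_ker hW (svalP q0) WM dk.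
  pose n' : obj W := exist _ N' WN'.
  have [|e eP] := lift_inj (f := d1) k_inj; first by move=> z; apply/kP.
  have es : surj e.
    apply/(eq_hom_surj hW F (a := q1) (b := n')) => z.
    have /p0P[w wP] : p0 (al0 (@eq_hom _ _ _ _ F n' q0 k z)) = 0.
      rewrite -[p0 _]/((p0 \o al0) _) -d0P (@eq_hom_comp _ _ _ _ F n' q0 m).
      move: z; apply/(@eq_hom0 _ _ _ _ F n' m) => z /=.
      by apply/kP; exists z.
    exists (be1 w); apply: (eq_hom_inj (a := n') (b := q0) k_inj).
    rewrite (@eq_hom_comp _ _ _ _ F q1 n' q0).
    rewrite (@eq_hom_ext _ _ _ _ F q1 q0 (k \o e) d1) //.
    by rewrite d1P /= be1K wP al0K.
  have /kP[z <-] := dy; have [w <-] := es z; exists w.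
  by rewrite eP.
have minQ1 Y (g : {linear Y -> sval q1}) : W Y ->
    (forall y, exists x, d1 (g x) = d1 y) -> surj g.
  move=> WY hg; pose y : obj W := exist _ Y WY.
  have [I [e [j [es j_inj je]]]] := im_ex d1.
  have WI : W I := wide_im hW (svalP q1) (svalP q0) es j_inj je.
  pose i : obj W := exist _ I WI.
  (* The covering condition is restated as surjectivity onto the image of [d1], a form that the
     equivalence preserves. *)
  have egs : surj (e \o g).
    move=> z; have [w <-] := es z; have [t tP] := hg w; exists t.
    by apply: j_inj; rewrite /= !je.
  have Fegs : surj (@eq_hom _ _ _ _ F y i (e \o g)).
    by apply/(eq_hom_surj hW F (a := y) (b := i)).
  have p1E z : p1 (al1 z) = al0 (@eq_hom _ _ _ _ F i q0 j (@eq_hom _ _ _ _ F q1 i e z)).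
    rewrite (@eq_hom_comp _ _ _ _ F q1 i q0).
    rewrite (@eq_hom_ext _ _ _ _ F q1 q0 (j \o e) d1) //.
    by rewrite d1P /= be0K.
  have : surj (al1 \o @eq_hom _ _ _ _ F y q1 g).
    apply: cov1.2 => w.
    have [t tP] := Fegs (@eq_hom _ _ _ _ F q1 i e (be1 w)); exists t => /=.
    by rewrite p1E (@eq_hom_comp _ _ _ _ F y q1 i) tP -p1E be1K.
  move=> s; apply/(eq_hom_surj hW F (a := y) (b := q1)) => z.
  by have [t tP] := s (al1 z); exists t; apply: (can_inj al1K).
rewrite -(presentation_qext hW WM (svalP q1) (svalP q0) Q1 Q0 dcok minQ1 WX).
have -> : hom_zero X N <-> hom_zero (eq_ob F x) (eq_ob F n).
  split=> H f z.
    have [g gP] := @eq_full _ _ _ _ F x n f.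
    by rewrite -gP; move: z; apply/(@eq_hom0 _ _ _ _ F x n) => y; apply: H.
  by move: z; apply/(@eq_hom0 _ _ _ _ F x n) => y; apply: H.
rewrite (HX _ (eq_fingen F x)); split=> H u.
  have [v vP] := H (@eq_hom _ _ _ _ F q1 x u \o be1).
  have [w wP] := @eq_full _ _ _ _ F q0 x (v \o al0).
  exists w; apply: (@eq_faithful _ _ _ _ F q1 x u (w \o d1)) => z.
  rewrite -(@eq_hom_comp _ _ _ _ F q1 q0 x) wP d1P /= be0K -vP /=.
  by rewrite al1K.
have [v vP] := @eq_full _ _ _ _ F q1 x (u \o al1).
have [w wP] := H v; exists (@eq_hom _ _ _ _ F q0 x w \o be0) => z.
rewrite -[z]be1K -[u _]/((u \o al1) (be1 z)) -vP.
rewrite (@eq_hom_ext _ _ _ _ F q1 x v (w \o d1)) //.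
by rewrite -(@eq_hom_comp _ _ _ _ F q1 q0 x) d1P /= be1K.
Qed.

End TauInWide.

(** * Existence of the Auslander-Reiten translate *)

(* Additive groups of functions [D -> V] on which a ring [R] acts through the
   domain; instances are Hom(P, X) over End(P)^op and the K-dual of a right
   module. *)
Record funspace (R : nzRingType) (D : Type) (V : zmodType) := Funspace {
  fs_act : R -> D -> D;
  fs_in : (D -> V) -> Prop;
  fs_in0 : fs_in (fun=> 0);
  fs_inB : forall f g, fs_in f -> fs_in g -> fs_in (fun d => f d - g d);
  fs_in_act : forall a f, fs_in f -> fs_in (fun d => f (fs_act a d));
  fs_act1 : forall f d, fs_in f -> f (fs_act 1 d) = f d;
  fs_actD : forall f a b d, fs_in f ->
    f (fs_act (a + b) d) = f (fs_act a d) + f (fs_act b d);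
  fs_actM : forall f a b d, fs_in f ->
    f (fs_act (a * b) d) = f (fs_act b (fs_act a d)) }.

Section FunctionModule.
Variables (R : nzRingType) (D : Type) (V : zmodType) (S : funspace R D V).

Record funmod := Funmod { fm_fun :> D -> V; fm_in : fs_in S fm_fun }.

HB.instance Definition _ := gen_eqMixin funmod.
HB.instance Definition _ := gen_choiceMixin funmod.

Lemma funmodP (f g : funmod) : (forall d, f d = g d) -> f = g.
Proof.
case: f g => [f hf] [g hg] /= /funext e; subst g.
by congr Funmod; apply: Prop_irrelevance.
Qed.

Definition fm_zero := Funmod (fs_in0 S).

Lemma fm_opp_subproof (f : funmod) : fs_in S (fun d => - f d).
Proof.
have := fs_inB (fs_in0 S) (fm_in f); congr (fs_in S _).
by apply/funext => d; rewrite sub0r.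
Qed.
Definition fm_opp f := Funmod (fm_opp_subproof f).

Lemma fm_add_subproof (f g : funmod) : fs_in S (fun d => f d + g d).
Proof.
have := fs_inB (fm_in f) (fm_in (fm_opp g)); congr (fs_in S _).
by apply/funext => d; rewrite /= opprK.
Qed.
Definition fm_add f g := Funmod (fm_add_subproof f g).

Lemma fm_addA : associative fm_add.
Proof. by move=> f g h; apply: funmodP => d /=; rewrite addrA. Qed.
Lemma fm_addC : commutative fm_add.
Proof. by move=> f g; apply: funmodP => d /=; rewrite addrC. Qed.
Lemma fm_add0 : left_id fm_zero fm_add.
Proof. by move=> f; apply: funmodP => d /=; rewrite add0r. Qed.
Lemma fm_addN : left_inverse fm_zero fm_opp fm_add.
Proof. by move=> f; apply: funmodP => d /=; rewrite addNr. Qed.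
HB.instance Definition _ := GRing.isZmodule.Build funmod fm_addA fm_addC fm_add0 fm_addN.

Definition fm_scale a (f : funmod) := Funmod (fs_in_act a (fm_in f)).

Lemma fm_scaleA a b f : fm_scale a (fm_scale b f) = fm_scale (a * b) f.
Proof. by apply: funmodP => d /=; rewrite (fs_actM _ _ _ (fm_in f)). Qed.
Lemma fm_scale1 : left_id 1 fm_scale.
Proof. by move=> f; apply: funmodP => d /=; rewrite (fs_act1 _ (fm_in f)). Qed.
Lemma fm_scaleDr : right_distributive fm_scale +%R.
Proof. by move=> a f g; apply: funmodP. Qed.
Lemma fm_scaleDl f : {morph fm_scale^~ f : a b / a + b}.
Proof. by move=> a b; apply: funmodP => d /=; rewrite (fs_actD _ _ _ (fm_in f)). Qed.
HB.instance Definition _ := GRing.Zmodule_isLmodule.Build R funmod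
  fm_scaleA fm_scale1 fm_scaleDr fm_scaleDl.

Lemma fmDE (f g : funmod) d : (f + g) d = f d + g d. Proof. by []. Qed.
Lemma fm0E d : (0 : funmod) d = 0. Proof. by []. Qed.
Lemma fm_sumE n (f : 'I_n -> funmod) d : (\sum_i f i) d = \sum_i f i d.
Proof. exact: (big_morph (fun g : funmod => g d) (fun f g => fmDE f g d) (fm0E d)). Qed.

End FunctionModule.

(** * Projective covers, transposes and duals over a finite-dimensional algebra *)

Section ProjectiveCovers.
Variables (K : fieldType) (A : falgType K).
Implicit Types C E I M N P Q V X Y Z : lmodType A.

Lemma free_projective n : projective ({ffun 'I_n -> A^o} : lmodType A).
Proof.
move=> M N p f ps.
pose e (i : 'I_n) : {ffun 'I_n -> A^o} := [ffun j => if j == i then 1 else 0].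
have /choice[y yP] : forall i, exists x, p x = f (e i) by move=> i; apply: ps.
exists (lcomb y) => a; rewrite /= linear_sum.
have {2}-> : a = \sum_i (a i : A) *: e i.
  apply/ffunP => j; rewrite sum_ffunE (bigD1 j) //= big1 => [|i ij].
    by rewrite !ffunE eqxx addr0 [RHS]mulr1.
  by rewrite !ffunE eq_sym (negbTE ij) scaler0.
by rewrite linear_sum; apply: eq_bigr => i _; rewrite !linearZ yP.
Qed.

Lemma projective_retract P Q (s : {linear Q -> P}) (r : {linear P -> Q}) :
  cancel s r -> projective P -> projective Q.
Proof.
move=> sK hP M N p f ps; have [g gP] := hP _ _ p (f \o r) ps.
by exists (g \o s) => x; rewrite /= gP /= sK.
Qed.

(** The power of [e] with exponent [n + 1], whence the successor in [iter_linD]. *)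
Fixpoint iter_lin P (e : {linear P -> P}) n : {linear P -> P} :=
  if n is m.+1 then e \o iter_lin e m else e.

Lemma iter_linD P (e : {linear P -> P}) n m x :
  iter_lin e n (iter_lin e m x) = iter_lin e (n + m).+1 x.
Proof. by elim: n x => [|n IHn] x //=; rewrite IHn. Qed.

(** A projective of least dimension over [M] is a cover. A map [g] that hits everything gives an
    endomorphism [e] of [P] over [M]; by Fitting's argument, the image of a power of least rank is a
    summand of [P] that still maps onto [M], hence all of [P]. *)
Lemma proj_cover_ex M : fingen M -> exists P (p : {linear P -> M}),
  [/\ proj_cover_of_image p, fingen P & surj p].
Proof.
move=> fM; pose T n := `[< exists P (p : {linear P -> M}),
  [/\ projective P, fingen P, surj p & dim P = n] >].
have Tex : exists n, T n.
  have [n [e eP]] := fM.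
  pose P : lmodType A := {ffun 'I_n -> A^o}.
  exists (dim P); apply/asboolP; exists P, (lcomb e); split=> //.
  - exact: free_projective.
  - apply: fingen_ffun; exists 1%N, (fun=> 1 : A^o) => x; exists (fun=> x).
    by rewrite big_ord1 [RHS]mulr1.
  - move=> x; have [a ->] := eP x; exists [ffun i => a i].
    by apply: eq_bigr => i _; rewrite ffunE.
case: (ex_minnP Tex) => n /asboolP[P [p [hP fP ps dP]]] min_n.
exists P, p; split=> //; split=> // X g gp.
have [s sP] : exists s : {linear P -> X}, forall x, p (g (s x)) = p x.
  apply: (hP _ _ (p \o g) p) => y; have [x <-] := ps y.
  by have [z zP] := gp x; exists z.
pose e : {linear P -> P} := g \o s.
have pe m x : p (iter_lin e m x) = p x.
  by elim: m x => [|m IHm] x /=; rewrite sP.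
pose T' k := `[< exists m, rank (iter_lin e m) = k >].
have Tex' : exists k, T' k by exists (rank e); apply/asboolP; exists 0%N.
case: (ex_minnP Tex') => k /asboolP[m rm] min_k.
have [I [a [b [as_ b_inj ba]]]] := im_ex (iter_lin e m).
have fI := fingen_surj as_ fP.
have [J [c [d [cs d_inj dc]]]] := im_ex (a \o b).
have abs : surj (a \o b).
  have ds : surj d.
    apply: dim_inj_surj => //; rewrite -(rankE fP as_ b_inj ba) rm.
    apply: leq_trans (min_k (rank (iter_lin e (m + m).+1)) _) _.
      by apply/asboolP; exists (m + m).+1.
    apply: (@rank_factor _ _ _ _ _ _ (c \o a) (b \o d)).
      exact: fingen_surj cs fI.
    by move=> x /=; rewrite dc /= !ba iter_linD.
  move=> x; have [y <-] := ds x; have [z <-] := cs y.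
  by exists z; rewrite dc.
have [t [tK Kt]] := lin_inv (dim_surj_inj abs fI (leqnn _)) abs.
have bK : cancel b (t \o a) by move=> x; apply: tK.
have bs : surj b.
  apply: dim_inj_surj => //; rewrite dP; apply: min_n; apply/asboolP.
  exists I, (p \o b); split=> //; first exact: projective_retract bK hP.
  move=> y; have [x <-] := ps y; exists (a x).
  by rewrite /= ba pe.
move=> y; have [z <-] := bs y; have [x <-] := as_ z; rewrite ba.
case: (m) => [|l] /=; first by exists (s x).
by exists (s (iter_lin e l x)).
Qed.

Lemma min_presentation_ex M : fingen M ->
  exists P1 P0 (p1 : {linear P1 -> P0}) (p0 : {linear P0 -> M}),
  [/\ min_proj_presentation p1 p0, fingen P1 & fingen P0].
Proof.
move=> fM; have [P0 [p0 [c0 f0 s0]]] := proj_cover_ex fM.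
have [N [k kp]] := ses_of_surj s0; have k_inj := ses_inj kp.
have [P1 [p1 [c1 f1 s1]]] := proj_cover_ex (fingen_inj k_inj f0).
exists P1, P0, (k \o p1), p0; split=> //; split=> //.
  split; first exact: c1.1.
  move=> X g gp; apply: c1.2 => y; have [x xP] := gp y; exists x.
  exact: k_inj.
split=> // y; split=> [/(ses_ker kp)[z <-]|[x <-]]; last exact: ses0 kp.
by have [x <-] := s1 z; exists x.
Qed.

(** Hom(P1, A) is realised over [A^c] by the tuples of values on generators of [P1]. The tuples of
    maps that factor through [p1] form the submodule to divide out. *)
Lemma transpose_ex M : fingen M -> exists T : lmodType A^c, is_transpose M T.
Proof.
move=> fM; have [P1 [P0 [p1 [p0 [pres [n [e eP]] f0]]]]] := min_presentation_ex fM.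
pose V : lmodType A^c := {ffun 'I_n -> (A^c)^o}.
pose val_at (h : {linear P1 -> A^o}) : V := [ffun i => (h (e i) : A^c)].
pose S (v : V) := exists h, v = val_at h.
have SD (h1 h2 h : {linear P1 -> A^o}) (a : A) :
    (forall x, h x = (h1 x : A) * a + h2 x) -> val_at h = (a : A^c) *: val_at h1 + val_at h2.
  by move=> hE; apply/ffunP => i; rewrite !ffunE hE.
have S0 : S 0 by exists \0; apply/ffunP => i; rewrite !ffunE.
have SL (a : A^c) x y : S x -> S y -> S (a *: x + y).
  move=> [h1 ->] [h2 ->]; exists (rmul h1 a \+ h2).
  by apply/esym/SD.
pose S' (v : V) := exists g : {linear P0 -> A^o}, v = val_at (g \o p1).
have S'0 : S' 0 by exists \0; apply/ffunP => i; rewrite !ffunE.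
have S'L (a : A^c) x y : S' x -> S' y -> S' (a *: x + y).
  move=> [g1 ->] [g2 ->]; exists (rmul g1 a \+ g2).
  by apply/esym/SD.
have [H [i [i_inj iP]]] := submodule_ex (Submod S0 SL).
have R0 : S' (i 0) by rewrite linear0.
have RL (a : A^c) x y : S' (i x) -> S' (i y) -> S' (i (a *: x + y)).
  by rewrite linearP; apply: S'L.
have [T [c [cs cP]]] := quotient_ex (@Submod _ H (fun x => S' (i x)) R0 RL).
have /choice[lift liftP] : forall h, exists x, i x = val_at h.
  by move=> h; apply/iP; exists h.
have val_ext (h g : {linear P1 -> A^o}) : val_at h = val_at g -> forall x, h x = g x.
  move=> hg x; have [a ->] := eP x; rewrite !linear_sum; apply: eq_bigr => j _.
  rewrite !linearZ; congr (_ *: _).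
  by have /ffunP/(_ j) := hg; rewrite !ffunE.
exists T, P1, P0, p1, p0, (c \o lift); split=> //.
- move=> t; have [x <-] := cs t.
  have /iP[h hE] : exists x', i x' = i x by exists x.
  by exists h; congr (c _); apply: i_inj; rewrite liftP.
- move=> h h1 h2 hE; rewrite /= -linearD; congr (c _); apply: i_inj.
  rewrite linearD !liftP -[val_at h1]scale1r; apply: SD => x.
  by rewrite mulr1.
- move=> a h h1 hE; rewrite /= -linearZ; congr (c _); apply: i_inj.
  rewrite linearZ /= !liftP -[RHS]addr0.
  rewrite (SD h1 \0 h a) => [|x]; last by rewrite hE addr0.
  by congr (_ + _); apply/ffunP => j; rewrite !ffunE.
- move=> h /=; rewrite cP /= liftP; split=> [[g gE]|[g gE]]; exists g.
    exact: (val_ext h (g \o p1) gE).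
  by apply/ffunP => j; rewrite !ffunE gE.
Qed.

Section Dual.
Variable T : lmodType A^c.

Definition dual_act (a : A) (t : T) : T := (a : A^c) *: t.

Lemma K_functionalD (phi : T -> K) : K_functional phi ->
  forall s t, phi (s + t) = phi s + phi t.
Proof. by move=> hphi s t; have := hphi 1 s t; rewrite !scale1r mul1r. Qed.

Definition dual_funspace : funspace A T K.
Proof.
exists dual_act (@K_functional K A T).
- by move=> k s t; rewrite mulr0 addr0.
- move=> f g hf hg k s t; rewrite hf hg mulrBr opprD !addrA; congr (_ + _).
  by rewrite -!addrA; congr (_ + _); rewrite addrC.
- move=> a f hf k s t; rewrite /dual_act scalerDr.
  rewrite scalerA -[X in X *: s]/((k%:A : A) * a) kalg_comm.
  by rewrite -[(a * _)]/(((k%:A : A) : A^c) * (a : A^c)) -scalerA hf.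
- by move=> f d hf; rewrite /dual_act scale1r.
- by move=> f a b d hf; rewrite /dual_act scalerDl K_functionalD.
- by move=> f a b d hf; rewrite /dual_act scalerA.
Defined.

Lemma K_dual_ex : exists N : lmodType A, is_K_dual T N.
Proof.
exists (funmod dual_funspace), (fun f => fm_fun f); split=> //.
- by move=> f; apply: (fm_in f).
- by move=> f g e; apply: funmodP.
- by move=> phi hphi; exists (Funmod (hphi : fs_in dual_funspace phi)).
Qed.
End Dual.

Lemma K_dual_iso (T : lmodType A^c) N N' : iso N N' -> is_K_dual T N -> is_K_dual T N'.
Proof.
move=> /isoP[f [g [fK gK]]] [theta [t1 t2 t3 t4 t5]].
exists (theta \o g); split=> //= [x y t|a x t|x y e|phi /t5[x xP]].
- by rewrite linearD t2.
- by rewrite linearZ t3.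
- by rewrite -[x]gK -[y]gK (t4 _ _ e).
- by exists (f x) => t /=; rewrite fK xP.
Qed.

(** An element of [N] is a functional on the transpose, determined by its values on the classes of a
    [K]-spanning family of Hom(P1, A). Finite generation is needed to transport [N] back to [W]. *)
Lemma tau_fingen M N : fingen M -> is_tau M N -> fingen N.
Proof.
move=> fM [T [[P1 [P0 [p1 [p0 [q [pres qs qD qZ q0]]]]]] [theta [t1 t2 t3 t4 t5]]]].
have [c1 c0 _] := pres; have fP1 := proj_cover_fingen c1 (proj_cover_fingen c0 fM).
have fA : fingen (A^o : lmodType A).
  by exists 1%N, (fun=> 1 : A^o) => x; exists (fun=> x); rewrite big_ord1 [RHS]mulr1.
have [m [F FP]] := hom_span fP1 fA.
pose V : lmodType K := {ffun 'I_m -> K^o}.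
pose val_at (x : kres N) : V := [ffun j => theta x (q (F j))].
have thL x y : val_at (x + y) = val_at x + val_at y.
  by apply/ffunP => j; rewrite !ffunE t2.
have th0 t : theta 0 t = 0 by apply: (addrI (theta 0 t)); rewrite -t2 !addr0.
have thr0 x : theta x 0 = 0.
  by apply: (addrI (theta x 0)); rewrite -(K_functionalD (t1 x)) !addr0.
have thZr k x t : theta x (((k%:A : A) : A^c) *: t) = k * theta x t.
  by have := t1 x k t 0; rewrite !addr0 thr0 addr0.
have thZ k x : val_at (k *: x) = k *: val_at x.
  by apply/ffunP => j; rewrite !ffunE kresZ t3 thZr.
have v_inj x y : val_at x = val_at y -> x = y.
  move=> e; apply: t4 => t; have [h <-] := qs t; have [a aP] := FP h.
  rewrite (q_sum qD q0 (h := fun j => rmul (F j) (a j)%:A)) => [|z]; last first.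
    by rewrite aP; apply: eq_bigr => j _; rewrite /= -kalg_comm.
  rewrite !(big_morph (theta _) (K_functionalD (t1 _)) (thr0 _)).
  apply: eq_bigr => j _; rewrite (qZ (a j)%:A (rmul (F j) (a j)%:A) (F j)) // !thZr.
  by congr (_ * _); have /ffunP/(_ j) := e; rewrite !ffunE.
have P0' : exists x, val_at x = 0 by exists 0; apply/ffunP => j; rewrite !ffunE th0.
have PL (k : K) x y : (exists z, val_at z = x) -> (exists z, val_at z = y) ->
    exists z, val_at z = k *: x + y.
  by move=> [z <-] [w <-]; exists (k *: z + w); rewrite thL thZ.
have [|r [e [eP _ eS]]] := @basis_ex _ V (@Submod K V _ P0' PL) m
    (fun j => [ffun i => (i == j)%:R]).
  move=> v _; exists v; apply/ffunP => j; rewrite /lincomb sum_ffunE.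
  rewrite (bigD1 j) //= !ffunE eqxx [X in X + _]mulr1 big1 ?addr0 // => i ij.
  by rewrite !ffunE eq_sym (negbTE ij) [LHS]mulr0.
move/choice: eP => [g gP]; apply: (@span_fingen _ _ N 'I_r g) => x.
have [|a aP] := eS (val_at x); first by exists x.
exists a; apply: v_inj; rewrite aP /lincomb.
have v0 : val_at 0 = 0 by apply/ffunP => j; rewrite !ffunE th0.
rewrite (big_morph val_at thL v0); apply: eq_bigr => j _.
by rewrite thZ gP.
Qed.

Lemma tau_ex M : fingen M -> exists N, is_tau M N.
Proof.
move=> /transpose_ex[T hT]; have [N hN] := K_dual_ex T.
by exists N, T.
Qed.

Lemma tau_iso M N N' : iso N N' -> is_tau M N -> is_tau M N'.
Proof. by move=> NN' [T [hT hN]]; exists T; split=> //; apply: K_dual_iso hN. Qed.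

End ProjectiveCovers.

(** * The opposite endomorphism algebra *)

Section EndoAlgebra.
Variables (K : fieldType) (L : falgType K) (P : lmodType L).

Lemma mx_ext n m (A B : 'M[K]_(n, m)) : (forall v : 'rV_n, v *m A = v *m B) -> A = B.
Proof. by move=> e; apply/row_matrixP => i; rewrite !rowE. Qed.

Lemma coordinates_ex : fingen P -> exists n (phi : {linear kres P -> 'rV[K]_n})
  (vec : {linear 'rV[K]_n -> kres P}), cancel phi vec /\ cancel vec phi.
Proof.
move=> /fingen_hasdim[n [e [ie se]]]; exists n.
have vL : linear (fun v : 'rV[K]_n => lincomb e (v 0)).
  move=> a u v; rewrite /lincomb scaler_sumr -big_split; apply: eq_bigr => i _.
  by rewrite !mxE scalerDl scalerA.
have vi : injective (mklin vL : 'rV[K]_n -> kres P).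
  apply: lin_inj => v v0; apply/rowP => i; rewrite mxE.
  exact: (ie (v 0) v0 i).
have vs : surj (mklin vL : 'rV[K]_n -> kres P).
  move=> x; have [a ->] := se x; exists (\row_i a i).
  by apply: eq_bigr => i _; rewrite mxE.
by have [phi [h1 h2]] := lin_inv vi vs; exists phi, (mklin vL).
Qed.

(* [act] is the right action of End(P), so that [A] is End(P)^op. *)
Lemma endo_alg_ex : fingen P -> ~ zero_module P ->
  exists (A : falgType K) (act : A -> {linear P -> P}),
  [/\ forall a b x, act (a + b) x = act a x + act b x,
      forall k x, act (k%:A) x = (k%:A : L) *: x,
      forall a b x, act (a * b) x = act b (act a x),
      forall a b, (forall x, act a x = act b x) -> a = b &
      forall g : {linear P -> P}, exists a, forall x, act a x = g x].
Proof.
move=> fP nzP; have [[|n] [phi [vec [phiK vecK]]]] := coordinates_ex fP.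
  by case: nzP => x; rewrite -[x]phiK [phi x]thinmx0 linear0.
have sL (b : L) : linear (fun v : 'rV[K]_n.+1 => phi ((b *: (vec v : P)) : P)).
  move=> k u v; rewrite linearP scalerDr -linearP; congr (phi _).
  by rewrite !kresZ !scalerA kalg_comm.
pose sc b : 'M[K]_n.+1 := lin1_mx (mklin (sL b)).
have scE b v : v *m sc b = phi ((b *: (vec v : P)) : P) by rewrite mul_rV_lin1.
(* Endomorphisms are the matrices commuting with the action of a basis of [L], a centralizer in a
   matrix algebra. Matrices act on row vectors from the right, which reverses composition. *)
pose C := ('C(<<[seq sc b | b <- vbasis {: L}]>>))%AS.
pose A : falgType K := subvs_of C.
have C_basis (a : A) b : b \in vbasis {: L} -> vsval a *m sc b = sc b *m vsval a.
  move=> bL; have /centvP := subvsP a; apply.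
  by apply: memv_span; apply: map_f.
pose act0 (a : A) (x : P) : P := vec (phi (x : kres P) *m vsval a).
have act0K a : linear (act0 a : kres P -> kres P).
  by move=> k x y; rewrite /act0 linearP mulmxDl -scalemxAl linearP.
have act0L a : linear (act0 a).
  move=> b x y; have act0D u v : act0 a (u + v) = act0 a u + act0 a v.
    by have := act0K a 1 u v; rewrite !scale1r.
  rewrite act0D; congr (_ + _).
  have act00 : act0 a 0 = 0 by rewrite /act0 linear0 mul0mx linear0.
  have act0Z k u : act0 a ((k%:A : L) *: u) = (k%:A : L) *: act0 a u.
    by have := act0K a k u 0; rewrite !addr0 act00 addr0.
  have basis i : act0 a ((vbasis {: L})`_i *: x) = (vbasis {: L})`_i *: act0 a x.
    have [lt|ge] := ltnP i (size (vbasis {: L})); last first.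
      by rewrite nth_default // !scale0r act00.
    have := C_basis a _ (mem_nth 0 lt); set bi := _`_i => e.
    rewrite {1}/act0 -[x in bi *: x]phiK -scE -mulmxA -e mulmxA scE phiK.
    by [].
  rewrite {1}(coord_vbasis (memvf b)) scaler_suml.
  rewrite (big_morph (act0 a) act0D act00).
  rewrite [in RHS](coord_vbasis (memvf b)) scaler_suml; apply: eq_bigr => i _.
  by rewrite -mulr_algl -!scalerA act0Z basis.
exists A, (fun a => mklin (act0L a)); split.
- by move=> a b x; rewrite /= /act0 /= mulmxDr linearD.
- move=> k x; rewrite /= /act0 linearZ /= (unitr_algid1 (centv1 _)) ?unitr1 //.
  by rewrite mulmx1 linearZ /= phiK.
- by move=> a b x; rewrite /= /act0 /= vecK mulmxA.
- move=> a b e; apply: val_inj; apply: mx_ext => v.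
  have := e (vec v); rewrite /= /act0 vecK => /(congr1 phi).
  by rewrite !vecK.
- move=> g; have gL : linear (fun v : 'rV[K]_n.+1 => phi (g (vec v))).
    move=> k u v; rewrite -[RHS]linearP; congr (phi _).
    by rewrite linearP; apply: (linearP g).
  pose G : 'M[K]_n.+1 := lin1_mx (mklin gL).
  have GE v : v *m G = phi (g (vec v)) by rewrite mul_rV_lin1.
  have GC : G \in C.
    rewrite -subv_cent1; apply/span_subvP => _ /mapP[b bL ->].
    apply/cent1vP; apply: mx_ext => v.
    by rewrite -!mulmxE !mulmxA scE !GE scE !phiK linearZ.
  exists (vsproj C G) => x; rewrite /= /act0 vsprojK // GE !phiK //.
Qed.

End EndoAlgebra.

Definition generates (R : nzRingType) (W : subcategory R) (P : lmodType R) :=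
  forall X, W X -> exists n (p : 'I_n -> {linear P -> X}),
    forall x, exists y : 'I_n -> P, x = \sum_i p i (y i).

Section Powers.
Variables (R : nzRingType) (W : subcategory R) (hW : wide W).
Implicit Types M X P : lmodType R.

Lemma wide_ffun n X : W X -> W {ffun 'I_n -> X}.
Proof.
move=> WX; elim: n => [|n IHn].
  by apply: (wide_zero hW) => f; apply/ffunP => -[].
pose i : {linear X -> {ffun 'I_n.+1 -> X}} :=
  ftuple (fun j => if j == ord0 then (idfun : {linear X -> X}) else \0).
pose p : {linear {ffun 'I_n.+1 -> X} -> {ffun 'I_n -> X}} :=
  ftuple (fun j => fproj X (lift ord0 j)).
have iE x j : i x j = if j == ord0 then x else 0 by rewrite ffunE; case: ifP.
have pE a j : p a j = a (lift ord0 j) by rewrite ffunE.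
apply: (wide_ses hW (i := i) (p := p)) => //; split; first split.
- by move=> x y /ffunP/(_ ord0); rewrite !iE.
- move=> a; split=> [/ffunP pa|[x <-]].
    exists (a ord0); apply/ffunP => j; rewrite iE.
    by case: (unliftP ord0 j) => [k ->|-> //]; have := pa k; rewrite pE ffunE => ->.
  by apply/ffunP => j; rewrite pE iE ffunE.
- move=> b; exists [ffun j => if unlift ord0 j is Some k then b k else 0].
  by apply/ffunP => j; rewrite pE ffunE liftK.
Qed.

End Powers.

(** * The equivalence Hom(P, -) for a projective generator P *)

Section HomFunctor.
Variables (K : fieldType) (L : falgType K) (W : subcategory L) (hW : wide W).
Variables (P : lmodType L) (WP : W P) (hP : proj_in W P) (gP : generates W P).
Variables (A : falgType K) (act : A -> {linear P -> P}).
Hypotheses (actD : forall a b x, act (a + b) x = act a x + act b x)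
  (actK : forall k x, act (k%:A) x = (k%:A : L) *: x)
  (actM : forall a b x, act (a * b) x = act b (act a x))
  (act_inj : forall a b, (forall x, act a x = act b x) -> a = b)
  (act_full : forall g : {linear P -> P}, exists a, forall x, act a x = g x).
Implicit Types I M N X Y : lmodType L.

Lemma act1 x : act 1 x = x.
Proof. by have := actK 1 x; rewrite !scale1r. Qed.

Lemma act0 x : act 0 x = 0.
Proof. by apply: (addrI (act 0 x)); rewrite -actD !addr0. Qed.

Lemma act_sum n (a : 'I_n -> A) x : act (\sum_i a i) x = \sum_i act (a i) x.
Proof. exact: (big_morph (fun a => act a x) (fun a b => actD a b x) (act0 x)). Qed.

Definition hom_funspace X : funspace A P X.
Proof.
exists (fun a => act a) (fun f => linear f).
- by move=> k x y; rewrite scaler0 addr0.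
- by move=> f g hf hg k x y; rewrite hf hg scalerBr opprD addrACA.
- by move=> a f hf k x y; rewrite linearP hf.
- by move=> f d _; rewrite act1.
- by move=> f a b d hf; rewrite actD -[act a d]scale1r hf !scale1r.
- by move=> f a b d _; rewrite actM.
Defined.

Definition hmod X : lmodType A := funmod (hom_funspace X).

Definition hmod_lin X (f : hmod X) : {linear P -> X} := mklin (fm_in f).
Definition lin_hmod X (f : {linear P -> X}) : hmod X :=
  @Funmod _ _ _ (hom_funspace X) f (linearP f).

Lemma hmap_linear X Y (f : {linear X -> Y}) :
  linear (fun x : hmod X => lin_hmod (f \o hmod_lin x)).
Proof. by move=> a x y; apply: funmodP => d; rewrite /= linearD. Qed.
Definition hmap X Y (f : {linear X -> Y}) : {linear hmod X -> hmod Y} :=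
  mklin (hmap_linear f).

Lemma hmapE X Y (f : {linear X -> Y}) (x : hmod X) d : fm_fun (hmap f x) d = f (fm_fun x d).
Proof. by []. Qed.

Lemma hmod_sumE n X (f : 'I_n -> hmod X) d : fm_fun (\sum_i f i) d = \sum_i fm_fun (f i) d.
Proof. exact: fm_sumE. Qed.

Lemma hmodZE X a (f : hmod X) d : fm_fun (a *: f) d = fm_fun f (act a d).
Proof. by []. Qed.

Lemma hmodDE X (f g : hmod X) d : fm_fun (f + g) d = fm_fun f d + fm_fun g d.
Proof. by []. Qed.

Lemma fm_linD X (f : hmod X) : {morph fm_fun f : x y / x + y}.
Proof. exact: (linearD (hmod_lin f)). Qed.

Lemma fm_lin0 X (f : hmod X) : fm_fun f 0 = 0.
Proof. exact: (linear0 (hmod_lin f)). Qed.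

Lemma fm_lin_sum n X (f : hmod X) (y : 'I_n -> P) : fm_fun f (\sum_i y i) = \sum_i fm_fun f (y i).
Proof. exact: (big_morph (fm_fun f) (fm_linD f) (fm_lin0 f)). Qed.

Lemma hmod_fingen X : W X -> fingen (hmod X).
Proof.
move=> WX; have [m [F FP]] := hom_span (wide_fingen hW WP) (wide_fingen hW WX).
exists m, (fun j => lin_hmod (F j)) => x.
have [a aP] := FP (hmod_lin x); exists (fun j => (a j)%:A).
apply: funmodP => d; rewrite hmod_sumE -[fm_fun x d]/(hmod_lin x d) aP.
by apply: eq_bigr => j _; rewrite hmodZE /= actK linearZ.
Qed.

Lemma act_comps n (g : {linear P -> {ffun 'I_n -> P}}) :
  exists a : 'I_n -> A, forall x i, g x i = act (a i) x.
Proof.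
have /choice[a aP] : forall i, exists b, forall x, act b x = g x i.
  by move=> i; apply: (act_full (fproj P i \o g)).
by exists a => x i; rewrite aP.
Qed.

(* Hom(P, M) is generated by the [p i], and the relations between them come from
   [P] because the kernel of the sum of the [p i] is again generated by [P]. *)
Lemma hmap_full M N (e : {linear hmod M -> hmod N}) : W M -> W N ->
  exists f : {linear M -> N}, forall z, hmap f z = e z.
Proof.
move=> WM WN; have [n [p pP]] := gP WM.
have ps : surj (fsum p).
  move=> x; have [y ->] := pP x; exists [ffun i => y i].
  by apply: eq_bigr => i _; rewrite ffunE.
have WPn := wide_ffun hW n WP.
have [Kr [k kp]] := ses_of_surj ps.
have WK := wide_ses_sub hW kp WPn WM.
have [m [s sP]] := gP WK.
pose ep i := e (lin_hmod (p i)).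
have eE (a : 'I_n -> A) : e (\sum_i a i *: lin_hmod (p i)) = \sum_i a i *: ep i.
  by rewrite linear_sum; apply: eq_bigr => i _; rewrite linearZ.
have key (y : 'I_n -> P) : \sum_i p i (y i) = 0 -> \sum_i fm_fun (ep i) (y i) = 0.
  move=> y0; have [|z zP] := ses_ker (e := [ffun i => y i]) kp.
    by rewrite -y0; apply: eq_bigr => i _; rewrite ffunE.
  have [w wP] := sP z.
  have /choice[a aP] : forall l, exists b : 'I_n -> A, forall x i, k (s l x) i = act (b i) x.
    by move=> l; apply: (act_comps (k \o s l)).
  have a0 l : \sum_i a l i *: lin_hmod (p i) = 0.
    apply: funmodP => d; rewrite hmod_sumE.
    rewrite -[RHS](ses0 (s l d) kp); apply: eq_bigr => i _.
    by rewrite hmodZE -aP.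
  have yE i : y i = \sum_l act (a l i) (w l).
    have /ffunP/(_ i) := zP; rewrite ffunE => <-; rewrite wP linear_sum sum_ffunE.
    by apply: eq_bigr => l _; rewrite aP.
  under eq_bigr do rewrite yE fm_lin_sum.
  rewrite exchange_big big1 // => l _.
  have := congr1 (fun h : hmod N => fm_fun h (w l)) (eE (a l)).
  by rewrite /= a0 linear0 hmod_sumE => <-.
have [x|a x x' z z' [y [-> ->]] [y' [-> ->]]|z [y [/esym y0 ->]]|f fP] :=
  @lin_graph _ M N (fun x z => exists y : 'I_n -> P,
     x = \sum_i p i (y i) /\ z = \sum_i fm_fun (ep i) (y i)).
- by have [y ->] := pP x; exists (\sum_i fm_fun (ep i) (y i)), y.
- exists (fun i => a *: y i + y' i); split.
    by rewrite scaler_sumr -big_split; apply: eq_bigr => i _; rewrite linearP.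
  rewrite scaler_sumr -big_split; apply: eq_bigr => i _ /=.
  exact: (esym (fm_in (ep i) a (y i) (y' i))).
- exact: key.
(* By projectivity [z] lifts to [P^n], so it is an [A]-combination of the [p i], on which [e] and
   [hmap f] agree. *)
exists f => z; have [g gE] := hP (hmod_lin z) WPn WM ps.
have [a aP] := act_comps g.
have zE : z = \sum_i a i *: lin_hmod (p i).
  apply: funmodP => d; rewrite hmod_sumE -[LHS]/(hmod_lin z d) -gE.
  by apply: eq_bigr => i _; rewrite hmodZE -aP.
apply: funmodP => d; rewrite hmapE; have [y [e1 ->]] := fP (fm_fun z d).
rewrite [in RHS]zE eE hmod_sumE; apply/subr0_eq.
rewrite -sumrB -[RHS](key (fun i => y i - act (a i) d)).
  apply: eq_bigr => i _; rewrite hmodZE.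
  by rewrite -[fm_fun (ep i) (y i - _)]/(hmod_lin (ep i) _) linearB.
under eq_bigr do rewrite linearB.
by rewrite sumrB -e1 {1}zE hmod_sumE subrr.
Qed.

(** A presentation of [X] by powers of [A] becomes a map [tau] between powers of [P], and [M] is its
    cokernel. The relation [Rel] sends a combination of the generators of [X] to the corresponding
    map from [P] to [M]. *)
Lemma hmod_dense (X : lmodType A) : fingen X -> exists M, W M /\ iso (hmod M) X.
Proof.
move=> fX; have [n [g gE]] := fX.
have fAn : fingen ({ffun 'I_n -> A^o} : lmodType A).
  apply: fingen_ffun; exists 1%N, (fun=> 1 : A^o) => x; exists (fun=> x).
  by rewrite big_ord1 [RHS]mulr1.
have [Kr [k [k_inj kE]]] := ker_ex (lcomb g).
have [m [r rE]] := fingen_inj k_inj fAn.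
have rg l : \sum_i (k (r l) i : A) *: g i = 0.
  by have /kE : exists x, k x = k (r l) by exists (r l).
pose tau : {linear {ffun 'I_m -> P} -> {ffun 'I_n -> P}} :=
  ftuple (fun i => fsum (fun l => act (k (r l) i))).
have tauE w i : tau w i = \sum_l act (k (r l) i) (w l) by rewrite ffunE.
have [M [c [cs cE]]] := coker_ex tau.
have WPn := wide_ffun hW n WP; have WPm := wide_ffun hW m WP.
have WM : W M := wide_coker hW WPm WPn (conj cs cE).
pose Rel (x : X) (h : hmod M) := exists a : 'I_n -> A, x = \sum_i a i *: g i /\
  forall w, fm_fun h w = c [ffun i => act (a i) w].
have Rel_ex (a : 'I_n -> A) : exists h, Rel (\sum_i a i *: g i) h.
  by exists (lin_hmod (c \o ftuple (fun i => act (a i)))), a.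
have Rel_lin (a : A) x x' h h' : Rel x h -> Rel x' h' -> Rel (a *: x + x') (a *: h + h').
  move=> [b [-> hb]] [b' [-> hb']]; exists (fun i => a * b i + b' i); split.
    rewrite scaler_sumr -big_split; apply: eq_bigr => i _.
    by rewrite scalerDl scalerA.
  move=> w; rewrite hmodDE hmodZE hb hb' -linearD; congr (c _).
  by apply/ffunP => i; rewrite !ffunE actD actM.
have Rel0 h : Rel 0 h -> h = 0.
  move=> [a [/esym a0 ha]]; apply: funmodP => w; rewrite ha.
  have [z zE] : exists z, k z = [ffun i => a i : A^o].
    by apply/kE; rewrite -[RHS]a0; apply: eq_bigr => i _; rewrite ffunE.
  have [b bE] := rE z; apply/cE; exists [ffun l => act (b l) w].
  apply/ffunP => i; rewrite tauE ffunE.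
  have -> : a i = \sum_l b l * (k (r l) i : A).
    have /ffunP/(_ i) := zE; rewrite ffunE => <-; rewrite bE linear_sum sum_ffunE.
    by apply: eq_bigr => l _; rewrite linearZ ffunE.
  by rewrite act_sum; apply: eq_bigr => l _; rewrite ffunE actM.
have [x|//|//|al alP] := @lin_graph _ X (hmod M) Rel.
  by have [a ->] := gE x.
exists M; split=> //; apply: iso_sym; exists al; apply: inj_surj_bij.
  apply: lin_inj => x x0; have [a [xE ha]] := alP x; rewrite x0 in ha; rewrite xE.
  (* If the coefficients give the zero map to [M], they factor through the image of [tau] and lift
     to [P^m], so they are a combination of the relations [r l]. *)
  have [I [p [j [ps j_inj jp]]]] := im_ex tau.
  have WI := wide_im hW WPm WPn ps j_inj jp.
  have [|g' g'P] := lift_inj (f := ftuple (fun i => act (a i))) j_inj.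
    move=> w; have /cE[z <-] : c (ftuple (fun i => act (a i)) w) = 0 by rewrite -[LHS]ha.
    by exists (p z); rewrite jp.
  have [t tP] := hP g' WPm WI ps.
  have [b bP] := act_comps t.
  have aE i : a i = \sum_l b l * (k (r l) i : A).
    apply: act_inj => w; have := g'P w; rewrite -tP jp => /ffunP/(_ i).
    rewrite [RHS]ffunE => <-; rewrite tauE act_sum.
    by apply: eq_bigr => l _; rewrite actM bP.
  under eq_bigr do rewrite aE scaler_suml.
  rewrite exchange_big big1 // => l _.
  under eq_bigr do rewrite -scalerA.
  by rewrite -scaler_sumr rg scaler0.
move=> h; have [t tP] := hP (hmod_lin h) WPn WM cs.
have [a aP] := act_comps t; exists (\sum_i a i *: g i).
have R1 := alP (\sum_i a i *: g i).
have R2 : Rel (\sum_i a i *: g i) h.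
  exists a; split=> // w; rewrite -[LHS]/(hmod_lin h w) -tP; congr (c _).
  by apply/ffunP => i; rewrite aP ffunE.
apply/subr0_eq/Rel0; have := Rel_lin (-1) _ _ _ _ R2 R1.
by rewrite !scaleN1r addNr addrC.
Qed.

Lemma hmap_faithful M N (f g : {linear M -> N}) : W M ->
  (forall z, hmap f z = hmap g z) -> forall x, f x = g x.
Proof.
move=> WM e x; have [n [p pP]] := gP WM; have [y ->] := pP x.
rewrite !linear_sum; apply: eq_bigr => i _.
by have := congr1 (fun h : hmod N => fm_fun h (y i)) (e (lin_hmod (p i))).
Qed.

Lemma hom_equivalence : exists F : equivalence W A, True.
Proof.
unshelve refine (ex_intro _ (@Equivalence K L W A (fun a => hmod (sval a))
  (fun a b f => hmap f) _ _ _ _ _ _ _) I).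
- by move=> [M WM]; apply: hmod_fingen.
- by move=> [M WM] f /= e z; apply: funmodP => d; rewrite hmapE e.
- move=> [M WM] [N WN] [Q WQ] f g h /= e z; apply: funmodP => d.
  by rewrite !hmapE e.
- move=> [M WM] [N WN] k f g h /= e z; apply: funmodP => d.
  by rewrite hmodDE hmodZE !hmapE e actK -[fm_fun z (_ *: _)]/(hmod_lin z _) !linearZ.
- by move=> [M WM] [N WN] f g; apply: hmap_faithful.
- by move=> [M WM] [N WN] e; apply: hmap_full.
- by move=> X /hmod_dense[M [WM MX]]; exists (exist _ M WM).
Qed.

End HomFunctor.

(** * Existence of the translate in a wide subcategory *)

Section TauExistence.
Variables (K : fieldType) (L : falgType K).
Implicit Types A C I M N P Q X Y Z : lmodType L.
Variables (rho : lmodType L -> nat) (bound dmax : nat).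
Hypothesis D : directing rho bound dmax.
Variables (W : subcategory L) (hW : wide W).

Lemma sums_span P Q : sums P Q -> exists n (p : 'I_n -> {linear P -> Q}),
  forall x, exists y : 'I_n -> P, x = \sum_i p i (y i).
Proof.
elim=> [Z Z0|Q' _ [n [p pP]]].
  by exists 0%N, (fun=> \0) => x; exists (fun=> 0); rewrite big_ord0 [LHS]Z0.
pose F i : {linear P -> (P * Q')%type} :=
  if unlift ord0 i is Some j then inr_lin P Q' \o p j else inl_lin P Q'.
have F0 x : F ord0 x = inl_lin P Q' x by rewrite /F unlift_none.
have FS i x : F (lift ord0 i) x = inr_lin P Q' (p i x) by rewrite /F liftK.
exists n.+1, F => -[u v]; have [y ->] := pP v.
pose z i := if unlift ord0 i is Some j then y j else u.
have z0 : z ord0 = u by rewrite /z unlift_none.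
have zS i : z (lift ord0 i) = y i by rewrite /z liftK.
exists z; rewrite big_ord_recl F0 z0. under [X in _ = _ + X]eq_bigr do rewrite FS zS.
rewrite -[X in _ = _ + X](linear_sum (inr_lin P Q')).
by congr (_, _); rewrite /= ?addr0 ?add0r.
Qed.

(** A projective with a nonzero map to every indecomposable of [W] is assembled along the values of
    [rho]. It generates: a nonzero map to an indecomposable summand of the cokernel of its trace
    would lift to [X] and land in the trace. *)
Lemma generator_ex : exists P, [/\ W P, proj_in W P & generates W P].
Proof.
have [P [WP hP PP]] : exists P, [/\ W P, proj_in W P &
    forall Z, W Z -> fgindec Z -> (rho Z < bound)%N ->
      exists f : {linear P -> Z}, nonzero_map f].
  elim: bound => [|k [P [WP hP PP]]].
    have [Z Z0] := zero_module_ex L; exists Z; split=> //.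
      exact: (wide_zero hW Z0).
    by move=> X Y p f _ _ _; exists \0 => x; rewrite [x]Z0 !linear0.
  have [[Z [WZ iZ rZ]]|nZ] := pselect (exists Z, [/\ W Z, fgindec Z & rho Z = k]).
    have [Q [h [WQ hQ hs]]] := enough_proj D hW WZ.
    exists (P * Q)%type; split; [exact: wide_prod|exact: proj_in_prod|].
    move=> Y WY iY; rewrite ltnS leq_eqVlt => /orP[/eqP rY|lt].
      have [a [b [aK bK]]] := isoP (rho_iso D iY iZ (etrans rY (esym rZ))).
      have [y ny] := fgindec_nz iY; have [x hx] := hs (a y).
      by exists (b \o h \o snd), (0, x); rewrite /= hx aK.
    have [f [x fx]] := PP Y WY iY lt.
    by exists (f \o fst), (x, 0).
  exists P; split=> // Y WY iY; rewrite ltnS leq_eqVlt => /orP[/eqP rY|lt].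
    by case: nZ; exists Y.
  exact: PP.
exists P; split=> // X WX.
have [Q [h [sQ hQ]]] := right_approx_ex (wide_fingen hW WP) (wide_fingen hW WX).
have WQ := sums_wide hW WP sQ.
have hs : surj h.
  have [C [c cc]] := coker_ex h; have [cs cP] := cc.
  have WC : W C := wide_coker hW WQ WX cc.
  apply: contrapT => nhs.
  have nzC : nonzero_map (idfun : {linear C -> C}).
    by apply: nonzero_mapP => C0; apply: nhs => x; apply/cP; apply: C0.
  have [A [s [r [iA sK _]]]] := indec_source (wide_fingen hW WC) nzC.
  have WA := wide_retract hW sK WC.
  have [f [x fx]] := PP A WA iA (rho_bound D iA).
  have [g gE] := hP _ _ c (s \o f) WX WC cs.
  have [g' g'E] := hQ g.
  apply: fx; apply: (can_inj sK); rewrite linear0 -[s _]/((s \o f) x) -gE -g'E.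
  by apply/cP; exists (g' x).
have [n [p pP]] := sums_span sQ; exists n, (fun i => h \o p i) => x.
have [z <-] := hs x; have [y ->] := pP z; exists y.
by rewrite linear_sum.
Qed.

(** [tau_perp] and [tau_rigid_in] ask for some translate, so [tau_in_qext] alone does not identify
    [tau_perp] with [perp]. *)
Lemma tau_in_ex M : W M -> ~ zero_module M -> exists N, is_tau_in W M N.
Proof.
move=> WM nzM; have [P [WP hP gP]] := generator_ex.
have nzP : ~ zero_module P.
  move=> P0; apply: nzM => x; have [n [p pP]] := gP M WM; have [y ->] := pP x.
  by rewrite big1 // => i _; rewrite [y i]P0 linear0.
have [A [act [h1 h2 h3 h4 h5]]] := endo_alg_ex (wide_fingen hW WP) nzP.
have [F _] := hom_equivalence hW WP hP gP h1 h2 h3 h4 h5.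
have fFM := eq_fingen F (exist _ M WM).
have [N0 tN0] := tau_ex fFM.
have [[N WN] /iso_sym Nb] := eq_dense F (tau_fingen fFM tN0).
by exists N, A, F, WM, WN; apply: tau_iso tN0.
Qed.

End TauExistence.

(** * Identification with the brick labeling defined by tau-rigid modules *)

Section Labeling.
Variables (K : fieldType) (L : falgType K).
Implicit Types M N X : lmodType L.
Variables (rho : lmodType L -> nat) (bound dmax : nat).
Hypothesis D : directing rho bound dmax.

Lemma tau_perpE (W : subcategory L) M X : wide W -> W M -> fgindec M ->
  tau_perp W M X <-> perp W M X.
Proof.
move=> hW WM iM; split=> [[WX MX [N tN XN]]|[WX MX qX]].
  by split=> //; apply/(tau_in_qext hW tN WX).
split=> //; have [N tN] := tau_in_ex D hW WM iM.2.1.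
by exists N => //; apply/(tau_in_qext hW tN WX).
Qed.

Lemma fgindec_tau_rigid (W : subcategory L) M : wide W -> W M -> fgindec M ->
  tau_rigid_in W M.
Proof.
move=> hW WM iM; split=> //; first exact: fgindec_basic.
have [N tN] := tau_in_ex D hW WM iM.2.1; exists N => //.
by apply/(tau_in_qext hW tN WM); apply: (qext_rigid D).
Qed.

Lemma brick_labelP : is_brick_labeling (brick_label D).
Proof.
move=> U W h; have [[WM iM _] UE] := label_ofP D h; set M := label_of D h in WM iM UE *.
have hW := svalP W; have UP X : sval U X <-> perp (sval W) M X by rewrite {1}UE.
exists M; split.
- split; [exact: iM.2|exact: fgindec_tau_rigid|].
  by move=> X; rewrite UP tau_perpE.
- move=> M' [iM' [WM' _ _] UM'].
  have iM1 : fgindec M' by split=> //; apply: wide_fingen hW _ WM'.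
  apply: (perp_inj D hW) => // V /UP /UM'.
  by rewrite tau_perpE.
- by exists M; [apply: (is_beta_fgindec D)|apply: iso_refl].
Qed.

End Labeling.

Theorem theorem1 (K : fieldType) (Lambda : falgType K)
    (hbasic : basic_algebra Lambda) (hdir : representation_directed Lambda) :
  exists leB : relation (brick_class Lambda),
    Relation_Definitions.order (brick_class Lambda) leB /\
    exists lam : labeling (brick_class Lambda) (@wide_le Lambda),
      is_brick_labeling lam /\ EL_labeling leB lam.
Proof.
have [rho [bound [dmax D]]] := directing_ex hdir.
exists (brick_le rho); split; first exact: (brick_le_order D).
exists (brick_label D); split; first exact: brick_labelP.
exact: (brick_label_EL D).
Qed.
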